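(* Let $n>m\ge 1$, let $C$ be an $m$-dimensional polytopal complex in $\mathbb{R}^n$ and let $\omega$ be an equilibrium force-load on the associated $m$-framework $\mathcal{F}_C$. Fix $\ell_0\in\mathrm{Gr}(n-m-1,n)$ which does not intersect the convex hull of $\mathcal{F}_C$ (i.e. of the polytopes of $C$), and let $\ell\in\mathrm{Gr}(n-m-1,n)$ be arbitrary. Then the lifting $$L_{\mathcal{F}_C,\omega,H}(\ell)=\sum_{f\in F_C}\mu(H,f)\cdot\omega_f\cdot\operatorname{dist}(\ell,f)$$ does not depend on the choice of an $\mathcal{F}_C$-simple path $H$ from $\ell_0$ to $\ell$.
   Context: $m$-frameworks. ''Plane'' means affine subspace of $\mathbb{R}^n$. An $m$-framework $\mathcal{F}=(E,F,I,\mathbf{n})$ consists of a collection $E$ of $(m-1)$-dimensional planes in $\mathbb{R}^n$, a collection $F$ of $m$-dimensional planes, a subset $I\subset\{(e,f)\in E\times F\mid e\subset f\}$, and a function $\mathbf{n}$ assigning to each $(e,f)\in I$ a unit vector $\mathbf{n}(e,f)$ contained in $f$ and orthogonal to $e$. A force-load is a function $\omega:F\to\mathbb{R}$; it is an equilibrium force-load if $\sum_{(e,f)\in I}\omega(f)\,\mathbf{n}(e,f)=0$ for every $e\in E$. Polytopal complexes. An $m$-dimensional polytope is the convex hull of a finite set of points spanning an $m$-dimensional space; its $(m-1)$-dimensional faces are its facets. Consider a finite collection $F$ of $m$-dimensional polytopes in $\mathbb{R}^n$ such that the intersection of polytopes in the collection is either a facet or a $q$-dimensional polytope with $q\le m-2$.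 Let $E$ be the collection of all facets of polytopes in $F$ (equal facets of distinct polytopes are identified), and require that the planes of any two facets in $E$ are distinct. Then $C=(F,E)$ is an $m$-dimensional polytopal complex. The associated $m$-framework $\mathcal{F}_C=(E_C,F_C,I_C,\mathbf{n})$ has: $E_C$ the planes spanned by facets in $E$; $F_C$ the planes spanned by polytopes in $F$; $I_C$ the pairs $(e,f)$ for which the facet $e$ is a facet of the polytope $f$; and $\mathbf{n}(e,f)$ the unit vector contained in $f$, orthogonal to $e$, pointing to the interior of the polytope. Write $\omega_f=\omega(f)$. When speaking of intersections of a plane with $\mathcal{F}_C$ or with an $m$-dimensional face $f$ of $\mathcal{F}_C$, the polytopes of $C$ are meant. Grassmannian. $\mathrm{Gr}(k,n)$ is the affine Grassmannian of oriented $k$-dimensional affine planes in $\mathbb{R}^n$, with its natural smooth structure (from Plücker coordinates). Every face $f$ is given a fixed orientation. Distance. For an oriented plane $\pi_1$ spanned by points $(p_1,\dots,p_a)$ and an oriented plane $\pi_2$ spanned by $(q_1,\dots,q_b)$ in $\mathbb{R}^{n}$ with $a+b-1=n$, $$\operatorname{dist}(\pi_1,\pi_2)=\frac{\det(q_2-q_1,\dots,q_b-q_1,\;p_1-q_1,\dots,p_a-q_1)}{\det(q_2-q_1,\dots,q_b-q_1)\cdot\det(p_2-p_1,\dots,p_a-p_1)},$$ where the points are chosen compatibly with the orientations and the determinants in the denominator denote the volumes of the parallelepipeds spanned by the given vectors within their linear spans. For $\ell\in\mathrm{Gr}(n-m-1,n)$ one has $a=n-m$, and for an $m$-dimensional face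 $f$ (its plane) $b=m+1$. Simple paths. A differentiable path $H$ in $\mathrm{Gr}(n-m-1,n)$ is $\mathcal{F}_C$-simple if it intersects $\mathcal{F}_C$ only finitely many times and each of the intersections, except at the very last point of the path, is in the interior of some $m$-dimensional face and is transversal to this face. The last plane in the path can be arbitrary. Signs. The sign of a crossing of $H$ with an $m$-dimensional face $f$ is $\operatorname{sign}\big(\frac{\partial}{\partial t}\operatorname{dist}(H(t),f)\big)$ at the crossing time. The sign multiplicity $\mu(H,f)$ is the sum of the signs of all crossings of $H$ with $f$ (and is $0$ if there are none). *)

(* Defs.v *)
(* Points and vectors of R^n are row vectors
   'rV[R]_n; a tuple of k points is a k x n matrix, one point per row. *)
From HB Require Import structures.
From mathcomp Require Import all_boot all_order all_algebra.
From mathcomp Require Import all_classical all_reals all_analysis.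

Set Implicit Arguments.
Unset Strict Implicit.
Unset Printing Implicit Defensive.

Import Order.TTheory GRing.Theory Num.Theory.
Import numFieldNormedType.Exports.

Local Open Scope classical_set_scope.
Local Open Scope ring_scope.
Local Open Scope quotient_scope.

Section Euclidean.
Variables (R : realType) (n : nat).
Implicit Types (A P S : set 'rV[R]_n).

Definition dot (u v : 'rV[R]_n) : R := (u *m v^T) 0 0.

Definition affine_set A :=
  forall x y (t : R), A x -> A y -> A ((1 - t) *: x + t *: y).

Definition affhull S : set 'rV[R]_n := smallest affine_set S.

Definition convhull S : set 'rV[R]_n := smallest (@convex_set R 'rV[R]_n) S.

(* Interior relative to the affine hull. *)
Definition relint A : set 'rV[R]_n :=
  [set x | A x /\ \forall y \near x, affhull A y -> A y].

(* The points p_i are replaced by (1, p_i) in R^(1+n): affine combinations of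
   the points become linear combinations whose first coordinate is 1. *)
Definition homog k (p : 'M[R]_(k, n)) : 'M[R]_(k, 1 + n) :=
  row_mx (const_mx 1) p.

Definition aff_indep k (p : 'M[R]_(k, n)) := row_free (homog p).

Definition span_pts k (p : 'M[R]_(k, n)) : set 'rV[R]_n :=
  [set x | (homog x <= homog p)%MS].

Definition is_plane k A :=
  exists2 p : 'M[R]_(k.+1, n), aff_indep p & A = span_pts p.

Definition is_polytope k A :=
  exists S, [/\ finite_set S, is_plane k (affhull S) & A = convhull S].

(* A face is the set where a linear inequality valid on P becomes an
   equality. *)
Definition is_face P A :=
  exists (u : 'rV[R]_n) (b : R), (forall x, P x -> dot u x <= b) /\
    A = P `&` [set x | dot u x = b].

Definition is_facet k P A := is_face P A /\ is_plane k.-1 (affhull A).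

End Euclidean.

(* The affine Grassmannian of oriented k-planes in R^n: classes of affinely
   independent (k+1)-tuples of points, two tuples being identified when they are
   related by a matrix of positive determinant on homogeneous coordinates. *)
Section Grassmannian.
Variables (R : realType) (k n : nat).

Definition aframe := {p : 'M[R]_(k.+1, n) | aff_indep p}.

Definition same_oplane (p q : aframe) : bool :=
  `[< exists2 A : 'M[R]_k.+1, 0 < \det A & homog (val q) = A *m homog (val p) >].

Lemma same_oplane_refl : reflexive same_oplane.
Proof. by move=> p; apply/asboolP; exists 1%:M; rewrite ?det1 ?mul1mx. Qed.

Lemma same_oplane_sym : symmetric same_oplane.
Proof.
suff S p q : same_oplane p q -> same_oplane q p by move=> p q; apply/idP/idP=> /S.
move=> /asboolP[A dA eA]; apply/asboolP; exists (invmx A).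
  by rewrite det_inv invr_gt0.
by rewrite eA mulKmx // unitmxE unitfE gt_eqF.
Qed.

Lemma same_oplane_trans : transitive same_oplane.
Proof.
move=> q p r /asboolP[A dA eA] /asboolP[B dB eB]; apply/asboolP.
by exists (B *m A); rewrite ?det_mulmx ?mulr_gt0 // -mulmxA -eA.
Qed.

Canonical same_oplane_equiv :=
  EquivRel same_oplane same_oplane_refl same_oplane_sym same_oplane_trans.

Definition gr := {eq_quot same_oplane_equiv}.

Definition points (l : gr) : 'M[R]_(k.+1, n) := val (repr l).

Definition plane (l : gr) : set 'rV[R]_n := span_pts (points l).

End Grassmannian.

Section Distance.
Variable R : realType.

(* The vectors p_2 - p_1, ..., p_(k+1) - p_1. *)
Definition directions k n (p : 'M[R]_(k.+1, n)) : 'M[R]_(k, n) :=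
  \matrix_(i < k) (row (lift ord0 i) p - row ord0 p).

(* Volume of the parallelepiped spanned by the rows within their span. *)
Definition vol k n (V : 'M[R]_(k, n)) : R := Num.sqrt (\det (V *m V^T)).

(* [conform_mx] reads the (k2 + (k1 + 1)) x n matrix as a square one; it is only
   meaningful when k2 + (k1 + 1) = n. *)
Definition dist k1 k2 n (l1 : gr R k1 n) (l2 : gr R k2 n) : R :=
  let p := points l1 in let q := points l2 in
  let M := col_mx (directions q) (\matrix_(i < k1.+1) (row i p - row ord0 q)) in
  \det (conform_mx (0 : 'M[R]_n) M) / (vol (directions q) * vol (directions p)).

(* Plücker coordinates: the maximal minors of the homogeneous coordinates, with
   the positive factor that depends on the spanning points normalized away. *)
Definition pluecker k n (l : gr R k n) (c : 'I_k.+1 -> 'I_(1 + n)) : R :=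
  \det (colsub c (homog (points l))) / vol (directions (points l)).

(* A differentiable path parametrized by [0, 1]. Such a path extends
   differentiably beyond its ends, so it is given as a map on R that is
   differentiable at the points of [0, 1]; only its values there matter. *)
Definition differentiable_path k n (H : R -> gr R k n) :=
  forall (t : R) c, 0 <= t <= 1 -> derivable (fun s => pluecker (H s) c) t 1.

(* Transversality at time t to the plane f, at the common point x of H(t) and f:
   the track of the moving plane, (s, c) |-> c *m p(s) for differentiable
   spanning points p(s) of H(s), has at x tangent directions which together with
   those of f fill R^n. These directions are those of H(t) and the velocity of
   the point with the barycentric coordinates c of x. *)
Definition transversal_at k n (H : R -> gr R k n) (t : R) (x : 'rV[R]_n)
    (f : set 'rV[R]_n) :=
  exists (p : R -> aframe R k n) (c : 'rV[R]_k.+1),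
    [/\ \forall s \near t, \pi_(gr R k n) (p s) = H s,
        derivable (fun s => val (p s)) t 1,
        homog x = c *m homog (val (p t)) &
        forall v, exists (a : R) (d1 d2 : 'rV[R]_n),
          [/\ plane (H t) (x + d1), f (x + d2) &
              v = a *: (c *m 'D_1 (fun s => val (p s)) t) + d1 + d2]].

End Distance.

(* The collections of planes are indexed families. *)
Record mframework (R : realType) (m n : nat) := MFramework {
  fw_E : Type;
  fw_F : finType;
  fw_eplane : fw_E -> set 'rV[R]_n;
  fw_fplane : fw_F -> set 'rV[R]_n;
  fw_eplaneP : forall e, is_plane m.-1 (fw_eplane e);
  fw_fplaneP : forall f, is_plane m (fw_fplane f);
  fw_I : fw_E -> pred fw_F;
  fw_IP : forall e f, fw_I e f -> fw_eplane e `<=` fw_fplane f;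
  fw_n : fw_E -> fw_F -> 'rV[R]_n;
  fw_n_unit : forall e f, fw_I e f -> dot (fw_n e f) (fw_n e f) = 1;
  fw_n_in : forall e f, fw_I e f ->
    forall x, fw_fplane f x -> fw_fplane f (x + fw_n e f);
  fw_n_orth : forall e f, fw_I e f ->
    forall x y, fw_eplane e x -> fw_eplane e y -> dot (fw_n e f) (y - x) = 0
}.

Definition force_load (R : realType) m n (Fr : mframework R m n) :=
  fw_F Fr -> R.

Definition equilibrium (R : realType) m n (Fr : mframework R m n)
    (w : force_load Fr) :=
  forall e : fw_E Fr, \sum_(f | fw_I e f) w f *: fw_n e f = 0.

(* The empty set counts as a polytope of dimension -1. *)
Record pcomplex (R : realType) (m n : nat) := PComplex {
  face : finType;
  body : face -> set 'rV[R]_n;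
  bodyP : forall f, is_polytope m (body f);
  body_meet : forall f g, f != g ->
    [\/ is_facet m (body f) (body f `&` body g),
        body f `&` body g = set0 |
        exists2 q, (q.+2 <= m)%N & is_polytope q (body f `&` body g)];
  facet_planes : forall f g (A B : set 'rV[R]_n),
    is_facet m (body f) A -> is_facet m (body g) B ->
    affhull A = affhull B -> A = B
}.

Section Complex.
Variables (R : realType) (m n : nat) (C : pcomplex R m n).

Definition facet := {e : set 'rV[R]_n | exists f : face C, is_facet m (body f) e}.

Definition incident (e : facet) : pred (face C) :=
  fun f => `[< is_facet m (body f) (sval e) >].

(* The conditions determine the vector. *)
Definition inner_normal (e : facet) (f : face C) (u : 'rV[R]_n) :=
  [/\ dot u u = 1,
      forall x, affhull (body f) x -> affhull (body f) (x + u),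
      forall x y, affhull (sval e) x -> affhull (sval e) y -> dot u (y - x) = 0 &
      forall x, relint (sval e) x ->
        \forall s \near (0 : R)^'+, relint (body f) (x + s *: u)].

Definition inner_normals (nu : facet -> face C -> 'rV[R]_n) :=
  forall e f, incident e f -> inner_normal e f (nu e f).

Lemma convex_set_affine (A : set 'rV[R]_n) :
  affine_set A -> @convex_set R 'rV[R]_n A.
Proof.
move=> aA x y t; rewrite !inE => Ax Ay.
have := aA y x t%:num Ay Ax.
by rewrite addrC.
Qed.

Lemma affhull_affine (S : set 'rV[R]_n) : affine_set (affhull S).
Proof. by move=> x y t Sx Sy A AS; apply: AS.1; [apply: Sx|apply: Sy]. Qed.

Lemma affhull_mono (S T : set 'rV[R]_n) :
  S `<=` T -> affhull S `<=` affhull T.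
Proof. by move=> ST x Sx A [aA TA]; apply: Sx; split=> // y /ST /TA. Qed.

Lemma affhull_convhull (S : set 'rV[R]_n) : affhull (convhull S) = affhull S.
Proof.
apply/seteqP; split; last by apply: affhull_mono; exact: sub_gen_smallest.
apply: smallest_sub; first exact: affhull_affine.
apply: smallest_sub; last exact: sub_gen_smallest.
by apply: convex_set_affine; exact: affhull_affine.
Qed.

Variables (nu : facet -> face C -> 'rV[R]_n) (hnu : inner_normals nu).

Lemma facet_planeP (e : facet) : is_plane m.-1 (affhull (sval e)).
Proof. by case: e => e [f []]. Qed.

Lemma face_planeP (f : face C) : is_plane m (affhull (body f)).
Proof. by have [S [_ pS ->]] := bodyP f; rewrite affhull_convhull. Qed.

Lemma incidentP (e : facet) (f : face C) :
  incident e f -> affhull (sval e) `<=` affhull (body f).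
Proof.
by move=> /asboolP[[u [b [_ ->]]] _]; apply: affhull_mono => x [].
Qed.

Lemma nu_unit (e : facet) (f : face C) :
  incident e f -> dot (nu e f) (nu e f) = 1.
Proof. by move=> /hnu[]. Qed.

Lemma nu_in (e : facet) (f : face C) : incident e f ->
  forall x, affhull (body f) x -> affhull (body f) (x + nu e f).
Proof. by move=> /hnu[]. Qed.

Lemma nu_orth (e : facet) (f : face C) : incident e f ->
  forall x y, affhull (sval e) x -> affhull (sval e) y -> dot (nu e f) (y - x) = 0.
Proof. by move=> /hnu[]. Qed.

(* The planes of the m-faces are indexed by the polytopes themselves, so that
   coplanar polytopes remain distinct members of the collection. *)
Definition complex_framework : mframework R m n :=
  MFramework facet_planeP face_planeP incidentP nu_unit nu_in nu_orth.

End Complex.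

Section Lifting.
Variables (R : realType) (m n k : nat) (C : pcomplex R m n).
Variable o : face C -> gr R m n.

(* A fixed choice of orientation of each face. *)
Definition orientation := forall f, plane (o f) = affhull (body f).

Definition meets_face (l : gr R k n) (f : face C) := plane l `&` body f !=set0.

(* Every common point with a polytope at a time t < 1, not just one of them, is a
   transversal intersection with the interior of that polytope. *)
Record simple_path (H : R -> gr R k n) (l0 l : gr R k n) : Prop := SimplePath {
  sp_start : H 0 = l0;
  sp_end : H 1 = l;
  sp_diff : differentiable_path H;
  sp_finite : finite_set [set t | 0 <= t <= 1 /\ exists f, meets_face (H t) f];
  sp_crossing : forall (t : R) (f : face C) (x : 'rV[R]_n), 0 <= t < 1 ->
    plane (H t) x -> body f x ->
    relint (body f) x /\ transversal_at H t x (affhull (body f))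
}.

Definition crossing_sign (H : R -> gr R k n) (f : face C) (t : R) : R :=
  Num.sg (derive1 (fun s => dist (H s) (o f)) t).

(* An intersection with f at the final time 1 is counted as well; it does not
   affect [lifting], since then dist l f = 0. *)
Definition sign_mult (H : R -> gr R k n) (f : face C) : R :=
  \sum_(t \in [set t | 0 <= t <= 1 /\ meets_face (H t) f]) crossing_sign H f t.

Definition lifting (w : face C -> R) (H : R -> gr R k n) (l : gr R k n) : R :=
  \sum_(f : face C) sign_mult H f * w f * dist l (o f).

End Lifting.

(* Main.v *)
Require Import Defs.
From mathcomp Require Import all_boot all_order all_algebra.
From mathcomp Require Import all_classical all_reals all_analysis.
From mathcomp Require Import generic_quotient ring lra.

Set Implicit Arguments.
Unset Strict Implicit.
Unset Printing Implicit Defensive.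

Import Order.TTheory GRing.Theory Num.Theory.
Import numFieldNormedType.Exports.

Local Open Scope classical_set_scope.
Local Open Scope ring_scope.

(** The lifting is the difference of a linking number at the two ends of the
    path.

    In homogeneous coordinates an affine plane of dimension k is a linear
    subspace of dimension k + 1, a point of the plane being a vector of the
    subspace whose first coordinate is 1, and a polytope becomes a finitely
    generated cone.  If Q and P are frames of the face f and of the plane H(t),
    then dist(H(t), f) is, up to a positive factor, the determinant of Q stacked
    on P ([dist_incline]).

    Fix the end plane l and give the face f the weight omega_f * dist(l, f).
    When f is oriented by its inner normal u at a facet e followed by a fixed
    frame of e, its distance from l is a linear function of u, the same for all
    faces at e.  So the equilibrium at e says that the weighted oriented faces
    have no boundary at e ([incidence_balance]): they form a cycle.

    Let L be the linear subspace of a plane that meets no face of nonzero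
    weight.  Modulo L, which has complementary dimension, the cones over the
    faces form a cycle in a space of their own dimension.  The number of times
    this cycle covers a vector v, each face counted with its weight and its
    orientation, is the [degree].  It is the same for all v off the images of
    the boundaries of the cones ([degree_constant]): along a segment from one
    such v to another, the contribution of a face changes when the segment
    crosses a facet of its cone ([facet_count]), and the changes at each facet
    cancel by the balance.  This needs a segment in general position and faces
    that project isomorphically, both of which a small perturbation provides.

    For a fixed v the degree is locally constant in L ([local_degree_near]), and
    when L passes transversally through an interior point of a face it changes
    by the weight of the face times the sign of the derivative of its distance
    ([local_degree_crossing], [transversal_crossing]).  Along a simple path the
    degree therefore grows by the sum over f and over the crossings of f of
    omega_f * dist(l, f) times the sign of the crossing, which is the lifting
    ([lifting_linking_value]).  The degree at either end depends on the end plane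
    alone.  At the last plane it is well defined, although l may meet
    faces in any way: a face that meets l has distance 0 from it, hence weight 0
    ([weight_meets]). *)

(** * Finitely generated cones *)

Section Cone.
Variable R : realType.

Definition nonneg s (c : 'rV[R]_s) := forall i, 0 <= c 0 i.

Definition cone s p (B : 'M[R]_(s, p)) : set 'rV[R]_p :=
  [set a | exists2 c, nonneg c & a = c *m B].

(** The interior, in the form that scalar estimates along one direction can
    establish; it is the topological interior by [nbhs_rint] and [rint_nbhs]. *)
Definition rint s p (B : 'M[R]_(s, p)) : set 'rV[R]_p :=
  [set a | forall z, \forall e \near 0^'+, cone B (a + e *: z)].

Definition subrows s p (B : 'M[R]_(s, p)) (I : {set 'I_s}) : 'M[R]_(#|I|, p) :=
  rowsub (@enum_val _ (mem I)) B.

Definition pairing p (a : 'rV[R]_p) (h : 'cV[R]_p) : R := (a *m h) 0 0.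

Definition supporting s p (B : 'M[R]_(s, p)) (h : 'cV[R]_p) :=
  h != 0 /\ forall i, 0 <= (B *m h) i 0.

Lemma pairingD p (a b : 'rV[R]_p) h : pairing (a + b) h = pairing a h + pairing b h.
Proof. by rewrite /pairing mulmxDl mxE. Qed.

Lemma pairingZ p (a : 'rV[R]_p) t h : pairing (t *: a) h = t * pairing a h.
Proof. by rewrite /pairing -scalemxAl mxE. Qed.

Lemma pairingN p (a : 'rV[R]_p) h : pairing (- a) h = - pairing a h.
Proof. by rewrite /pairing mulNmx mxE. Qed.

Lemma pairing_eq0 p (a : 'rV[R]_p) h : (pairing a h = 0) <-> (a *m h = 0).
Proof.
split=> [H|H]; last by rewrite /pairing H mxE.
by apply/matrixP=> i j; rewrite !ord1 [RHS]mxE.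
Qed.

Lemma pairing_neq0 p (h : 'cV[R]_p) : h != 0 -> exists z, pairing z h = 1.
Proof.
move=> h0; have [i hi] : exists i, h i 0 != 0.
  apply: contrapT => H; move/eqP: h0; apply; apply/matrixP=> i j.
  rewrite ord1 mxE; apply: contrapT => /eqP hi; apply: H; by exists i.
exists ((h i 0)^-1 *: delta_mx 0 i); rewrite pairingZ /pairing -rowE mxE.
by rewrite mulVf.
Qed.

Lemma pairing_cone s p (B : 'M[R]_(s, p)) c h :
  pairing (c *m B) h = \sum_i c 0 i * (B *m h) i 0.
Proof. by rewrite /pairing -mulmxA mxE. Qed.

Lemma cone_supporting s p (B : 'M[R]_(s, p)) h a :
  supporting B h -> cone B a -> 0 <= pairing a h.
Proof.
move=> [_ Bh] [c c0 ->]; rewrite pairing_cone sumr_ge0 // => i _.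
by rewrite mulr_ge0.
Qed.

Lemma coneD s p (B : 'M[R]_(s, p)) a b : cone B a -> cone B b -> cone B (a + b).
Proof.
move=> [c c0 ->] [d d0 ->]; exists (c + d); last by rewrite mulmxDl.
by move=> i; rewrite mxE addr_ge0.
Qed.

Lemma coneZ s p (B : 'M[R]_(s, p)) a t : 0 <= t -> cone B a -> cone B (t *: a).
Proof.
move=> t0 [c c0 ->]; exists (t *: c); last by rewrite scalemxAl.
by move=> i; rewrite mxE mulr_ge0.
Qed.

Lemma cone_convex s p (B : 'M[R]_(s, p)) a b t :
  0 <= t -> t <= 1 -> cone B a -> cone B b -> cone B ((1 - t) *: a + t *: b).
Proof. by move=> t0 t1 Ca Cb; apply: coneD; apply: coneZ; rewrite ?subr_ge0. Qed.

Lemma rint_cone s p (B : 'M[R]_(s, p)) a : rint B a -> cone B a.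
Proof.
move=> /(_ 0) /filter_ex[e]; by rewrite scaler0 addr0.
Qed.

(** A small move in the direction -z, where pairing z h = 1, lowers the pairing
    and leaves it nonnegative. *)
Lemma rint_supporting s p (B : 'M[R]_(s, p)) h a :
  supporting B h -> rint B a -> 0 < pairing a h.
Proof.
move=> sh ia; have [z hz] := pairing_neq0 sh.1.
have /filter_ex[e [e0 /(cone_supporting sh)]] :
    \forall e \near (0 : R)^'+, 0 < e /\ cone B (a + e *: (- z)).
  near=> e; split; first by near: e; exact: nbhs_right_gt.
  by near: e; exact: ia.
rewrite pairingD pairingZ pairingN hz mulrN1 subr_ge0.
exact: lt_le_trans.
Unshelve. all: by end_near.
Qed.

(** A positive coefficient can absorb a small decrease, and the others do not
    decrease. *)
Lemma cone_push s p (B : 'M[R]_(s, p)) (c e : 'rV[R]_s) : nonneg c ->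
  (forall i, c 0 i = 0 -> 0 <= e 0 i) ->
  \forall t \near 0^'+, cone B (c *m B + t *: (e *m B)).
Proof.
move=> c0 ce.
have H : \forall t \near (0 : R)^'+, forall i, 0 <= c 0 i + t * e 0 i.
  apply: filter_forall => i.
  have [ci|ci] := eqVneq (c 0 i) 0.
    near=> t; have t0 : 0 < t by near: t; exact: nbhs_right_gt.
    by rewrite ci add0r mulr_ge0 ?ce // ltW.
  have cp : 0 < c 0 i by rewrite lt_def ci c0.
  have d0 : 0 < c 0 i / (1 + `|e 0 i|) by rewrite divr_gt0 // ltr_wpDr.
  near=> t.
  have t0 : 0 < t by near: t; exact: nbhs_right_gt.
  have tl : t < c 0 i / (1 + `|e 0 i|) by near: t; exact: nbhs_right_lt.
  have tl' : t * (1 + `|e 0 i|) < c 0 i by rewrite -ltr_pdivlMr // ltr_wpDr.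
  have := ler_norm (- e 0 i); rewrite normrN => ne.
  nra.
apply: filterS H => t ct; exists (c + t *: e); last by rewrite mulmxDl scalemxAl.
by move=> i; rewrite !mxE.
Unshelve. all: by end_near.
Qed.

Lemma subrows_comb s p (B : 'M[R]_(s, p)) (I : {set 'I_s}) (l : 'rV[R]_#|I|) :
  exists2 l' : 'rV[R]_s, l *m subrows B I = l' *m B &
    (forall i, i \notin I -> l' 0 i = 0) /\ (l' = 0 -> l = 0).
Proof.
exists (l *m rowsub (@enum_val _ (mem I)) 1%:M).
  by rewrite -mulmxA -rowsubE.
split=> [i iI|H].
  rewrite mxE big1 // => j _; rewrite !mxE; case: eqP => [E|_]; last by rewrite mulr0.
  by case/negP: iI; rewrite -E; exact: enum_valP.
apply/rowP=> j; have /rowP/(_ (enum_val j)) := H.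
rewrite !mxE (bigD1 j) //= big1 ?addr0 => [|i ij].
  by rewrite !mxE eqxx mulr1.
by rewrite !mxE (inj_eq enum_val_inj) (negbTE ij) mulr0.
Qed.

Lemma support_zero s (c : 'rV[R]_s) (I : {set 'I_s}) : nonneg c ->
  (forall i, (0 < c 0 i) = (i \in I)) -> forall i, i \notin I -> c 0 i = 0.
Proof. by move=> c0 cI i; rewrite -cI -leNgt => ci; apply/le_anti; rewrite ci c0. Qed.

Lemma supp_subrows s p (B : 'M[R]_(s, p)) (I : {set 'I_s}) (c : 'rV[R]_s) :
  (forall i, i \notin I -> c 0 i = 0) -> (c *m B <= subrows B I)%MS.
Proof.
move=> cI; rewrite mulmx_sum_row; apply: summx_sub => i _.
have [iI|iI] := boolP (i \in I); last by rewrite cI // scale0r sub0mx.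
apply: scalemx_sub.
have -> : row i B = row (enum_rank_in iI i) (subrows B I).
  by apply/rowP=> j; rewrite !mxE enum_rankK_in.
exact: row_sub.
Qed.

(** Carathéodory: subtract a linear relation from the coefficients until the
    generators that remain are independent. *)
Lemma cone_caratheodory s p (B : 'M[R]_(s, p)) a : cone B a ->
  exists (I : {set 'I_s}) (c : 'rV[R]_s),
  [/\ nonneg c, forall i, (0 < c 0 i) = (i \in I), a = c *m B &
      row_free (subrows B I)].
Proof.
move=> [c c0 ->{a}].
have [k] := ubnP #|[set i | 0 < c 0 i]%SET|.
elim: k c c0 => // k IH c c0 ck.
set I := [set i | 0 < c 0 i]%SET in ck *.
have [fI|fI] := boolP (row_free (subrows B I)).
  by exists I, c; split=> // i; rewrite inE.
have [l l0 lB] : exists2 l : 'rV[R]_#|I|, l != 0 & l *m subrows B I = 0.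
  move: fI; rewrite -kermx_eq0 => /rowV0Pn[l lk l0]; exists l => //.
  exact/sub_kermxP.
have [l' lE [lI lz]] := subrows_comb B l.
have l'B : l' *m B = 0 by rewrite -lE.
have l'0 : l' != 0 by apply: contra_neq l0.
(* the relation is oriented so that some coefficient decreases *)
clear lE lz l0 lB.
wlog [i0 i0P] : l' l'B lI l'0 / exists i, 0 < l' 0 i.
  move=> W; have [i li] : exists i, l' 0 i != 0.
    apply: contrapT => H; move/eqP: l'0; apply; apply/rowP=> i; rewrite mxE.
    by apply: contrapT => /eqP hi; apply: H; exists i.
  have [lp|ln] := ltP 0 (l' 0 i); first by apply: (W l') => //; exists i.
  apply: (W (- l')); rewrite ?mulNmx ?l'B ?oppr0 ?oppr_eq0 //.
    by move=> j jI; rewrite mxE lI ?oppr0.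
  by exists i; rewrite mxE oppr_gt0 lt_neqAle li.
case: (@arg_minP _ _ _ i0 (fun i => 0 < l' 0 i) (fun i => c 0 i / l' 0 i) i0P).
move=> j lj jmin; set t := c 0 j / l' 0 j in jmin.
have t0 : 0 <= t by rewrite divr_ge0 ?(c0 j) ?ltW.
pose c' := c - t *: l'.
have c'0 : nonneg c'.
  move=> i; rewrite !mxE; have [lp|ln] := ltP 0 (l' 0 i).
    by rewrite subr_ge0 -ler_pdivlMr // jmin.
  by rewrite subr_ge0 (le_trans _ (c0 i)) // mulr_ge0_le0.
have -> : c *m B = c' *m B.
  by rewrite /c' mulmxBl -scalemxAl l'B scaler0 subr0.
apply: IH => //; rewrite -ltnS (leq_trans _ ck) // ltnS.
apply: proper_card; apply/properP; split.
  apply/fintype.subsetP=> i; rewrite !inE !mxE.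
  have [ci|ci] := ltP 0 (c 0 i); first by [].
  have ci0 : c 0 i = 0 by apply/le_anti; rewrite ci c0.
  by rewrite lI ?mulr0 ?subr0 ?ci0 ?ltxx // inE ci0 ltxx.
exists j.
  by rewrite inE; apply: contraTT lj => cj; rewrite lI ?ltxx // inE.
by rewrite inE !mxE /t divfK ?subrr ?ltxx // gt_eqF.
Qed.

(** The kernel of h contains the row space of A and has the same rank. *)
Lemma hyperplane_kernel q d (A : 'M[R]_(q, d.+1)) (h : 'cV[R]_d.+1) :
  \rank A = d -> h != 0 -> A *m h = 0 ->
  forall z : 'rV[R]_d.+1, z *m h = 0 -> (z <= A)%MS.
Proof.
move=> rA h0 Ah z /sub_kermxP zk.
apply: (submx_trans zk).
have Ak : (A <= kermx h)%MS by apply/sub_kermxP.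
rewrite -(geq_leqif (mxrank_leqif_sup Ak)) mxrank_ker rA.
have : (\rank h <= 1)%N := rank_leq_col h.
have : \rank h != 0%N by rewrite mxrank_eq0.
by case: (\rank h) => [|[|]] // _ _; rewrite subn1.
Qed.

(** Both functionals vanish on the hyperplane spanned by A, so they are
    determined by their value at one vector z0 outside it. *)
Lemma kernel_proportional q d (A : 'M[R]_(q, d.+1)) (h h' : 'cV[R]_d.+1) :
  \rank A = d -> h != 0 -> A *m h = 0 -> A *m h' = 0 ->
  exists l, h' = l *: h.
Proof.
move=> rA h0 Ah Ah'; have [z0 hz0] := pairing_neq0 h0.
exists (pairing z0 h').
apply/row_matrixP=> i; rewrite !rowE -scalemxAr.
set z := delta_mx 0 i.
have : (z - pairing z h *: z0) *m h = 0.
  by apply/pairing_eq0; rewrite pairingD pairingN pairingZ hz0 mulr1 subrr.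
move=> /(hyperplane_kernel rA h0 Ah) /submxP[D E].
have : pairing (z - pairing z h *: z0) h' = 0.
  by apply/pairing_eq0; rewrite E -mulmxA Ah' mulmx0.
rewrite pairingD pairingN pairingZ => /eqP; rewrite subr_eq0 => /eqP E'.
by apply/matrixP=> a b; rewrite !ord1 -[LHS]/(pairing z h') E' mxE mulrC.
Qed.

Lemma vanishing_functional q n (A : 'M[R]_(q, n)) : (\rank A < n)%N ->
  exists2 h : 'cV[R]_n, h != 0 & A *m h = 0.
Proof.
move=> rA; have : kermx A^T != 0.
  by rewrite -mxrank_eq0 mxrank_ker mxrank_tr subn_eq0 -ltnNge.
move=> /rowV0Pn[v /sub_kermxP vA v0]; exists v^T; first by rewrite trmx_eq0.
by apply: trmx_inj; rewrite trmx_mul trmxK vA trmx0.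
Qed.

(** The generators with positive coefficients span, so every direction is a
    combination of them alone and [cone_push] applies. *)
Lemma rint_full s p (B : 'M[R]_(s, p)) (I : {set 'I_s}) (c : 'rV[R]_s) :
  nonneg c -> (forall i, (0 < c 0 i) = (i \in I)) ->
  row_full (subrows B I) -> rint B (c *m B).
Proof.
move=> c0 cI fI z.
have /submxP[D ->] : (z <= subrows B I)%MS by exact: submx_full.
have [e -> [eI _]] := subrows_comb B D.
apply: cone_push => // i ci; rewrite eI // -cI ci ltxx //.
Qed.

Lemma row_full_pairing s p (B : 'M[R]_(s, p)) (h : 'cV[R]_p) :
  row_full B -> h != 0 -> exists g, (B *m h) g 0 != 0.
Proof.
move=> fB h0; apply: contrapT => H; move/eqP: h0; apply.
have /submxP[D E] : ((1%:M : 'M[R]_p) <= B)%MS by rewrite sub1mx.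
rewrite -[h]mul1mx E -mulmxA (_ : B *m h = 0) ?mulmx0 //.
apply/matrixP=> i j; rewrite ord1 [RHS]mxE; apply/eqP; apply: contrapT => /negP hi.
by apply: H; exists i.
Qed.

(** A functional and its opposite cannot both be nonnegative on a spanning
    family. *)
Lemma supporting_scale s p (B : 'M[R]_(s, p)) h (l : R) :
  row_full B -> supporting B h -> supporting B (l *: h) -> 0 < l.
Proof.
move=> fB sh sl.
have l0 : l != 0 by apply: contra_neq sl.1 => l0; rewrite l0 scale0r.
rewrite lt_neqAle eq_sym l0 /=.
have [g hg] := row_full_pairing fB sh.1.
have hgp : 0 < (B *m h) g 0 by rewrite lt_neqAle eq_sym hg sh.2.
by have := sl.2 g; rewrite -scalemxAr mxE pmulr_lge0.
Qed.

End Cone.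

(** * Limits of matrices *)

Section MatrixLimits.
Variables (R : realType) (T : Type) (F : set_system T).
Context {FF : Filter F}.

Lemma cvg_mx m n (f : T -> 'M[R]_(m, n)) (M : 'M[R]_(m, n)) :
  (forall i j, (fun t => f t i j) @ F --> M i j) -> f @ F --> M.
Proof.
move=> H A [P MP PA]; apply: filterS (_ : \forall t \near F, forall i j, P i j (f t i j)).
  by move=> t Pt; apply: PA.
apply: filter_forall => i; apply: filter_forall => j.
exact: (H i j _ (MP i j)).
Qed.

Lemma cvg_coord m n (f : T -> 'M[R]_(m, n)) (M : 'M[R]_(m, n)) i j :
  f @ F --> M -> (fun t => f t i j) @ F --> M i j.
Proof.
move=> fM; apply: (@cvg_comp _ _ _ f (fun M : 'M[R]_(m, n) => M i j) _ _ _ fM).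
exact: coord_continuous.
Qed.

Lemma cvg_sumr (I : Type) (r : seq I) (f : I -> T -> R) (l : I -> R) :
  (forall i, f i @ F --> l i) ->
  (fun t => \sum_(i <- r) f i t) @ F --> \sum_(i <- r) l i.
Proof.
move=> H; elim: r => [|i r IH].
  by rewrite big_nil; under eq_fun do rewrite big_nil; exact: cvg_cst.
rewrite big_cons; under eq_fun do rewrite big_cons.
by apply: cvgD => //; exact: H.
Qed.

Lemma cvg_prodr (I : Type) (r : seq I) (f : I -> T -> R) (l : I -> R) :
  (forall i, f i @ F --> l i) ->
  (fun t => \prod_(i <- r) f i t) @ F --> \prod_(i <- r) l i.
Proof.
move=> H; elim: r => [|i r IH].
  by rewrite big_nil; under eq_fun do rewrite big_nil; exact: cvg_cst.
rewrite big_cons; under eq_fun do rewrite big_cons.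
by apply: cvgM => //; exact: H.
Qed.

Lemma cvg_mulmx m n p (f : T -> 'M[R]_(m, n)) (g : T -> 'M[R]_(n, p))
    (A : 'M[R]_(m, n)) (B : 'M[R]_(n, p)) :
  f @ F --> A -> g @ F --> B -> (fun t => f t *m g t) @ F --> A *m B.
Proof.
move=> fA gB; apply: cvg_mx => i j; rewrite mxE; under eq_fun do rewrite mxE.
by apply: cvg_sumr => k; apply: cvgM; exact: cvg_coord.
Qed.

Lemma cvg_addmx m n (f g : T -> 'M[R]_(m, n)) (A B : 'M[R]_(m, n)) :
  f @ F --> A -> g @ F --> B -> (fun t => f t + g t) @ F --> A + B.
Proof.
move=> fA gB; apply: cvg_mx => i j; rewrite mxE; under eq_fun do rewrite mxE.
by apply: cvgD; exact: cvg_coord.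
Qed.

Lemma cvg_scalemx m n (f : T -> R) (g : T -> 'M[R]_(m, n)) (a : R) (B : 'M[R]_(m, n)) :
  f @ F --> a -> g @ F --> B -> (fun t => f t *: g t) @ F --> a *: B.
Proof.
move=> fA gB; apply: cvg_mx => i j; rewrite mxE; under eq_fun do rewrite mxE.
by apply: cvgM => //; exact: cvg_coord.
Qed.

Lemma cvg_col_mx m n p (f : T -> 'M[R]_(m, p)) (g : T -> 'M[R]_(n, p))
    (A : 'M[R]_(m, p)) (B : 'M[R]_(n, p)) :
  f @ F --> A -> g @ F --> B -> (fun t => col_mx (f t) (g t)) @ F --> col_mx A B.
Proof.
move=> fA gB; apply: cvg_mx => i j; rewrite mxE; under eq_fun do rewrite mxE.
by case: (fintype.split i) => k; exact: cvg_coord.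
Qed.

Lemma cvg_lsubmx m n p (f : T -> 'M[R]_(m, n + p)) (A : 'M[R]_(m, n + p)) :
  f @ F --> A -> (fun t => lsubmx (f t)) @ F --> lsubmx A.
Proof.
move=> fA; apply: cvg_mx => i j; rewrite mxE; under eq_fun do rewrite mxE.
exact: cvg_coord.
Qed.

Lemma cvg_tr m n (f : T -> 'M[R]_(m, n)) (A : 'M[R]_(m, n)) :
  f @ F --> A -> (fun t => (f t)^T) @ F --> A^T.
Proof.
move=> fA; apply: cvg_mx => i j; rewrite mxE; under eq_fun do rewrite mxE.
exact: cvg_coord.
Qed.

Lemma cvg_det n (f : T -> 'M[R]_n) (A : 'M[R]_n) :
  f @ F --> A -> (fun t => \det (f t)) @ F --> \det A.
Proof.
move=> fA; apply: cvg_sumr => s; apply: cvgM; first exact: cvg_cst.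
by apply: cvg_prodr => i; exact: cvg_coord.
Qed.

Lemma cvg_adj n (f : T -> 'M[R]_n) (A : 'M[R]_n) :
  f @ F --> A -> (fun t => \adj (f t)) @ F --> \adj A.
Proof.
move=> fA; apply: cvg_mx => i j; rewrite mxE; under eq_fun do rewrite mxE.
apply: cvgM; first exact: cvg_cst.
apply: cvg_det; apply: cvg_mx => a b; rewrite !mxE; under eq_fun do rewrite !mxE.
exact: cvg_coord.
Qed.

End MatrixLimits.

(** Injectivity of a linear map on the closed set of vectors whose first
    coordinates are nonnegative is an open condition: by homogeneity it is a
    condition on the compact unit sphere. *)
Lemma pointed_near (R : realType) (T : Type) (F : set_system T) {FF : Filter F}
    s r q (f : T -> 'M[R]_(s + r, q)) (W : 'M[R]_(s + r, q)) :
  f @ F --> W ->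
  (forall x, nonneg (lsubmx x) -> x *m W = 0 -> x = 0) ->
  \forall t \near F, forall x, nonneg (lsubmx x) -> x *m f t = 0 -> x = 0.
Proof.
move=> fW HW.
pose K := [set x : 'rV[R]_(s + r) | `|x| = 1] `&`
          \bigcap_(i in [set: 'I_s]) [set x | 0 <= lsubmx x 0 i].
have cK : compact K.
  apply: bounded_closed_compact.
    exists 1; split; first exact: real1.
    by move=> M M1 x [/= -> _]; exact: ltW.
  apply: closedI.
    have -> : [set x : 'rV[R]_(s + r) | `|x| = 1] =
              (fun x => `|x|) @^-1` [set 1] by [].
    by apply: preimage_closed; [move=> x _; exact: norm_continuous|exact: closed_eq].
  apply: closed_bigI => i _.
  have -> : [set x : 'rV[R]_(s + r) | 0 <= lsubmx x 0 i] =
            (fun x => x 0 (lshift r i)) @^-1` [set y | 0 <= y].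
    by apply/seteqP; split=> x /=; rewrite mxE.
  by apply: preimage_closed; [move=> x _; exact: coord_continuous|exact: closed_ge].
have : \forall t \near F, K `<=` (fun x => x *m f t != 0).
  apply: (proj1 (compact_near_coveringP K) cK T F (fun t x => x *m f t != 0)) => x [x1 xK].
  have xW : x *m W != 0.
    apply/eqP => /HW xz; have : x = 0 by apply: xz => i; exact: (xK i).
    by move=> xz'; move: x1; rewrite /= xz' normr0 => /eqP; rewrite eq_sym oner_eq0.
  have : (fun z : 'rV[R]_(s + r) * T => z.1 *m f z.2)
           @ filter_prod (nbhs x) F --> x *m W.
    apply: cvg_mulmx; first exact: cvg_fst.
    by apply: cvg_comp fW; exact: cvg_snd.
  by move=> /cvgr_neq0 /(_ xW).
apply: filterS => t H x xn xt; apply/eqP; apply: contraT => x0.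
have nx : 0 < `|x| by rewrite normr_gt0.
suff /H : K (`|x|^-1 *: x) by rewrite -scalemxAl xt scaler0 eqxx.
split; first by rewrite /= normrZ normfV normr_id mulVf // gt_eqF.
by move=> i _; rewrite /= !mxE mulr_ge0 ?invr_ge0 //; have := xn i; rewrite mxE.
Qed.

(** * The topology of cones *)

Section ConeTopology.
Variable R : realType.

(** The equation c G + b P = y is made homogeneous by adjoining the generator
    -y; its coefficient is nonnegative, and when it is positive dividing by it
    gives back a solution of the original equation.  So [pointed_near] applies to
    the enlarged family. *)
Lemma cone_avoid_near (T : Type) (F : set_system T) {FF : Filter F} s r q
    (G : T -> 'M[R]_(s, q)) (P : T -> 'M[R]_(r, q)) (y : T -> 'rV[R]_q)
    (G0 : 'M[R]_(s, q)) (P0 : 'M[R]_(r, q)) (y0 : 'rV[R]_q) :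
  G @ F --> G0 -> P @ F --> P0 -> y @ F --> y0 ->
  (forall c b, nonneg c -> c *m G0 + b *m P0 = 0 -> c = 0 /\ b = 0) ->
  (forall c b, nonneg c -> c *m G0 + b *m P0 <> y0) ->
  \forall t \near F, forall c b, nonneg c -> c *m G t + b *m P t <> y t.
Proof.
move=> cG cP cy pt av.
pose W t := col_mx (col_mx (G t) (- y t)) (P t).
have cW : W @ F --> col_mx (col_mx G0 (- y0)) P0.
  apply: cvg_col_mx => //; apply: cvg_col_mx => //.
  have -> : - y0 = (-1) *: y0 by rewrite scaleN1r.
  under eq_fun do rewrite -scaleN1r.
  by apply: cvg_scalemx => //; exact: cvg_cst.
have : \forall t \near F, forall x, nonneg (lsubmx x) -> x *m W t = 0 -> x = 0.
  apply: (pointed_near cW) => x xn.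
  rewrite -[x]hsubmxK mul_row_col -[lsubmx x]hsubmxK mul_row_col.
  set c := lsubmx (lsubmx x); set l := rsubmx (lsubmx x); set b := rsubmx x.
  have c0 : nonneg c by move=> i; rewrite mxE; exact: xn.
  have l0 : 0 <= l 0 0 by rewrite mxE; exact: xn.
  have lE : l = (l 0 0)%:M by apply/matrixP=> i j; rewrite !ord1 [RHS]mxE eqxx mulr1n.
  rewrite lE mul_scalar_mx scalerN => E.
  have [ln|lp] := leP (l 0 0) 0.
    have lz : l 0 0 = 0 by apply/le_anti; rewrite ln l0.
    move: E; rewrite lz scale0r subr0 => /(pt _ _ c0)[-> ->].
    by rewrite -[X in row_mx (row_mx _ X)]scalemx1 scale0r !row_mx0.
  case: (av ((l 0 0)^-1 *: c) ((l 0 0)^-1 *: b)).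
    by move=> i; rewrite mxE mulr_ge0 // invr_ge0.
  rewrite -!scalemxAl -scalerDr.
  have -> : c *m G0 + b *m P0 = l 0 0 *: y0.
    by apply/eqP; rewrite -subr_eq0 -E addrAC.
  by rewrite scalerA mulVf ?scale1r // gt_eqF.
apply: filterS => t H c b c0 E.
have : row_mx (row_mx c (1%:M : 'M[R]_1)) b = 0.
  apply: H; last by rewrite !mul_row_col mul1mx addrAC E subrr.
  rewrite row_mxKl => i; rewrite mxE; case: fintype.split => j; first exact: c0.
  by rewrite mxE; case: eqP.
move/eqP; rewrite row_mx_eq0 => /andP[/eqP]; rewrite -row_mx0 => /eq_row_mx[_].
by move/eqP; rewrite -[_ == _]/(1 == 0 :> 'M[R]_1) oner_eq0.
Qed.

(** All generators lie on the hyperplane where the coordinates add up to 1.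
    This holds for the vertices of a polytope in affine coordinates, and it makes
    the cone pointed and closed. *)
Definition unit_sum s p (B : 'M[R]_(s, p)) := B *m (const_mx 1 : 'cV_p) = const_mx 1.

Lemma unit_sum_eq0 s p (B : 'M[R]_(s, p)) c :
  unit_sum B -> nonneg c -> c *m B = 0 -> c = 0.
Proof.
move=> uB c0 cB.
have H : \sum_i c 0 i = 0.
  have : (c *m (const_mx 1 : 'cV_s)) 0 0 = 0 by rewrite -uB mulmxA cB mul0mx mxE.
  by rewrite mxE; under eq_bigr do rewrite mxE mulr1.
apply/rowP=> i; rewrite mxE; apply/eqP; move/eqP: H.
by rewrite psumr_eq0 // => /allP/(_ i); rewrite mem_index_enum => /(_ isT).
Qed.

Lemma cone_pointed s p (B : 'M[R]_(s, p)) a :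
  unit_sum B -> cone B a -> cone B (- a) -> a = 0.
Proof.
move=> uB [c c0 ->] [d d0 E].
have : c + d = 0.
  apply: (unit_sum_eq0 uB); first by move=> i; rewrite mxE addr_ge0.
  by rewrite mulmxDl -E subrr.
move=> /rowP H; suff -> : c = 0 by rewrite mul0mx.
apply/rowP=> i; have := H i; rewrite !mxE => /eqP; rewrite paddr_eq0 //.
by case/andP=> /eqP.
Qed.

Lemma cone_compl_near s p (B : 'M[R]_(s, p)) a : unit_sum B ->
  ~ cone B a -> \forall b \near a, ~ cone B b.
Proof.
move=> uB na.
have : \forall b \near a, forall (c : 'rV_s) (d : 'rV_0), nonneg c ->
    c *m B + d *m (0 : 'M[R]_(0, p)) <> b.
  apply: (@cone_avoid_near _ (nbhs a) _ s 0 p (fun=> B) (fun=> 0) id B 0 a); [exact: cvg_cst|exact: cvg_cst|exact: cvg_id| |].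
    move=> c d c0; rewrite mulmx0 addr0 => /(unit_sum_eq0 uB c0) ->.
    by split=> //; exact: thinmx0.
  by move=> c d c0; rewrite mulmx0 addr0 => E; apply: na; exists c.
apply: filterS => b H [c c0 E]; apply: (H c 0 c0).
by rewrite mulmx0 addr0.
Qed.

Lemma nbhs_rint s p (B : 'M[R]_(s, p)) a : nbhs a (cone B) -> rint B a.
Proof.
move=> na z.
have : (fun t : R => a + t *: z) @ 0^'+ --> a + 0 *: z.
  apply: cvg_addmx; first exact: cvg_cst.
  apply: cvg_scalemx; last exact: cvg_cst.
  apply: (@cvg_at_right_filter _ _ id); exact: cvg_id.
by rewrite scale0r addr0 => /(_ _ na).
Qed.

(** A point near a is the average of p + 1 points of the cone: a itself and, for
    each coordinate i, the point a moved along the axis i by p + 1 times the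
    difference of the i-th coordinates. *)
Lemma rint_nbhs s p (B : 'M[R]_(s, p)) a : rint B a -> nbhs a (cone B).
Proof.
move=> ra; have [e e0 ce] : exists2 e, 0 < e & forall i : 'I_p,
    cone B (a + e *: delta_mx 0 i) /\ cone B (a + e *: (- delta_mx 0 i)).
  have : \forall e \near (0 : R)^'+, 0 < e /\ forall i : 'I_p,
     cone B (a + e *: delta_mx 0 i) /\ cone B (a + e *: (- delta_mx 0 i)).
    have H : \forall e \near (0 : R)^'+, forall i : 'I_p,
        cone B (a + e *: delta_mx 0 i) /\ cone B (a + e *: (- delta_mx 0 i)).
      apply: filter_forall => i.
      by apply: filterS2 (ra (delta_mx 0 i)) (ra (- delta_mx 0 i)) => e; exact: conj.
    by apply: filterS2 (nbhs_right_gt (0 : R)) H => e; exact: conj.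
  by move=> /filter_ex[e [e0 ce]]; exists e.
have Ca := rint_cone ra.
have ci i u : `|u| <= e -> cone B (a + u *: delta_mx 0 i).
  move=> ue; have [un|up] := leP 0 u.
    have -> : a + u *: delta_mx 0 i = (1 - u / e) *: a
        + (u / e) *: (a + e *: delta_mx 0 i).
      rewrite scalerDr scalerA divfK ?gt_eqF // addrA -scalerDl.
      by rewrite subrK scale1r.
    apply: cone_convex => //; first by rewrite divr_ge0 // ltW.
      by rewrite ler_pdivrMr // mul1r (le_trans (ler_norm _)).
    exact: (ce i).1.
  have -> : a + u *: delta_mx 0 i = (1 - (- u / e)) *: a
      + (- u / e) *: (a + e *: (- delta_mx 0 i)).
    rewrite scalerDr scalerA divfK ?gt_eqF // addrA -scalerDl.
    by rewrite subrK scale1r scaleNr scalerN opprK.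
  apply: cone_convex => //; first by rewrite divr_ge0 ?oppr_ge0 // ltW.
    by rewrite ler_pdivrMr // mul1r (le_trans (ler_norm _)) // normrN.
  exact: (ce i).2.
have : \forall y \near (a : 'rV[R]_p), forall i : 'I_p, `|a 0 i - (y : 'rV[R]_p) 0 i| < e / p.+1%:R.
  exists (fun i j => ball (a i j) (e / p.+1%:R)).
    by move=> i j; apply: nbhsx_ballx; rewrite divr_gt0.
  by move=> y H i; exact: H.
apply: filterS => y H.
pose q : R := p.+1%:R.
have q0 : 0 < q by rewrite ltr0n.
have -> : y = q^-1 *: (a + \sum_(i < p) (a + (q * (y 0 i - a 0 i)) *: delta_mx 0 i)).
  rewrite big_split /= sumr_const card_ord addrA -mulrS -scaler_nat.
  rewrite scalerDr scalerA mulVf ?scale1r ?gt_eqF //.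
  under eq_bigr do rewrite -scalerA.
  rewrite -scaler_sumr scalerA mulVf ?gt_eqF // scale1r.
  rewrite -[LHS](subrK a) addrC; congr (_ + _).
  rewrite [LHS]row_sum_delta; apply: eq_bigr => i _; by rewrite !mxE.
apply: coneZ; first by rewrite invr_ge0 ltW.
apply: coneD => //; elim/big_ind: _ => [|b c|i _]; [|exact: coneD|].
  by exists 0; rewrite ?mul0mx // => i; rewrite mxE.
apply: ci; rewrite normrM gtr0_norm // mulrC -ler_pdivlMr // distrC.
exact/ltW/H.
Qed.

Lemma rint_near s p (B : 'M[R]_(s, p)) a : rint B a -> \forall b \near a, rint B b.
Proof.
move=> /rint_nbhs ra; have : \forall b \near a, nbhs b (cone B).
  exact: (nbhs_interior ra).
by apply: filterS => b; exact: nbhs_rint.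
Qed.

Lemma rintZ s p (B : 'M[R]_(s, p)) a t : 0 < t -> rint B a -> rint B (t *: a).
Proof.
move=> t0 ra z; apply: filterS (ra (t^-1 *: z)) => e /(coneZ (ltW t0)).
by rewrite scalerDr !scalerA mulrAC mulfV ?mul1r // gt_eqF.
Qed.

End ConeTopology.

(** * Segments and the boundary of a cone *)

Section Segment.
Variables (R : realType) (s d : nat) (B : 'M[R]_(s, d.+1)).
Hypotheses (uB : unit_sum B) (fB : row_full B).

(** A facet of the cone is encoded by an inward functional that vanishes on it,
    unique up to a positive factor. *)
Definition facet_functional (h : 'cV[R]_d.+1) :=
  supporting B h /\
  exists2 I : {set 'I_s}, \rank (subrows B I) = d & subrows B I *m h = 0.

Lemma rank_subrows (I : {set 'I_s}) :
  row_free (subrows B I) -> \rank (subrows B I) = #|I|.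
Proof. by move=> /eqP. Qed.

Lemma supporting_zero h c : supporting B h -> nonneg c ->
  pairing (c *m B) h = 0 -> forall I : {set 'I_s},
  (forall i, i \in I -> 0 < c 0 i) -> subrows B I *m h = 0.
Proof.
move=> [h0 Bh] c0 ch I cI; apply/matrixP=> i j; rewrite ord1 [RHS]mxE.
move: ch; rewrite pairing_cone => /eqP; rewrite psumr_eq0 => [|k _]; last first.
  by rewrite mulr_ge0.
move=> /allP/(_ (enum_val i)); rewrite mem_index_enum => /(_ isT) /=.
rewrite mulf_eq0 gt_eqF ?cI ?enum_valP //= => /eqP H.
by rewrite -[RHS]H !mxE; apply: eq_bigr => k _; rewrite !mxE.
Qed.

(** A minimal expression of y uses independent generators, hence d or d + 1 of
    them, fewer being excluded.  If d + 1, they span and y is interior.  If d,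
    they span a hyperplane.  When that hyperplane has generators on both sides, y
    can move a little to either side and is interior; otherwise it supports the
    cone and y lies in the relative interior of a facet, from which every inward
    direction leads into the cone. *)
Lemma facet_or_interior y : cone B y ->
  (forall I : {set 'I_s}, (#|I| < d)%N -> ~~ (y <= subrows B I)%MS) ->
  rint B y \/ exists h, [/\ facet_functional h, pairing y h = 0 &
     forall z, 0 < pairing z h -> \forall t \near 0^'+, cone B (y + t *: z)].
Proof.
move=> /cone_caratheodory[I [c [c0 cI -> fI]]] ridge.
have cI0 := support_zero c0 cI.
have dI : (d <= #|I|)%N.
  by rewrite leqNgt; apply/negP => /ridge; rewrite supp_subrows.
have rI := rank_subrows fI.
have [fullI|nfull] := boolP (row_full (subrows B I)).
  by left; exact: rint_full cI fullI.
have {}dI : \rank (subrows B I) = d.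
  apply/eqP; rewrite eqn_leq rI dI andbT -rI.
  have := rank_leq_col (subrows B I).
  by rewrite leq_eqVlt -/(row_full (subrows B I)) (negbTE nfull).
(* z is a nonnegative multiple of a generator g off the hyperplane, on the same
   side as z, plus a vector of the hyperplane *)
have push h : subrows B I *m h = 0 -> forall g z, (B *m h) g 0 != 0 ->
    0 <= pairing z h / (B *m h) g 0 -> h != 0 ->
    \forall t \near 0^'+, cone B (c *m B + t *: z).
  move=> Ih g z hg zg h0; set l := _ / _ in zg.
  have : (z - l *: row g B) *m h = 0.
    apply/pairing_eq0; rewrite pairingD pairingN pairingZ.
    have -> : pairing (row g B) h = (B *m h) g 0 by rewrite /pairing -row_mul mxE.
    by rewrite /l divfK // subrr.
  move=> /(hyperplane_kernel dI h0 Ih) /submxP[D].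
  have [e -> [eI _]] := subrows_comb B D => E.
  have -> : z = (e + l *: delta_mx 0 g) *m B.
    by rewrite mulmxDl -scalemxAl -rowE -E subrK.
  apply: cone_push => // i ci; rewrite !mxE eI ?add0r.
    by rewrite mulr_ge0 // ler0n.
  by rewrite -cI ci ltxx.
have [h h0 Ih] : exists2 h : 'cV[R]_d.+1, h != 0 & subrows B I *m h = 0.
  by apply: vanishing_functional; rewrite dI.
have yh k : subrows B I *m k = 0 -> pairing (c *m B) k = 0.
  move=> Ik; apply/pairing_eq0; have /submxP[D ->] := supp_subrows B cI0.
  by rewrite -mulmxA Ik mulmx0.
have [g hg] := row_full_pairing fB h0.
wlog hgp : h h0 Ih hg / 0 < (B *m h) g 0.
  move=> W; have [lp|ln] := ltP 0 ((B *m h) g 0); first exact: (W h).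
  apply: (W (- h)); rewrite ?oppr_eq0 ?mulmxN ?Ih ?oppr0 // mxE ?oppr_eq0 //.
  by rewrite oppr_gt0 lt_neqAle hg.
have [Bh|] := pselect (forall i, 0 <= (B *m h) i 0).
  right; exists h; split; [|exact: yh|].
    by split; [|exists I].
  move=> z zh; apply: (push h Ih g) => //; by rewrite divr_ge0 ?ltW.
move=> /existsNP[g'] /negP; rewrite -ltNge => hg'.
left=> z; have [zh|zh] := leP 0 (pairing z h).
  by apply: (push h Ih g) => //; rewrite divr_ge0 // ltW.
by apply: (push h Ih g') => //; rewrite ?lt_eqF // mulr_le0 ?invr_le0 ?ltW.
Qed.

Section Generic.
Variables a0 a1 : 'rV[R]_d.+1.
Definition seg t := a0 + t *: (a1 - a0).

Hypothesis ridge : forall t, 0 < t < 1 -> forall I : {set 'I_s},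
  (#|I| < d)%N -> ~~ (seg t <= subrows B I)%MS.
Hypothesis transverse : forall I : {set 'I_s}, (#|I| <= d)%N ->
  ~~ ((a0 <= subrows B I)%MS && (a1 <= subrows B I)%MS).

Definition hit (h : 'cV[R]_d.+1) :=
  exists t, [/\ 0 < t < 1, cone B (seg t) & pairing (seg t) h = 0].

Lemma pairing_seg t h :
  pairing (seg t) h = pairing a0 h + t * pairing (a1 - a0) h.
Proof. by rewrite /seg pairingD pairingZ. Qed.

Lemma seg_convex t1 t2 t : t1 <= t -> t <= t2 ->
  cone B (seg t1) -> cone B (seg t2) -> cone B (seg t).
Proof.
move=> t1t tt2 C1 C2.
have [E|t12] := eqVneq t1 t2.
  by have -> : t = t1 by apply/le_anti; rewrite t1t {1}E tt2.
have p : 0 < t2 - t1 by rewrite subr_gt0 lt_neqAle t12 (le_trans t1t).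
have -> : seg t = (1 - (t - t1) / (t2 - t1)) *: seg t1 + ((t - t1) / (t2 - t1)) *: seg t2.
  rewrite /seg; apply/rowP=> i; rewrite !mxE; field.
  exact: lt0r_neq0.
apply: cone_convex => //; first by rewrite divr_ge0 ?subr_ge0 // -subr_ge0 ltW.
by rewrite ler_pdivrMr // mul1r lerD2r.
Qed.

(** A minimal expression of the point where the segment meets the boundary uses
    exactly d independent generators: fewer are excluded by [ridge], and h
    vanishes on all of them.  These generators lie in every supporting hyperplane
    through the point. *)
Lemma hit_carrier h t : supporting B h -> 0 < t < 1 -> cone B (seg t) ->
  pairing (seg t) h = 0 ->
  exists I : {set 'I_s}, [/\ (#|I| <= d)%N, \rank (subrows B I) = d &
    forall h', supporting B h' -> pairing (seg t) h' = 0 -> subrows B I *m h' = 0].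
Proof.
move=> sh t01 Ct th.
have [I [c [c0 cI E fI]]] := cone_caratheodory Ct.
have van h' : supporting B h' -> pairing (seg t) h' = 0 -> subrows B I *m h' = 0.
  by rewrite E => sh' ch'; apply: (supporting_zero sh' c0 ch') => i; rewrite cI.
have dI : (d <= #|I|)%N.
  rewrite leqNgt; apply/negP => /(ridge t01).
  by rewrite E supp_subrows //; exact: support_zero.
have rI := rank_subrows fI.
have rd : (\rank (subrows B I) <= d)%N.
  rewrite -ltnS ltn_neqAle rank_leq_col andbT; apply/negP => full.
  have := van _ sh th; move=> /(congr1 (mulmx (pinvmx (subrows B I)))).
  by rewrite mulmxA mulVpmx // mul1mx mulmx0; move/eqP: sh.1.
exists I; split=> //; first by rewrite -rI.
by apply/eqP; rewrite eqn_leq rd rI dI.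
Qed.

(** Otherwise the whole segment would lie in the hyperplane of a facet, against
    [transverse]. *)
Lemma hit_transverse h t : supporting B h -> 0 < t < 1 -> cone B (seg t) ->
  pairing (seg t) h = 0 -> pairing (a1 - a0) h != 0.
Proof.
move=> sh t01 Ct th; have [I [cI rI /(_ h sh th) Ih]] := hit_carrier sh t01 Ct th.
apply/negP => /eqP E; have := th; rewrite pairing_seg E mulr0 addr0 => a0h.
have a1h : pairing a1 h = 0 by rewrite -[a1](subrK a0) pairingD E add0r.
have := transverse cI; rewrite !(hyperplane_kernel rI sh.1 Ih) //; exact/pairing_eq0.
Qed.

(** Both functionals vanish on the same d independent generators. *)
Lemma hit_unique h h' t : supporting B h -> supporting B h' -> 0 < t < 1 ->
  cone B (seg t) -> pairing (seg t) h = 0 -> pairing (seg t) h' = 0 ->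
  exists2 l, 0 < l & h' = l *: h.
Proof.
move=> sh sh' t01 Ct th th'; have [I [cI rI H]] := hit_carrier sh t01 Ct th.
have [l E] := kernel_proportional rI sh.1 (H _ sh th) (H _ sh' th').
exists l => //; apply: (supporting_scale fB sh); by rewrite -E.
Qed.

(** At a boundary point the supporting functional would vanish there and be
    nonnegative at both ends, so it would vanish on the whole segment, against
    [hit_transverse]. *)
Lemma between_interior t1 t t2 : 0 <= t1 -> t1 < t -> t < t2 -> t2 <= 1 ->
  cone B (seg t1) -> cone B (seg t2) -> rint B (seg t).
Proof.
move=> t10 t1t tt2 t21 C1 C2.
have t01 : 0 < t < 1 by rewrite (le_lt_trans t10) // (lt_le_trans tt2).
have Ct : cone B (seg t) by apply: seg_convex C1 C2; exact: ltW.
have [//|[h [[sh _] th _]]] := facet_or_interior Ct (ridge t01).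
have := hit_transverse sh t01 Ct th.
have := cone_supporting sh C1; have := cone_supporting sh C2.
move: th; rewrite !pairing_seg => th H2 H1 /eqP; case.
set u := pairing (a1 - a0) h in th H1 H2 *; set v := pairing a0 h in th H1 H2.
apply/le_anti/andP; split.
  have : 0 <= (t - t1) * - u by nra.
  by rewrite pmulr_rge0 ?subr_gt0 // oppr_ge0.
have : 0 <= (t2 - t) * u by nra.
by rewrite pmulr_rge0 ?subr_gt0.
Qed.

(** By convexity the segment is in the cone exactly up to its last point there.
    This point is not interior, and being off the ridges it lies on one facet
    only.  A supporting functional is positive at the start, so it decreases along
    the segment when it vanishes somewhere on it, and it cannot vanish before the
    last point. *)
Lemma exit_facet : rint B a0 -> ~ cone B a1 ->
  exists h, [/\ facet_functional h, hit h, pairing (a1 - a0) h < 0 &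
    forall h', supporting B h' -> hit h' -> exists2 l, 0 < l & h' = l *: h].
Proof.
move=> ra0 na1.
have seg0 : seg 0 = a0 by rewrite /seg scale0r addr0.
have seg1 : seg 1 = a1 by rewrite /seg scale1r addrCA subrr addr0.
pose S := [set t | 0 <= t <= 1 /\ cone B (seg t)].
have S0 : S 0 by split; rewrite ?lexx ?ler01 // seg0; exact: rint_cone.
have hS : has_sup S by split; [exists 0|exists 1 => t [/andP[]]].
pose b := sup S.
have b0 : 0 <= b by exact: (sup_upper_bound hS).
have b1 : b <= 1 by apply: ge_sup; [exists 0|move=> t [/andP[]]].
have Cb : cone B (seg b).
  apply: contrapT => /(cone_compl_near uB) nb.
  have cs : seg @ b --> seg b.
    apply: cvg_addmx; first exact: cvg_cst.
    by apply: cvg_scalemx; [exact: cvg_id|exact: cvg_cst].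
  have /nbhs_ballP[e /= e0 be] : \forall t \near b, ~ cone B (seg t) := cs _ nb.
  have [t [t01 Ct] bt] := sup_adherent e0 hS.
  apply: (be t _ Ct); rewrite /ball /= ger0_norm ?subr_ge0; last first.
    exact: (sup_upper_bound hS).
  by rewrite ltrBlDr addrC -ltrBlDr.
have b1' : b < 1.
  by rewrite lt_neqAle b1 andbT; apply/eqP => E; apply: na1; rewrite -seg1 -E.
have b0' : 0 < b.
  have : \forall t \near (0 : R)^'+, [/\ 0 < t, t < 1 & cone B (a0 + t *: (a1 - a0))].
    near=> t; split; [near: t; exact: nbhs_right_gt|near: t; exact: nbhs_right_lt|].
    by near: t; exact: ra0.
  move=> /filter_ex[t [t0 t1 Ct]]; apply: (lt_le_trans t0).
  by apply: (sup_upper_bound hS); rewrite /S /= (ltW t0) (ltW t1).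
have b01 : 0 < b < 1 by rewrite b0'.
have nafter t : b < t -> t <= 1 -> ~ cone B (seg t).
  move=> bt t1 Ct; have := sup_upper_bound hS (x := t).
  rewrite -/b leNgt bt => /(_ _)/negP; case=> //.
  by rewrite /S /= t1 (le_trans b0) // ltW.
have [rb|[h [ff bh _]]] := facet_or_interior Cb (ridge b01).
  have : \forall t \near (0 : R)^'+, [/\ 0 < t, t < 1 - b & cone B (seg b + t *: (a1 - a0))].
    near=> t; split; [near: t; exact: nbhs_right_gt| |].
      by near: t; apply: nbhs_right_lt; rewrite subr_gt0.
    by near: t; exact: rb.
  move=> /filter_ex[t [t0 t1 Ct]]; case: (@nafter (b + t)).
  - by rewrite ltrDl.
  - by rewrite addrC -lerBrDr ltW.
  - by move: Ct; rewrite /seg -addrA -scalerDl.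
have sh := ff.1.
have neg k : supporting B k -> forall t, 0 < t < 1 -> pairing (seg t) k = 0 ->
    pairing (a1 - a0) k < 0.
  move=> sk t /andP[t0 t1] tk; have := rint_supporting sk ra0.
  move: tk; rewrite pairing_seg => tk a0k.
  have : t * pairing (a1 - a0) k < 0 by lra.
  by rewrite pmulr_rlt0.
exists h; split=> //; [by exists b|exact: (neg _ sh b)|].
move=> h' sh' [t [t01 Ct th']].
have tb : t <= b.
  rewrite leNgt; apply/negP => /nafter; apply=> //.
  by case/andP: t01 => _ /ltW.
suff E : t = b by apply: (@hit_unique h h' b) => //; rewrite -E.
apply/le_anti; rewrite tb /=.
have nh' := neg _ sh' _ t01 th'.
have := cone_supporting sh' Cb; move: th'; rewrite !pairing_seg => th' bh'.
rewrite -subr_ge0 -(nmulr_rle0 _ nh').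
by nra.
Unshelve. all: by end_near.
Qed.

(** The functional is positive at both ends. *)
Lemma no_hit h : rint B a0 -> rint B a1 -> supporting B h -> ~ hit h.
Proof.
move=> r0 r1 sh [t [/andP[t0 t1] _]]; rewrite pairing_seg pairingD pairingN.
have := rint_supporting sh r0; have := rint_supporting sh r1.
nra.
Qed.

End Generic.
End Segment.

(** * Generic vectors *)

Section Generic.
Variable R : realType.

Lemma row_free0P q n (A : 'M[R]_(q, n)) :
  (forall x : 'rV_q, x *m A = 0 -> x = 0) <-> row_free A.
Proof.
split=> [H|fA x xA]; last by apply: (row_free_inj fA); rewrite mul0mx.
rewrite -kermx_eq0; apply: contraT => /rowV0Pn[x /sub_kermxP/H ->].
by rewrite eqxx.
Qed.

Lemma poly_nonroot (p : {poly R}) : p != 0 -> exists x, ~~ root p x.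
Proof.
move=> p0; apply: contrapT => H.
pose rs : seq R := [seq i%:R | i <- iota 0 (size p)].
have : (size rs < size p)%N.
  apply: max_poly_roots => //.
    by apply/allP=> x _; apply: contrapT => /negP xr; apply: H; exists x.
  rewrite map_inj_in_uniq ?iota_uniq // => i j _ _ /eqP.
  by rewrite eqr_nat => /eqP.
by rewrite size_map size_iota ltnn.
Qed.

(** Finitely many proper subspaces do not cover the space: they meet the moment
    curve in finitely many points. *)
Lemma generic_vector (I : finType) n (A : I -> 'M[R]_n.+1) :
  (forall i, (\rank (A i) < n.+1)%N) ->
  exists v : 'rV[R]_n.+1, forall i, ~~ (v <= A i)%MS.
Proof.
move=> rA.
have /choice[h hP] : forall i, exists k : 'cV[R]_n.+1, k != 0 /\ A i *m k = 0.
  by move=> i; have [k k0 Ak] := vanishing_functional (rA i); exists k.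
pose p i : {poly R} := \poly_(j < n.+1) h i (inord j) 0.
have p0 : \prod_i p i != 0.
  rewrite prodf_seq_neq0; apply/allP => i _ /=; apply: contra_neq (hP i).1 => pi0.
  apply/matrixP=> j k; rewrite ord1 mxE.
  have := coef_poly n.+1 (fun j => h i (inord j) 0) j.
  by rewrite -/(p i) pi0 coef0 ltn_ord inord_val => <-.
have [x xr] := poly_nonroot p0.
(* the pairing of this vector with h i is the value of p i at x *)
exists (\row_j x ^+ j) => i; apply/negP => /submxP[D E].
move/negP: xr; apply; rewrite /root horner_prod.
rewrite (bigD1 i) //= (_ : (p i).[x] = 0) ?mul0r //.
have : (\row_(j < n.+1) x ^+ j) *m h i = 0 by rewrite E -mulmxA (hP i).2 mulmx0.
move=> /matrixP/(_ 0 0); rewrite !mxE => <-.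
rewrite horner_poly; apply: eq_bigr => j _; by rewrite mxE inord_val mulrC.
Qed.

(** One vector at a time, each outside the finitely many proper subspaces spanned
    so far. *)
Lemma generic_complement (I : finType) q n (Q : I -> 'M[R]_(q, n)) r :
  (forall i, row_free (Q i)) -> (q + r <= n)%N ->
  exists M : 'M[R]_(r, n), forall i, row_free (col_mx (Q i) M).
Proof.
move=> fQ; elim: r => [|r IH] qr.
  exists 0 => i; apply/row_free0P => x.
  rewrite -[x]hsubmxK mul_row_col mulmx0 addr0.
  move=> /(proj2 (row_free0P (Q i)) (fQ i)) ->.
  by rewrite [rsubmx x]thinmx0 row_mx0.
have [M MP] := IH (leq_trans (leq_add (leqnn q) (leqnSn r)) qr).
case: n Q fQ IH qr M MP => [|n] Q fQ IH qr M MP; first by rewrite addnS in qr.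
have [v vP] : exists v : 'rV[R]_n.+1, forall i, ~~ (v <= <<col_mx (Q i) M>>)%MS.
  apply: generic_vector => i; rewrite genmxE.
  by apply: leq_ltn_trans (rank_leq_row _) _; rewrite -addnS.
have -> : r.+1 = (r + 1)%N by rewrite addn1.
exists (col_mx M v) => i; apply/row_free0P => x.
rewrite -[x]hsubmxK mul_row_col -[rsubmx x]hsubmxK mul_row_col.
set a := lsubmx x; set b := lsubmx _; set c := rsubmx _.
have cE : c = (c 0 0)%:M by apply/matrixP=> i' j; rewrite !ord1 [RHS]mxE eqxx mulr1n.
rewrite cE mul_scalar_mx addrA => E.
have c0 : c 0 0 = 0.
  apply/eqP; apply: contraT => cn; have := vP i; rewrite genmxE.
  have -> : v = (- (c 0 0)^-1) *: (row_mx a b *m col_mx (Q i) M).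
    have -> : row_mx a b *m col_mx (Q i) M = - (c 0 0 *: v).
      by rewrite mul_row_col; apply/eqP; rewrite -addr_eq0 E.
    by rewrite scalerN scaleNr opprK scalerA mulVf // scale1r.
  by rewrite scalemx_sub // submxMl.
move: E; rewrite c0 scale0r addr0 -mul_row_col.
move=> /(proj2 (row_free0P _) (MP i)) /eqP; rewrite row_mx_eq0 => /andP[/eqP-> /eqP->].
by rewrite -[0%:M]scalemx1 scale0r !row_mx0.
Qed.

(** After division by the largest power of the variable the polynomial does not
    vanish at 0. *)
Lemma poly_nonroot_near (p : {poly R}) : p != 0 ->
  \forall e \near 0^'+, ~~ root p e.
Proof.
move=> p0; have [m [q]] := multiplicity_XsubC p 0.
rewrite p0 /= => q0 ->.
have H : \forall e \near (0 : R)^'+, q.[e] != 0.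
  have : (fun e => q.[e]) @ (0 : R)^'+ --> q.[0].
    by apply: cvg_at_right_filter; exact: continuous_horner.
  by move=> /cvgr_neq0 /(_ q0).
near=> e; rewrite rootM negb_or; apply/andP; split.
  by rewrite /root; near: e; exact: H.
have e0 : 0 < e by near: e; exact: nbhs_right_gt.
rewrite /root horner_exp expf_neq0 // hornerXsubC subr0 gt_eqF //.
Unshelve. all: by end_near.
Qed.

(** With M a common complement of all the Q i, the determinant is, up to a
    nonzero factor, the value at e of the characteristic polynomial of a square
    matrix, so it has finitely many zeros. *)
Lemma generic_perturbation (I : finType) q r (Q : I -> 'M[R]_(q, q + r)) P :
  (forall i, row_free (Q i)) ->
  exists M, \forall e \near 0^'+, forall i, \det (col_mx (Q i) (P + e *: M)) != 0.
Proof.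
move=> fQ; have [M MP] := generic_complement fQ (leqnn _).
exists M; apply: filter_forall => i.
set W := col_mx (Q i) M; have uW : W \in unitmx by rewrite -row_free_unit; exact: MP.
set X := P *m invmx W.
have EP : P = lsubmx X *m Q i + rsubmx X *m M.
  by rewrite -mul_row_col hsubmxK -mulmxA mulVmx // mulmx1.
have := poly_nonroot_near (monic_neq0 (char_poly_monic (- rsubmx X))).
apply: filterS => e; rewrite -eigenvalue_root_char /eigenvalue /eigenspace negbK.
rewrite kermx_eq0 row_free_unit unitmxE unitfE => de.
have -> : col_mx (Q i) (P + e *: M) = block_mx 1%:M 0 (lsubmx X) (rsubmx X + e%:M) *m W.
  rewrite mul_block_col !mul1mx mul0mx addr0 mulmxDl mul_scalar_mx addrA.
  by rewrite -EP.
rewrite det_mulmx det_lblock det1 mul1r mulf_neq0 //; last by rewrite -unitfE -unitmxE.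
by rewrite -[_ + _]opprK opprD -scaleN1r detZ mulf_neq0 // expf_neq0 // oppr_eq0 oner_eq0.
Qed.

End Generic.

Lemma kernel_line (R : realType) n m (W : 'M[R]_(m, n)) (k x : 'rV[R]_m) :
  (\rank W).+1 = m -> k != 0 -> k *m W = 0 -> x *m W = 0 ->
  exists al, x = al *: k.
Proof.
move=> rW k0 /sub_kermxP kW /sub_kermxP xW; apply/sub_rVP.
apply: (submx_trans xW); rewrite -(geq_leqif (mxrank_leqif_sup kW)).
by rewrite mxrank_ker -{1}rW subSnn lt0n mxrank_eq0.
Qed.

(** By cofactor expansion the i-th entry of v \adj W is the determinant of W with
    its i-th row replaced by v.  For a row that is a combination of the others, the
    new matrix is invertible. *)
Lemma adj_generic (R : realType) n (W : 'M[R]_n.+1) (v : 'rV[R]_n.+1) :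
  \rank W = n -> ~~ (v <= W)%MS -> v *m \adj W != 0.
Proof.
move=> rW vW.
have : kermx W != 0 by rewrite -mxrank_eq0 mxrank_ker rW subSnn.
move=> /rowV0Pn[k /sub_kermxP kW k0].
have [i ki] : exists i, k 0 i != 0.
  by apply/existsP; apply: contraT => /existsPn H; case/negP: k0; apply/eqP/rowP=> i;
    rewrite mxE; apply/eqP; move: (H i); rewrite negbK.
pose W' := \matrix_j (if j == i then v else row j W).
have E : (v *m \adj W) 0 i = \det W'.
  rewrite mxE (expand_det_row W' i); apply: eq_bigr => j _.
  rewrite !mxE eqxx; congr (_ * (_ * \det _)).
  by apply/matrixP=> a b; rewrite !mxE eq_sym (negbTE (neq_lift _ _)) mxE.
suff : \det W' != 0 by apply: contra_neq => vz; rewrite -E vz mxE.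
rewrite -unitfE -unitmxE -row_free_unit; apply/row_free0P => x xW'.
have E1 : x 0 i *: v + \sum_(j | j != i) x 0 j *: row j W = 0.
  rewrite -[RHS]xW' mulmx_sum_row [RHS](bigD1 i) //= /W' rowK eqxx; congr (_ + _).
  by apply: eq_bigr => j ji; rewrite /W' rowK (negbTE ji).
have xi : x 0 i = 0.
  apply/eqP; apply: contraNT vW => xi.
  have -> : v = - (x 0 i)^-1 *: \sum_(j | j != i) x 0 j *: row j W.
    rewrite -[X in _ *: X](addKr (x 0 i *: v)) E1 addr0 scalerN scaleNr opprK.
    by rewrite scalerA mulVf // scale1r.
  apply: scalemx_sub; apply: summx_sub => j _; apply: scalemx_sub; exact: row_sub.
have xW : x *m W = 0.
  by rewrite mulmx_sum_row (bigD1 i) //= -[RHS]E1 xi !scale0r.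
have [al Ex] : exists al, x = al *: k by apply: (kernel_line _ k0 kW xW); rewrite rW.
move: xi; rewrite Ex mxE => /eqP; rewrite mulf_eq0 (negbTE ki) orbF => /eqP ->.
by rewrite scale0r.
Qed.

(** A cone that is a neighbourhood of 0 contains a line. *)
Lemma rint_neq0 (R : realType) s d (B : 'M[R]_(s, d.+1)) a :
  unit_sum B -> rint B a -> a != 0.
Proof.
move=> uB ra; apply/eqP => a0.
have : \forall e \near (0 : R)^'+, 0 < e /\ (cone B (e *: (delta_mx 0 0 : 'rV_d.+1)) /\
    cone B (- (e *: (delta_mx 0 0 : 'rV_d.+1)))).
  near=> e; split; first by near: e; exact: nbhs_right_gt.
  split; first by rewrite -[_ *: _]add0r -{1}a0; near: e; exact: ra.
  by rewrite -scalerN -[_ *: _]add0r -{1}a0; near: e; exact: ra.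
move=> /filter_ex[e [e0 [C1 C2]]]; have := cone_pointed uB C1 C2.
move=> /rowP/(_ 0)/eqP; rewrite !mxE !eqxx mulr1 gt_eqF //.
Unshelve. all: by end_near.
Qed.

(** * The degree of a weighted family of cones *)

Section Face.
Variables (R : realType) (s d r : nat).
Variables (B : 'M[R]_(s, d.+1)) (Q : 'M[R]_(d.+1, d.+1 + r)).
Hypothesis uB : unit_sum B.
Implicit Types (P : 'M[R]_(r, d.+1 + r)) (v : 'rV[R]_(d.+1 + r)).

Definition incline P := \det (col_mx Q P).

Definition covers P v := exists2 a, cone B a & (v - a *m Q <= P)%MS.

Definition covers_interior P v := exists2 a, rint B a & (v - a *m Q <= P)%MS.

Definition misses P := forall a, cone B a -> (a *m Q <= P)%MS -> a = 0.

Definition local_degree P v : R := if `[< covers P v >] then Num.sg (incline P) else 0.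

(** Excluded are the image of the boundary of the cone modulo P and, when the
    projection of the face modulo P is not an isomorphism, its whole image, which
    then lies in a proper subspace. *)
Definition regular_value P v :=
  ~ covers P v \/ incline P != 0 /\ covers_interior P v.

(** The numerator of Cramer's rule for the coordinates in Q of the projection of
    v along P.  Unlike the coordinates it is continuous in P everywhere. *)
Definition cramer P v : 'rV[R]_d.+1 := lsubmx (v *m \adj (col_mx Q P)).

Lemma cramerE P v a : (v - a *m Q <= P)%MS -> cramer P v = incline P *: a.
Proof.
move=> /submxP[b E]; rewrite /cramer /incline.
have -> : v = row_mx a b *m col_mx Q P by rewrite mul_row_col -E addrC subrK.
by rewrite -mulmxA mul_mx_adj mul_mx_scalar scale_row_mx row_mxKl.
Qed.

Lemma cramer_sub P v : (incline P *: v - cramer P v *m Q <= P)%MS.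
Proof.
have -> : incline P *: v = v *m \adj (col_mx Q P) *m col_mx Q P.
  by rewrite -mulmxA mul_adj_mx mul_mx_scalar.
rewrite -[v *m _]hsubmxK mul_row_col addrAC subrr add0r.
exact: submxMl.
Qed.

Lemma coverP P v : incline P != 0 ->
  covers P v <-> cone B ((incline P)^-1 *: cramer P v).
Proof.
move=> D0; split=> [[a Ca /cramerE ->]|C]; first by rewrite scalerA mulVf // scale1r.
exists ((incline P)^-1 *: cramer P v) => //.
have -> : v - (incline P)^-1 *: cramer P v *m Q =
    (incline P)^-1 *: (incline P *: v - cramer P v *m Q).
  by rewrite scalerBr scalerA mulVf // scale1r scalemxAl.
exact/scalemx_sub/cramer_sub.
Qed.

Lemma cover_interiorP P v : incline P != 0 ->
  covers_interior P v <-> rint B ((incline P)^-1 *: cramer P v).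
Proof.
move=> D0; split=> [[a Ca /cramerE ->]|C]; first by rewrite scalerA mulVf // scale1r.
exists ((incline P)^-1 *: cramer P v) => //.
have -> : v - (incline P)^-1 *: cramer P v *m Q =
    (incline P)^-1 *: (incline P *: v - cramer P v *m Q).
  by rewrite scalerBr scalerA mulVf // scale1r scalemxAl.
exact/scalemx_sub/cramer_sub.
Qed.

Lemma covers_interior_covers P v : covers_interior P v -> covers P v.
Proof. by case=> a /rint_cone Ca H; exists a. Qed.

(** This is the hypothesis of [cone_avoid_near]: a linear relation between the
    generators of the cone and the rows of P exhibits a common vector of the cone
    and the row space of P. *)
Lemma pointed_face P c b : row_free P -> misses P -> nonneg c ->
  c *m (B *m Q) + b *m P = 0 -> c = 0 /\ b = 0.
Proof.
move=> fP mP c0 E.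
have : c *m B = 0.
  apply: mP; first by exists c.
  have -> : c *m B *m Q = - b *m P.
    by rewrite mulNmx -mulmxA; apply/eqP; rewrite -addr_eq0 E.
  exact: submxMl.
move=> cB; have cz := unit_sum_eq0 uB c0 cB.
split=> //; move: E; rewrite cz mul0mx add0r.
exact: (proj2 (row_free0P P) fP).
Qed.

Lemma misses_incline P : incline P != 0 -> misses P.
Proof.
move=> D0 a Ca aQ.
have : (0 - (- a) *m Q <= P)%MS by rewrite mulNmx sub0r opprK.
move=> /cramerE; rewrite /cramer mul0mx linear0 => /eqP.
by rewrite eq_sym scaler_eq0 (negbTE D0) oppr_eq0 => /eqP.
Qed.

Section Limit.
Variables (T : Type) (F : set_system T).
Context {FF : Filter F}.
Variables (Pt : T -> 'M[R]_(r, d.+1 + r)) (P : 'M[R]_(r, d.+1 + r)).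
Hypotheses (cP : Pt @ F --> P) (fP : row_free P).

Lemma cvg_incline : (fun t => incline (Pt t)) @ F --> incline P.
Proof. by apply: cvg_det; apply: cvg_col_mx => //; exact: cvg_cst. Qed.

Lemma cvg_cramer v : (fun t => cramer (Pt t) v) @ F --> cramer P v.
Proof.
apply: cvg_lsubmx; apply: cvg_mulmx; first exact: cvg_cst.
by apply: cvg_adj; apply: cvg_col_mx => //; exact: cvg_cst.
Qed.

Lemma sg_near (f : T -> R) l : f @ F --> l -> l != 0 ->
  \forall t \near F, Num.sg (f t) = Num.sg l.
Proof.
move=> fl l0; have [lp|ln] := ltP 0 l.
  have H : \forall t \near F, 0 < f t by exact: cvgr_gt fl _ lp.
  by apply: filterS H => t ft; rewrite !gtr0_sg.
have {}ln : l < 0 by rewrite lt_neqAle l0.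
have H : \forall t \near F, f t < 0 by exact: cvgr_lt fl _ ln.
by apply: filterS H => t ft; rewrite !ltr0_sg.
Qed.

(** An uncovered value stays uncovered because the sum of the cone and the
    subspace is closed, even as the subspace moves ([cone_avoid_near]); a value
    covered by an interior point stays so because the coordinates of that point
    are continuous. *)
Lemma local_degree_near v : misses P -> regular_value P v ->
  \forall t \near F, regular_value (Pt t) v /\
    local_degree (Pt t) v = local_degree P v.
Proof.
move=> mP [nv|[D0 vi]].
  have : \forall t \near F, forall c b, nonneg c ->
      c *m (B *m Q) + b *m Pt t <> v.
    apply: (@cone_avoid_near _ _ F _ _ _ _ (fun=> B *m Q) Pt (fun=> v) (B *m Q) P v) => //.
    - exact: cvg_cst.
    - exact: cvg_cst.
    - move=> c b c0; exact: pointed_face.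
    move=> c b c0 E; apply: nv; exists (c *m B); first by exists c.
    by rewrite -E -mulmxA addrAC subrr add0r submxMl.
  apply: filterS => t H.
  have nt : ~ covers (Pt t) v.
    move=> [a [c c0 ->]] /submxP[b E]; apply: (H c b c0).
    by rewrite mulmxA -E addrC subrK.
  split; first by left.
  by rewrite /local_degree; do 2 case: asboolP => //.
have ri := proj1 (cover_interiorP v D0) vi.
have H1 := sg_near cvg_incline D0.
have H2 : \forall t \near F, rint B ((incline (Pt t))^-1 *: cramer (Pt t) v).
  have : (fun t => (incline (Pt t))^-1 *: cramer (Pt t) v) @ F -->
      (incline P)^-1 *: cramer P v.
    apply: cvg_scalemx; last exact: cvg_cramer.
    exact: cvgV D0 cvg_incline.
  by move=> /(_ _ (rint_near ri)).
apply: filterS2 H1 H2 => t sg ri'.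
have Dt : incline (Pt t) != 0 by rewrite -sgr_eq0 sg sgr_eq0.
have vt := proj2 (cover_interiorP v Dt) ri'.
split; first by right.
rewrite /local_degree sg; case: asboolP => [_|n]; case: asboolP => // n'.
  by case: n'; exact: covers_interior_covers.
by case: n; exact: covers_interior_covers.
Qed.

(** At the crossing Q stacked on P is singular with a one-dimensional kernel,
    spanned by the relation that expresses the common vector a0.  Hence the
    numerator of Cramer's rule for v tends to a nonzero multiple al of a0, while
    the denominator tends to 0.  The coordinates of v are then close to a large
    multiple of a0: in the interior of the cone when the factor is positive, and
    in the opposite cone when it is negative. *)
Lemma local_degree_crossing v a0 : rint B a0 -> (a0 *m Q <= P)%MS ->
  \rank (col_mx Q P) = (d + r)%N -> ~~ (v <= col_mx Q P)%MS ->
  exists2 al : R, al != 0 & \forall t \near F, incline (Pt t) != 0 ->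
    regular_value (Pt t) v /\ local_degree (Pt t) v =
      if 0 < incline (Pt t) * al then Num.sg (incline (Pt t)) else 0.
Proof.
move=> ra0 aP rW vW.
have a0n := rint_neq0 uB ra0.
have [b0 Eb0] := submxP aP.
have D0 : incline P = 0.
  apply/eqP; apply: contraT => D0; move/eqP: a0n; case.
  exact: (misses_incline D0 (rint_cone ra0) aP).
have rW' : (\rank (col_mx Q P)).+1 = (d.+1 + r)%N by rewrite rW.
pose k := row_mx a0 (- b0).
have kW : k *m col_mx Q P = 0 by rewrite mul_row_col mulNmx -Eb0 subrr.
have k0 : k != 0 by rewrite row_mx_eq0 (negbTE a0n).
have [al E] : exists al, cramer P v = al *: a0.
  have := cramer_sub P v; rewrite D0 scale0r sub0r eqmx_opp => /submxP[b Eb].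
  have : row_mx (cramer P v) (- b) *m col_mx Q P = 0.
    by rewrite mul_row_col mulNmx -Eb subrr.
  move=> /(kernel_line rW' k0 kW)[al]; rewrite /k scale_row_mx => /eq_row_mx[-> _].
  by exists al.
have al0 : al != 0.
  apply: contraNneq (adj_generic rW vW) => al0.
  have := cramer_sub P v; rewrite E al0 scale0r.
  have : v *m \adj (col_mx Q P) *m col_mx Q P = 0.
    by rewrite -mulmxA mul_adj_mx mul_mx_scalar -/(incline P) D0 scale0r.
  rewrite -[v *m _]hsubmxK mul_row_col -/(cramer P v) E al0 scale0r mul0mx add0r.
  by move=> /(proj2 (row_free0P P) fP) ->; rewrite row_mx0.
exists al => //.
have : \forall t \near F, rint B (al^-1 *: cramer (Pt t) v).
  have : (fun t => al^-1 *: cramer (Pt t) v) @ F --> al^-1 *: cramer P v.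
    by apply: cvg_scalemx; [exact: cvg_cst|exact: cvg_cramer].
  by rewrite E scalerA mulVf // scale1r => /(_ _ (rint_near ra0)).
apply: filterS => t; set y := _ *: _ => ry Dt.
have Ey : (incline (Pt t))^-1 *: cramer (Pt t) v = (al / incline (Pt t)) *: y.
  by rewrite /y scalerA mulrAC mulfV // mul1r.
have Eq : al / incline (Pt t) = incline (Pt t) * al * (incline (Pt t))^-1 ^+ 2.
  by field.
have D2 : 0 < (incline (Pt t))^-1 ^+ 2 by rewrite exprn_even_gt0 // invr_eq0 Dt orbT.
have [Dp|Dn] := ltP 0 (incline (Pt t) * al).
  have ci : covers_interior (Pt t) v.
    by apply/cover_interiorP => //; rewrite Ey; apply: rintZ => //; rewrite Eq mulr_gt0.
  split; first by right.
  by rewrite /local_degree; case: asboolP => // n; case: n; exact: covers_interior_covers.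
have {}Dn : al / incline (Pt t) < 0.
  by rewrite Eq pmulr_llt0 // lt_neqAle Dn andbT mulf_neq0.
have nc : ~ covers (Pt t) v.
  move=> /(coverP _ Dt); rewrite Ey => Cy.
  have := rint_neq0 uB ry; rewrite (cone_pointed uB (rint_cone ry)) ?eqxx //.
  have -> : - y = (- (al / incline (Pt t)))^-1 *: ((al / incline (Pt t)) *: y).
    by rewrite scalerA invrN mulNr mulVf ?lt_eqF // scaleN1r.
  by apply: coneZ => //; rewrite invr_ge0 oppr_ge0 ltW.
split; first by left.
by rewrite /local_degree; case: asboolP.
Qed.

End Limit.
End Face.

(** * Counting the facets met by a segment *)

Section FacetCount.
Variables (R : realType) (s d : nat) (B : 'M[R]_(s, d.+1)).
Hypotheses (uB : unit_sum B) (fB : row_full B).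

Definition ridge_free (a0 a1 : 'rV[R]_d.+1) := forall t, 0 < t < 1 ->
  forall I : {set 'I_s}, (#|I| < d)%N -> ~~ (seg a0 a1 t <= subrows B I)%MS.

Definition wall_transverse (a0 a1 : 'rV[R]_d.+1) := forall I : {set 'I_s},
  (#|I| <= d)%N -> ~~ ((a0 <= subrows B I)%MS && (a1 <= subrows B I)%MS).

Lemma seg_rev a0 a1 (t : R) : seg a1 a0 t = seg a0 a1 (1 - t) :> 'rV[R]_d.+1.
Proof. by apply/rowP=> i; rewrite !mxE; ring. Qed.

Lemma seg_left a0 a1 (g t : R) : seg a0 (seg a0 a1 g) t = seg a0 a1 (t * g) :> 'rV[R]_d.+1.
Proof. by apply/rowP=> i; rewrite !mxE; ring. Qed.

Lemma seg_right a0 a1 (g t : R) :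
  seg (seg a0 a1 g) a1 t = seg a0 a1 (g + t * (1 - g)) :> 'rV[R]_d.+1.
Proof. by apply/rowP=> i; rewrite !mxE; ring. Qed.

Lemma ridge_free_rev a0 a1 : ridge_free a0 a1 -> ridge_free a1 a0.
Proof. by move=> H t t01 I dI; rewrite seg_rev; apply: H => //; lra. Qed.

Lemma hit_rev a0 a1 h : hit B a1 a0 h <-> hit B a0 a1 h.
Proof.
have W b0 b1 : hit B b1 b0 h -> hit B b0 b1 h.
  by move=> [t [t01]]; rewrite seg_rev => C E; exists (1 - t); split=> //; lra.
by split; apply: W.
Qed.

Lemma mul_in01 (t g : R) : 0 < t < 1 -> 0 < g < 1 -> 0 < t * g < 1.
Proof.
by move=> /andP[t0 t1] /andP[g0 g1]; rewrite mulr_gt0 //= mulr_ilt1 // ltW.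
Qed.

Lemma mix_in01 (t g : R) : 0 < t < 1 -> 0 < g < 1 -> 0 < g + t * (1 - g) < 1.
Proof.
move=> t01 g01; have := mul_in01 (t := 1 - t) (g := 1 - g); lra.
Qed.

Section Split.
Variables (a0 a1 : 'rV[R]_d.+1) (g : R).
Hypothesis g01 : 0 < g < 1.
Let c := seg a0 a1 g.

Lemma ridge_free_split : ridge_free a0 a1 -> ridge_free a0 c /\ ridge_free c a1.
Proof.
move=> H; split=> t t01 I dI.
  by rewrite seg_left; apply: H => //; exact: mul_in01.
by rewrite seg_right; apply: H => //; exact: mix_in01.
Qed.

Lemma hit_split h t : 0 < t < 1 -> cone B (seg a0 a1 t) ->
  pairing (seg a0 a1 t) h = 0 ->
  [\/ hit B a0 c h, hit B c a1 h | t = g].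
Proof.
have /andP[g0 g1] := g01; move=> /andP[t0 t1] C E.
have [tg|gt|tg] := ltrgtP t g; last by constructor 3.
  constructor 1; exists (t / g); split.
  - by rewrite divr_gt0 //= ltr_pdivrMr // mul1r.
  - by rewrite seg_left divfK ?gt_eqF.
  - by rewrite seg_left divfK ?gt_eqF.
have g1' : 0 < 1 - g by rewrite subr_gt0.
have g1n : 1 - g != 0 by rewrite gt_eqF.
constructor 2; exists ((t - g) / (1 - g)); split.
- by rewrite divr_gt0 ?subr_gt0 //= ltr_pdivrMr // mul1r ltrD2r.
- by rewrite seg_right divfK // addrC subrK.
- by rewrite seg_right divfK // addrC subrK.
Qed.

Lemma hit_left h : hit B a0 c h -> hit B a0 a1 h.
Proof.
move=> [t [t01]]; rewrite seg_left => C E; exists (t * g); split=> //.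
exact: mul_in01.
Qed.

Lemma hit_right h : hit B c a1 h -> hit B a0 a1 h.
Proof.
move=> [t [t01]]; rewrite seg_right => C E; exists (g + t * (1 - g)); split=> //.
exact: mix_in01.
Qed.

Lemma pairing_left h : pairing (c - a0) h = g * pairing (a1 - a0) h.
Proof. by rewrite /c /seg addrAC subrr add0r pairingZ. Qed.

Lemma pairing_right h : pairing (a1 - c) h = (1 - g) * pairing (a1 - a0) h.
Proof. by rewrite -pairingZ; congr pairing; apply/rowP=> i; rewrite !mxE; ring. Qed.

End Split.

Variables (T : eqType) (inc : pred T) (h : T -> 'cV[R]_d.+1).
Hypothesis h_supp : forall e, inc e -> supporting B (h e).
Hypothesis h_compl : forall k, facet_functional B k ->
  exists2 e, inc e & exists2 l, 0 < l & h e = l *: k.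
Hypothesis h_inj : forall e e' l, inc e -> inc e' -> 0 < l -> h e' = l *: h e -> e' = e.

Lemma exit_index a0 a1 : ridge_free a0 a1 ->
  rint B a0 -> ~ cone B a1 ->
  exists e, [/\ inc e, hit B a0 a1 (h e), pairing (a1 - a0) (h e) < 0 &
    forall e', inc e' -> hit B a0 a1 (h e') -> e' = e].
Proof.
move=> rf r0 n1; have [k [fk [t [t01 C E]] neg uniq_k]] := exit_facet uB fB rf r0 n1.
have [e ie [l l0 hE]] := h_compl fk.
exists e; split=> //.
- by exists t; split=> //; rewrite hE /pairing -scalemxAr mxE [X in _ * X]E mulr0.
- rewrite hE /pairing -scalemxAr mxE; by rewrite pmulr_rlt0.
move=> e' ie' /(uniq_k _ (h_supp ie'))[l' l'0 hE'].
apply: (h_inj (l := l' / l)) => //; first by rewrite divr_gt0.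
by rewrite hE scalerA divfK // gt_eqF.
Qed.

(** From a boundary point the segment enters the cone in one of its two
    directions, since it is transverse to the facet; between the two points of the
    cone it is interior. *)
Lemma interior_inside a0 a1 t : ridge_free a0 a1 -> wall_transverse a0 a1 ->
  0 < t < 1 -> cone B (seg a0 a1 t) ->
  exists2 g, 0 < g < 1 & rint B (seg a0 a1 g).
Proof.
move=> rf wt t01 C; have [r|[k [fk kt push]]] := facet_or_interior fB C (rf _ t01).
  by exists t.
have tau0 := hit_transverse rf wt fk.1 t01 C kt.
have /andP[t0 t1] := t01.
wlog [sg [sg1 kp]] : / exists sg : R, `|sg| = 1 /\ 0 < pairing (sg *: (a1 - a0)) k.
  apply; have [kp|kn] := ltP 0 (pairing (a1 - a0) k).
    by exists 1; rewrite normr1 scale1r.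
  exists (-1); rewrite normrN normr1 scaleN1r pairingN oppr_gt0; split=> //.
  by rewrite lt_neqAle tau0.
have : \forall e \near (0 : R)^'+, [/\ 0 < e, e < Num.min t (1 - t) &
    cone B (seg a0 a1 (t + e * sg))].
  have m0 : 0 < Num.min t (1 - t) by rewrite lt_min t0 subr_gt0.
  near=> e; split; [near: e; exact: nbhs_right_gt|near: e; exact: nbhs_right_lt|].
  rewrite /seg scalerDl addrA -scalerA; near: e; exact: push.
move=> /filter_ex[e [e0]]; rewrite lt_min => /andP[et et1] Ce.
have sgE : sg = 1 \/ sg = -1.
  have [p|n] := leP 0 sg; first by left; rewrite -sg1 ger0_norm.
  by right; rewrite -sg1 ltr0_norm // opprK.
exists (t + e / 2 * sg); first by case: sgE => ->; lra.
case: sgE => sE; rewrite sE in Ce *.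
  by apply: (between_interior fB rf wt _ _ _ _ C Ce) => //; lra.
by apply: (between_interior fB rf wt _ _ _ _ Ce C) => //; lra.
Unshelve. all: by end_near.
Qed.

(** By convexity the segment meets no facet, enters through one, leaves through
    one, or does both, according to which ends lie in the cone; a functional
    increases when the segment enters through its facet and decreases when it
    leaves.  When both ends are outside, the segment is cut at an interior
    point. *)
Lemma facet_count a0 a1 : ridge_free a0 a1 -> wall_transverse a0 a1 ->
  (~ cone B a0 \/ rint B a0) -> (~ cone B a1 \/ rint B a1) ->
  exists E : seq T, [/\ uniq E,
    forall e, e \in E = inc e && `[< hit B a0 a1 (h e) >] &
    \sum_(e <- E) Num.sg (pairing (a1 - a0) (h e)) =
      (`[< cone B a1 >])%:R - (`[< cone B a0 >])%:R].
Proof.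
move=> rf wt [n0|r0] [n1|r1].
- have [[t t01 C]|none] := pselect (exists2 t, 0 < t < 1 & cone B (seg a0 a1 t)); last first.
    exists [::]; split=> //.
      move=> e; rewrite in_nil; symmetry; apply/negbTE/negP => /andP[_ /asboolP[t [t01 C _]]].
      by apply: none; exists t.
    by rewrite big_nil; do 2 case: asboolP => //; rewrite subrr.
  have [g g01 rg] := interior_inside rf wt t01 C.
  have [rfl rfr] := ridge_free_split g01 rf.
  have /andP[g0 g1] := g01.
  have [e1 [i1 h1 neg1 u1]] := exit_index (ridge_free_rev rfl) rg n0.
  have [e2 [i2 h2 neg2 u2]] := exit_index rfr rg n1.
  have p1 : 0 < pairing (a1 - a0) (h e1).
    have : 0 < pairing (seg a0 a1 g - a0) (h e1).
      by move: neg1; rewrite -opprB pairingN oppr_lt0.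
    by rewrite pairing_left pmulr_rgt0.
  have p2 : pairing (a1 - a0) (h e2) < 0.
    by move: neg2; rewrite pairing_right pmulr_rlt0 // subr_gt0.
  have e12 : e1 != e2.
    by apply/eqP => E; move: p1; rewrite E ltNge (ltW p2).
  exists [:: e1; e2]; split.
  + by rewrite /= inE e12.
  + move=> e; rewrite !inE; apply/orP/andP => [[/eqP->|/eqP->]|[ie /asboolP[t' [t'01 C' E']]]].
    * by split=> //; apply/asboolP; apply: (hit_left g01); apply/hit_rev.
    * by split=> //; apply/asboolP; exact: (hit_right g01).
    have [/hit_rev H|H|tg] := hit_split g01 t'01 C' E'.
    * by left; rewrite (u1 _ ie H).
    * by right; rewrite (u2 _ ie H).
    by have := rint_supporting (h_supp ie) rg; rewrite -tg E' ltxx.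
  + rewrite !big_cons big_nil gtr0_sg // ltr0_sg // addr0 subrr.
    by do 2 case: asboolP => //; rewrite subrr.
- have [e [ie he neg ue]] := exit_index (ridge_free_rev rf) r1 n0.
  exists [:: e]; split=> //.
  + move=> e'; rewrite inE; apply/eqP/andP => [->|[ie' /asboolP/hit_rev he']].
      by split=> //; apply/asboolP/hit_rev.
    exact: ue.
  + rewrite big_cons big_nil addr0 -opprB pairingN gtr0_sg ?oppr_gt0 //.
    case: asboolP => [_|]; last by have := rint_cone r1.
    by case: asboolP => // _; rewrite subr0.
- have [e [ie he neg ue]] := exit_index rf r0 n1.
  exists [:: e]; split=> //.
  + move=> e'; rewrite inE; apply/eqP/andP => [->|[ie' /asboolP he']].
      by split=> //; apply/asboolP.
    exact: ue.
  + rewrite big_cons big_nil addr0 ltr0_sg //.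
    case: asboolP => // _.
    by case: asboolP => [_|]; [rewrite sub0r|have := rint_cone r0].
- exists [::]; split=> //.
    move=> e; rewrite in_nil; symmetry; apply/negbTE/negP => /andP[ie /asboolP].
    exact: (no_hit r0 r1 (h_supp ie)).
  rewrite big_nil; case: asboolP => [_|]; last by have := rint_cone r1.
  by case: asboolP => [_|]; [rewrite subrr|have := rint_cone r0].
Qed.

End FacetCount.

Section Coordinates.
Variables (R : realType) (s d r : nat).
Variables (B : 'M[R]_(s, d.+1)) (Q : 'M[R]_(d.+1, d.+1 + r)).
Hypotheses (uB : unit_sum B).
Implicit Types (P : 'M[R]_(r, d.+1 + r)) (v : 'rV[R]_(d.+1 + r)).

(** The cone over the face covers v modulo P when this point lies in the cone, so
    the projection modulo P is replaced by an affine image in a fixed space. *)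
Definition coord P v : 'rV[R]_d.+1 := (incline Q P)^-1 *: cramer Q P v.

Lemma coordP P v a : incline Q P != 0 -> (v - a *m Q <= P)%MS -> a = coord P v.
Proof. by move=> D0 /cramerE; rewrite /coord => ->; rewrite scalerA mulVf // scale1r. Qed.

Lemma coord_sub P v : incline Q P != 0 -> (v - coord P v *m Q <= P)%MS.
Proof.
move=> D0; have -> : v - coord P v *m Q =
    (incline Q P)^-1 *: (incline Q P *: v - cramer Q P v *m Q).
  by rewrite scalerBr scalerA mulVf // scale1r scalemxAl.
exact/scalemx_sub/cramer_sub.
Qed.

Lemma coord_seg P v v' t : coord P (v + t *: (v' - v)) = seg (coord P v) (coord P v') t.
Proof.
rewrite /coord /cramer /seg mulmxDl -scalemxAl mulmxBl linearD linearZ linearB /=.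
by rewrite scalerDr -scalerBr !scalerA [t * _]mulrC.
Qed.

Lemma coordB P v v' : coord P (v' - v) = coord P v' - coord P v.
Proof. by rewrite /coord /cramer mulmxBl linearB scalerBr. Qed.

Lemma sub_wall P v a (I : {set 'I_s}) : (v - a *m Q <= P)%MS ->
  (a <= subrows B I)%MS -> (v <= col_mx (subrows B I *m Q) P)%MS.
Proof.
move=> vP aI; rewrite -[v](subrK (a *m Q)) addmx_sub //; rewrite -addsmxE.
  exact: submx_trans (addsmxSr _ _).
apply: submx_trans (addsmxSl _ _); exact: submxMr.
Qed.

(** A minimal expression of a covering point uses more than d independent
    generators, so it is an interior point. *)
Lemma generic_regular P v :
  (forall I : {set 'I_s}, (#|I| <= d)%N -> ~~ (v <= col_mx (subrows B I *m Q) P)%MS) ->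
  (incline Q P = 0 -> ~~ (v <= col_mx Q P)%MS) ->
  regular_value B Q P v.
Proof.
move=> gI gQ; have [D0|D0] := eqVneq (incline Q P) 0.
  left=> -[a _ /submxP[b E]]; move/negP: (gQ D0); apply.
  by rewrite -[v](subrK (a *m Q)) E addrC -mul_row_col submxMl.
have [cv|] := pselect (covers B Q P v); last by left.
right; split=> //; have [a Ca va] := cv; exists a => //.
have [I [c [c0 cI E fI]]] := cone_caratheodory Ca.
rewrite E; apply: (rint_full c0 cI).
have aI : (a <= subrows B I)%MS.
  by rewrite E; apply: supp_subrows; exact: support_zero.
have dI : (d < #|I|)%N.
  by rewrite ltnNge; apply/negP => /gI; rewrite (sub_wall va aI).
move: (rank_leq_col (subrows B I)); rewrite (rank_subrows fI) => Id.
by rewrite /row_full (rank_subrows fI) eqn_leq Id dI.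
Qed.

End Coordinates.

(** * Independence of the regular value *)

Section Degree.
Variables (R : realType) (d r : nat) (F : finType) (s : F -> nat).
Variables (B : forall f, 'M[R]_(s f, d.+1)) (Q : F -> 'M[R]_(d.+1, d.+1 + r)).
Variable w : F -> R.
Hypotheses (uB : forall f, unit_sum (B f)) (fB : forall f, row_full (B f)).
Hypothesis fQ : forall f, row_free (Q f).
Implicit Types (P : 'M[R]_(r, d.+1 + r)) (v : 'rV[R]_(d.+1 + r)).

Definition degree P v := \sum_f w f * local_degree (B f) (Q f) P v.

Definition regular P v := forall f, w f != 0 -> regular_value (B f) (Q f) P v.

Definition avoids P := forall f, w f != 0 -> misses (B f) (Q f) P.

(** The walls are the images modulo P of the cones on at most d generators.  A
    vector off the walls is not in the image of the boundary of a cone, and a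
    segment ending there is transverse to the facets. *)
Definition off_walls P v := forall f (I : {set 'I_(s f)}), (#|I| <= d)%N ->
  ~~ (v <= col_mx (subrows (B f) I *m Q f) P)%MS.

(** Beyond v0, a segment from v0 meets the image of a cone on fewer than d
    generators only if its end lies in the span of that image and v0. *)
Definition off_ridges P v0 v := forall f (I : {set 'I_(s f)}), (#|I| < d)%N ->
  ~~ (v <= col_mx (col_mx (subrows (B f) I *m Q f) P) v0)%MS.

(** All the conditions say that v is outside finitely many proper subspaces. *)
Lemma exists_generic P v0 v1 : exists v,
  [/\ off_walls P v, off_ridges P v0 v, off_ridges P v1 v &
      forall f, incline (Q f) P = 0 -> ~~ (v <= col_mx (Q f) P)%MS].
Proof.
pose X := {f : F & {set 'I_(s f)}}.
pose A (x : X + X * bool + F) : 'M[R]_((d + r).+1) :=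
  match x with
  | inl (inl x) => if (#|tagged x| <= d)%N
      then <<col_mx (subrows (B (tag x)) (tagged x) *m Q (tag x)) P>>%MS else 0
  | inl (inr (x, b)) => if (#|tagged x| < d)%N
      then <<col_mx (col_mx (subrows (B (tag x)) (tagged x) *m Q (tag x)) P)
              (if b then v0 else v1)>>%MS else 0
  | inr f => if incline (Q f) P == 0 then <<col_mx (Q f) P>>%MS else 0
  end.
have [v vP] : exists v, forall x, ~~ (v <= A x)%MS.
  apply: generic_vector => -[[x|[x b]]|f] /=.
  - case: ifP => dx; rewrite ?mxrank0 // genmxE.
    by apply: leq_ltn_trans (rank_leq_row _) _; rewrite ltnS leq_add2r.
  - case: ifP => dx; rewrite ?mxrank0 // genmxE.
    apply: leq_ltn_trans (rank_leq_row _) _.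
    by rewrite addn1 ltnS -addSn leq_add2r.
  case: eqP => D0; rewrite ?mxrank0 // genmxE.
  rewrite ltn_neqAle rank_leq_row andbT.
  apply/negP => fl; have : incline (Q f) P != 0; last by rewrite D0 eqxx.
  by rewrite -unitfE -unitmxE -row_free_unit.
exists v; split.
- by move=> f I dI; have := vP (inl (inl (Tagged (fun f => {set 'I_(s f)}) I))); rewrite /= dI genmxE.
- by move=> f I dI; have := vP (inl (inr (Tagged (fun f => {set 'I_(s f)}) I, true))); rewrite /= dI genmxE.
- by move=> f I dI; have := vP (inl (inr (Tagged (fun f => {set 'I_(s f)}) I, false))); rewrite /= dI genmxE.
- by move=> f D0; have := vP (inr f); rewrite /= D0 eqxx genmxE.
Qed.

Lemma degree_near (T : Type) (G : set_system T) {FG : Filter G} Pt P v :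
  Pt @ G --> P -> row_free P -> avoids P -> regular P v ->
  \forall t \near G, regular (Pt t) v /\ degree (Pt t) v = degree P v.
Proof.
move=> cP fP aP rP.
have : \forall t \near G, forall f, w f != 0 -> regular_value (B f) (Q f) (Pt t) v /\
    local_degree (B f) (Q f) (Pt t) v = local_degree (B f) (Q f) P v.
  apply: filter_forall => f; have [wf|wf] := eqVneq (w f) 0.
    by apply: nearW => t; rewrite ?wf ?eqxx.
  have H := @local_degree_near _ _ _ _ _ _ (uB f) T G FG Pt P cP fP v (aP f wf) (rP f wf).
  by apply: (@filterS _ G FG) H => t H _.
apply: (@filterS _ G FG) => t H; split=> [f wf|]; first by have [] := H f wf.
apply: eq_bigr => f _; have [->|wf] := eqVneq (w f) 0; first by rewrite !mul0r.
by have [_ ->] := H f wf.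
Qed.

(** K e is the cone over the facet e, with frame Qe e, and X e f expresses the
    frame of the face f in the one made of the inward vector nrm e f and Qe e.  The
    first column of X e f is then the functional on coordinates that vanishes on
    the facet and is positive inside. *)
Variables (T : eqType) (inc : T -> pred F) (K : T -> set 'rV[R]_(d.+1 + r)).
Variables (Qe : T -> 'M[R]_(d, d.+1 + r)) (nrm : T -> F -> 'rV[R]_(d.+1 + r)).
Variable X : T -> F -> 'M[R]_(1 + d).

Definition facet_height e f : 'cV[R]_d.+1 := col 0 (X e f).

Hypothesis frameE : forall e f, inc e f -> Q f = X e f *m col_mx (nrm e f) (Qe e).
Hypothesis height_supp : forall e f, inc e f -> supporting (B f) (facet_height e f).
Hypothesis facet_coneP : forall e f a, inc e f -> cone (B f) a ->
  K e (a *m Q f) <-> pairing a (facet_height e f) = 0.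
Hypothesis facet_cone_sub : forall e f y, inc e f -> K e y ->
  exists2 a, cone (B f) a & y = a *m Q f.
Hypothesis facet_compl : forall f k, facet_functional (B f) k ->
  exists2 e, inc e f & exists2 l, 0 < l & facet_height e f = l *: k.
Hypothesis facet_inj : forall f e e' l, inc e f -> inc e' f -> 0 < l ->
  facet_height e' f = l *: facet_height e f -> e' = e.
Hypothesis balance : forall e, \sum_(f | inc e f) Num.sg (\det (X e f)) * w f = 0.

(** The segment from v to v' meets the facet modulo P.  This does not refer to
    any of the faces at the facet, so that the crossings of all of them can be
    compared. *)
Definition strip_hits P v v' e := exists t y,
  [/\ 0 < t < 1, K e y & (v + t *: (v' - v) - y <= P)%MS].

Lemma strip_hitsP P v v' e f : inc e f -> incline (Q f) P != 0 ->
  strip_hits P v v' e <-> hit (B f) (coord (Q f) P v) (coord (Q f) P v') (facet_height e f).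
Proof.
move=> ef D0; split=> [[t [y [t01 Ky]]]|[t [t01 C E]]].
  have [a Ca yE] := facet_cone_sub ef Ky; rewrite yE => /(coordP D0) aE.
  exists t; rewrite -coord_seg -aE; split=> //.
  by apply/(facet_coneP ef Ca); rewrite -yE.
exists t, (coord (Q f) P (v + t *: (v' - v)) *m Q f); split=> //.
  by rewrite coord_seg; apply/(facet_coneP ef C).
exact: coord_sub.
Qed.

(** Both sides compare the frame (u, Qe) with (nrm, Qe) modulo P.  The right-hand
    side depends on the face only through the sign that enters the balance. *)
Lemma crossing_sign_facet P u e f : inc e f -> incline (Q f) P != 0 ->
  Num.sg (incline (Q f) P) * Num.sg (pairing (coord (Q f) P u) (facet_height e f)) =
  Num.sg (\det (X e f)) * Num.sg (incline (col_mx u (Qe e)) P).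
Proof.
move=> ef D0; set a := coord (Q f) P u.
have /submxP[b Eb] : (u - a *m Q f <= P)%MS by exact: coord_sub.
pose D := \det (col_mx (col_mx (nrm e f) (Qe e)) P).
have E1 : incline (Q f) P = \det (X e f) * D.
  rewrite /incline /D (frameE ef).
  have -> : col_mx (X e f *m col_mx (nrm e f) (Qe e)) P =
      block_mx (X e f) 0 0 1%:M *m col_mx (col_mx (nrm e f) (Qe e)) P.
    by rewrite mul_block_col !mul0mx mul1mx add0r addr0.
  by rewrite det_mulmx det_ublock det1 mulr1.
have E2 : incline (col_mx u (Qe e)) P = pairing a (facet_height e f) * D.
  pose Y : 'M[R]_(1 + d) := block_mx (lsubmx (a *m X e f)) (rsubmx (a *m X e f)) 0 1%:M.
  have -> : incline (col_mx u (Qe e)) P = \det (block_mx Y (col_mx b 0) 0 1%:M) * D.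
    rewrite /incline /D -det_mulmx mul_block_col !mul0mx mul1mx add0r.
    congr (\det (col_mx _ _)); rewrite /Y mul_block_col mul0mx mul1mx add0r.
    rewrite mul_col_mx mul0mx add_col_mx addr0 -mul_row_col hsubmxK.
    by rewrite -mulmxA -(frameE ef) -Eb addrC subrK.
  rewrite det_ublock det1 mulr1 /Y det_ublock det1 mulr1; congr (_ * _).
  rewrite [lsubmx _]mx11_scalar det_scalar1 mxE /pairing /facet_height.
  by rewrite colE mulmxA -colE [RHS]mxE (_ : lshift d 0 = 0) //; exact: val_inj.
by rewrite E1 E2 !sgrM -mulrA [Num.sg D * _]mulrC.
Qed.

(** The difference of the degrees is a sum over the faces and, for each face, over
    its facets met by the segment.  Summing over the facets first, the faces at
    one facet contribute a common sign times the left-hand side of the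
    balance. *)
Lemma degree_constant_generic P v v' : (forall f, w f != 0 -> incline (Q f) P != 0) ->
  regular P v -> regular P v' -> off_walls P v' -> off_ridges P v v' ->
  degree P v = degree P v'.
Proof.
move=> D0 rv rv' ow or.
have [E EP] : exists E : F -> seq T, forall f, w f != 0 ->
   [/\ uniq (E f), forall e, e \in E f = inc e f && `[< strip_hits P v v' e >] &
    local_degree (B f) (Q f) P v' - local_degree (B f) (Q f) P v =
    \sum_(e <- E f) Num.sg (\det (X e f)) * Num.sg (incline (col_mx (v' - v) (Qe e)) P)].
  suff /choice[E EP] : forall f, exists Ef : seq T, w f != 0 ->
    [/\ uniq Ef, forall e, e \in Ef = inc e f && `[< strip_hits P v v' e >] &
    local_degree (B f) (Q f) P v' - local_degree (B f) (Q f) P v =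
    \sum_(e <- Ef) Num.sg (\det (X e f)) * Num.sg (incline (col_mx (v' - v) (Qe e)) P)].
    by exists E.
  move=> f; have [wf|wf] := eqVneq (w f) 0; first by exists [::]; rewrite ?wf ?eqxx.
  have Df := D0 f wf; have vf := coord_sub v Df; have vf' := coord_sub v' Df.
  have rf : ridge_free (B f) (coord (Q f) P v) (coord (Q f) P v').
    move=> t /andP[t0 t1] I dI; apply/negP => tI; move/negP: (or f I dI); apply.
    have := sub_wall (coord_sub (v + t *: (v' - v)) Df); rewrite coord_seg => /(_ _ _ _ tI) vt.
    have -> : v' = t^-1 *: (v + t *: (v' - v)) + (1 - t^-1) *: v.
      apply/rowP=> i; rewrite !mxE; field; exact: lt0r_neq0.
    rewrite -addsmxE addmx_sub //.
      by apply: submx_trans (addsmxSl _ _); exact: scalemx_sub.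
    by apply: submx_trans (addsmxSr _ _); exact: scalemx_sub.
  have wt : wall_transverse (B f) (coord (Q f) P v) (coord (Q f) P v').
    move=> I dI; rewrite negb_and; apply/orP; right; apply/negP => vI.
    by move/negP: (ow f I dI); apply; exact: sub_wall vf' vI.
  have ends u : regular_value (B f) (Q f) P u ->
      ~ cone (B f) (coord (Q f) P u) \/ rint (B f) (coord (Q f) P u).
    move=> [nu|[_ /(cover_interiorP _ _ Df)]]; last by right.
    by left=> Cu; apply: nu; apply/(coverP _ _ Df).
  have [Ef [uE mE sE]] := facet_count (uB f) (fB f) (fun e => @height_supp e f)
    (@facet_compl f) (@facet_inj f) rf wt (ends _ (rv f wf)) (ends _ (rv' f wf)).
  exists Ef => _; split=> //.
    move=> e; rewrite mE; apply: andb_id2l => ef; apply/asboolP/asboolP.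
      by move=> /(strip_hitsP _ _ ef Df).
    by move=> /(strip_hitsP _ _ ef Df).
  have ldE u : local_degree (B f) (Q f) P u =
      Num.sg (incline (Q f) P) * (`[< cone (B f) (coord (Q f) P u) >])%:R.
    rewrite /local_degree (_ : `[< covers _ _ _ _ >] = `[< cone (B f) (coord (Q f) P u) >]).
      by case: asboolP; rewrite ?mulr1 ?mulr0.
    by apply/asboolP/asboolP => /(coverP _ _ Df).
  rewrite !ldE -mulrBr -sE mulr_sumr; apply: eq_big_seq => e; rewrite mE => /andP[ef _].
  by rewrite -coordB crossing_sign_facet.
apply/eqP; rewrite eq_sym -subr_eq0 /degree -sumrB; apply/eqP.
pose S := undup (flatten [seq E f | f <- enum F & w f != 0]).
have SP e : e \in S -> strip_hits P v v' e.
  rewrite mem_undup => /flattenP[l /mapP[f]]; rewrite mem_filter => /andP[wf _] ->.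
  by have [_ -> _] := EP f wf => /andP[_ /asboolP].
have ES f : w f != 0 -> perm_eq (E f) [seq e <- S | inc e f].
  move=> wf; have [uE mE _] := EP f wf; apply: uniq_perm => //.
    by rewrite filter_uniq // undup_uniq.
  move=> e; rewrite mem_filter mE; apply: andb_id2l => ef; apply/asboolP/idP.
    move=> he; rewrite mem_undup; apply/flattenP; exists (E f).
      by apply/mapP; exists f => //; rewrite mem_filter wf mem_enum.
    by rewrite mE ef; apply/asboolP.
  exact: SP.
transitivity (\sum_f \sum_(e <- S | inc e f) w f *
    (Num.sg (\det (X e f)) * Num.sg (incline (col_mx (v' - v) (Qe e)) P))).
  apply: eq_bigr => f _; rewrite -mulrBr.
  have [->|wf] := eqVneq (w f) 0.
    by rewrite mul0r big1 // => e _; rewrite mul0r.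
  have [_ _ ->] := EP f wf; rewrite (perm_big _ (ES f wf)) /= big_filter.
  by rewrite mulr_sumr.
rewrite (exchange_big_dep xpredT) //= big1 // => e _.
under eq_bigr do rewrite mulrA [w _ * _]mulrC.
by rewrite -mulr_suml balance mul0r.
Qed.

(** A small perturbation of P changes neither degree and makes every face project
    isomorphically.  The segment between the two values need not be generic, so
    both are joined to a third, generic one. *)
Theorem degree_constant P v v' : row_free P -> avoids P ->
  regular P v -> regular P v' -> degree P v = degree P v'.
Proof.
move=> fP aP rv rv'.
have [M MP] := generic_perturbation P fQ.
have cP : (fun e : R => P + e *: M) @ 0^'+ --> P.
  rewrite -[X in _ --> X]addr0 -(scale0r M).
  apply: cvg_addmx; first exact: cvg_cst.
  apply: cvg_scalemx; last exact: cvg_cst.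
  apply: (@cvg_at_right_filter _ _ id); exact: cvg_id.
have near_deg u : regular P u -> \forall e \near (0 : R)^'+,
    regular (P + e *: M) u /\ degree (P + e *: M) u = degree P u.
  by move=> ru; exact: degree_near cP fP aP ru.
have [e [De [[r1 E1] [r2 E2]]]] : exists e, (forall f, incline (Q f) (P + e *: M) != 0) /\
   ((regular (P + e *: M) v /\ degree (P + e *: M) v = degree P v) /\
    (regular (P + e *: M) v' /\ degree (P + e *: M) v' = degree P v')).
  have H : \forall e \near (0 : R)^'+, (forall f, incline (Q f) (P + e *: M) != 0) /\
   ((regular (P + e *: M) v /\ degree (P + e *: M) v = degree P v) /\
    (regular (P + e *: M) v' /\ degree (P + e *: M) v' = degree P v')).
    near=> e; split; first by near: e; exact: MP.
    by split; near: e; exact: near_deg.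
  by have [e] := filter_ex H; exists e.
have [u [ow or1 or2 uQ]] := exists_generic (P + e *: M) v v'.
have ru : regular (P + e *: M) u.
  by move=> f wf; apply: generic_regular; [exact: ow|exact: uQ].
rewrite -E1 -E2 (degree_constant_generic _ r1 ru ow or1) //.
by rewrite (degree_constant_generic _ r2 ru ow or2).
Unshelve. all: by end_near.
Qed.

End Degree.

(** * Volumes and distances in homogeneous coordinates *)

Section Homogeneous.
Variable R : realType.

(** Subtracting the first point from the others is a unimodular operation. *)
Lemma homog_directions k n (q : 'M[R]_(k.+1, n)) :
  homog q = (block_mx 1%:M 0 (const_mx 1) 1%:M : 'M[R]_(1 + k)) *m
            col_mx (row_mx 1%:M (row ord0 q)) (row_mx 0 (directions q)).
Proof.
rewrite mul_block_col !mul1mx mul0mx addr0 mul_mx_row mulmx1.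
rewrite add_row_mx addr0; apply/matrixP=> i j.
rewrite [RHS]mxE; case: splitP => i' ii'.
  rewrite [RHS]mxE [LHS]mxE; case: splitP => j' jj'.
    by rewrite !mxE (ord1 i') (ord1 j') eqxx.
  by rewrite !mxE; congr (q _ _); apply: val_inj; rewrite /= ii' (ord1 i').
rewrite [RHS]mxE [LHS]mxE; case: splitP => j' jj'; rewrite !mxE //.
rewrite big_ord1 !mxE mul1r addrC subrK; congr (q _ _).
by apply: val_inj; rewrite /= ii'.
Qed.

Lemma det_unimodular k : \det (block_mx 1%:M 0 (const_mx 1) 1%:M : 'M[R]_(1 + k)) = 1.
Proof. by rewrite det_lblock !det1 mulr1. Qed.

Lemma det_homog n (q : 'M[R]_(n.+1, n)) : \det (homog q) = \det (directions q).
Proof.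
rewrite homog_directions det_mulmx det_unimodular mul1r.
have -> : col_mx (row_mx 1%:M (row ord0 q)) (row_mx 0 (directions q)) =
   block_mx 1%:M (row ord0 q) 0 (directions q) by [].
by rewrite (det_ublock (1%:M : 'M[R]_1)) det1 mul1r.
Qed.

Lemma aff_indep_directions k n (q : 'M[R]_(k.+1, n)) :
  aff_indep q -> row_free (directions q).
Proof.
move=> fq; apply/row_free0P => x xq.
have U := det_unimodular k.
set L := block_mx _ _ _ _ in U.
have uL : L \in unitmx by rewrite unitmxE U unitr1.
have : row_mx 0 x *m invmx L *m homog q = 0.
  rewrite homog_directions -mulmxA mulKmx // mul_row_col mul0mx add0r.
  by rewrite mul_mx_row mulmx0 xq row_mx0.
move=> /(proj2 (row_free0P _) fq) /(congr1 (mulmx^~ L)).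
rewrite mulmxKV // mul0mx => /eqP; rewrite row_mx_eq0 => /andP[_ /eqP].
by [].
Qed.

Lemma normsq_eq0 n (x : 'rV[R]_n) : (x *m x^T) 0 0 = 0 -> x = 0.
Proof.
rewrite mxE => /eqP; under eq_bigr do rewrite mxE.
rewrite psumr_eq0 => [|i _]; last by rewrite -expr2 sqr_ge0.
move=> /allP H; apply/rowP=> i; rewrite [RHS]mxE; apply/eqP.
by have := H i; rewrite mem_index_enum mulf_eq0 orbb; apply.
Qed.

Lemma normsq_ge0 n (x : 'rV[R]_n) : 0 <= (x *m x^T) 0 0.
Proof.
rewrite mxE; apply: sumr_ge0 => i _; rewrite mxE -expr2; exact: sqr_ge0.
Qed.

(** The determinant does not vanish on the segment of positive definite matrices
    from the identity to a Gram matrix, so it stays positive. *)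
Lemma gram_gt0 k n (V : 'M[R]_(k, n)) : row_free V -> 0 < \det (V *m V^T).
Proof.
move=> fV; pose G (t : R) := (1 - t) *: 1%:M + t *: (V *m V^T).
have G0 t : 0 <= t -> t <= 1 -> \det (G t) != 0.
  move=> t0 t1; rewrite -unitfE -unitmxE -row_free_unit; apply/row_free0P => x xG.
  have : (1 - t) * (x *m x^T) 0 0 + t * ((x *m V) *m (x *m V)^T) 0 0 = 0.
    transitivity ((x *m G t *m x^T) 0 0); last by rewrite xG mul0mx mxE.
    rewrite /G mulmxDr mulmxDl -!scalemxAr -!scalemxAl mulmx1 [RHS]mxE.
    by rewrite trmx_mul !mulmxA; congr (_ + _); rewrite [RHS]mxE.
  move=> /eqP; rewrite paddr_eq0 ?mulr_ge0 ?subr_ge0 ?normsq_ge0 //.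
  case/andP; have [->|t1'] := eqVneq t 1.
    rewrite mul1r => _ /eqP/normsq_eq0; exact: (proj2 (row_free0P V) fV).
  rewrite mulf_eq0 subr_eq0 eq_sym (negbTE t1') => /eqP/normsq_eq0 //.
have cG : continuous (fun t => \det (G t)).
  move=> t; apply: cvg_det; apply: cvg_addmx; apply: cvg_scalemx.
  - by apply: cvgB; [exact: cvg_cst|exact: cvg_id].
  - exact: cvg_cst.
  - exact: cvg_id.
  - exact: cvg_cst.
have G1 : \det (V *m V^T) = \det (G 1) by rewrite /G subrr scale0r add0r scale1r.
have Gz : \det (G 0) = 1 by rewrite /G subr0 scale0r addr0 scale1r det1.
rewrite G1 ltNge; apply/negP => neg.
have [c] : exists2 c, c \in `[0, 1] & \det (G c) = 0.
  apply: IVT; [exact: ler01|exact: continuous_subspaceT|].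
  by rewrite Gz ge_min neg orbT le_max ler01.
rewrite in_itv /= => /andP[c0 c1] /eqP; exact/negP/G0.
Qed.

Lemma vol_gt0 k n (q : 'M[R]_(k.+1, n)) : aff_indep q -> 0 < vol (directions q).
Proof.
by move=> /aff_indep_directions/gram_gt0; rewrite /vol sqrtr_gt0.
Qed.

(** The first row of the determinant in homogeneous coordinates is the first
    point of f; subtracting it from all others gives the determinant that defines
    the distance. *)
Lemma dist_incline m k (l : gr R k (m + k.+1)) (f : gr R m (m + k.+1)) :
  dist l f = incline (homog (points f)) (homog (points l)) /
    (vol (directions (points f)) * vol (directions (points l))).
Proof.
rewrite /dist; congr (_ / _); rewrite conform_mx_id /incline.
have -> : col_mx (homog (points f)) (homog (points l)) =
    homog (col_mx (points f) (points l) : 'M[R]_((m + k.+1).+1, m + k.+1)).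
  rewrite /homog; apply/matrixP=> i j; rewrite [RHS]mxE [LHS]mxE.
  case: splitP => i' ii'; rewrite [LHS]mxE; case: splitP => j' jj'; rewrite !mxE //.
    case: splitP => i2 Ei; first by congr (_ _ _); apply: val_inj; rewrite /= -ii' Ei.
    by have := ltn_ord i'; rewrite -ii' Ei ltnNge leq_addr.
  case: splitP => i2 Ei; first by have := ltn_ord i2; rewrite -Ei ii' ltnNge leq_addr.
  by congr (_ _ _); apply: val_inj; apply/eqP; rewrite -(eqn_add2l m.+1) -ii' Ei.
rewrite det_homog; congr (\det _); apply/matrixP=> i j.
rewrite [LHS]mxE; case: splitP => i' ii'; rewrite !mxE; case: splitP => i2 /= Ei.
- case: splitP => i3 E3; last by (have E4 : 0%N = (m.+1 + i3)%N := E3); rewrite addSn in E4.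
  congr (_ - _); congr (points f _ _); apply: val_inj => //=.
  by rewrite -Ei ii'.
- by have := ltn_ord i'; rewrite -ii' -ltnS -[i.+1]/(bump 0 i) Ei ltnNge leq_addr.
- by have := ltn_ord i2; rewrite -Ei /bump /= add1n ii' ltnNge leq_addr.
case: splitP => i3 E3; last by (have E4 : 0%N = (m.+1 + i3)%N := E3); rewrite addSn in E4.
congr (_ - _); last by congr (points f _ _); apply: val_inj.
congr (points l _ _); apply: val_inj; apply/eqP; rewrite -(eqn_add2l m.+1) -Ei.
by rewrite /bump /= ii' addSn.
Qed.

(** The first column, the homogeneous coordinate, forces the change of frame to be
    block triangular with 1 in the corner. *)
Lemma block_change k n (a b : 'rV[R]_n) (V W : 'M[R]_(k, n)) (Z : 'M[R]_(1 + k)) :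
  col_mx (row_mx 1%:M a) (row_mx 0 V) = Z *m col_mx (row_mx 1%:M b) (row_mx 0 W) ->
  exists2 z : 'M[R]_k, V = z *m W & \det Z = \det z.
Proof.
rewrite -{1}[Z]submxK mul_block_col !mul_mx_row !mulmx1 !mulmx0.
rewrite !add_row_mx !addr0 => /eq_col_mx[/eq_row_mx[z11 _] /eq_row_mx[z21 VE]].
exists (drsubmx Z); first by rewrite VE -z21 mul0mx add0r.
by rewrite -[in LHS](submxK Z) -z21 -z11 det_ublock det1 mul1r.
Qed.

Lemma vol_mul k n (V W : 'M[R]_(k, n)) (z : 'M[R]_k) :
  V = z *m W -> vol V = `|\det z| * vol W.
Proof.
move=> ->; rewrite /vol.
have -> : z *m W *m (z *m W)^T = z *m (W *m W^T) *m z^T by rewrite trmx_mul !mulmxA.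
by rewrite !det_mulmx det_tr mulrAC -expr2 sqrtrM ?sqr_ge0 // sqrtr_sqr.
Qed.

Lemma vol_change k n (q p : 'M[R]_(k.+1, n)) (A : 'M[R]_k.+1) :
  homog q = A *m homog p -> vol (directions q) = `|\det A| * vol (directions p).
Proof.
rewrite !homog_directions mulmxA; have U := det_unimodular k.
set L := block_mx _ _ _ _ in U *.
have uL : L \in unitmx by rewrite unitmxE U unitr1.
move=> /(congr1 (mulmx (invmx L))); rewrite mulKmx // mulmxA.
move=> /block_change[z Vz dz]; rewrite (vol_mul Vz) -dz !det_mulmx det_inv U.
by rewrite invr1 mul1r mulr1.
Qed.

(** The parallelepiped spanned by p and the unit normal u is a prism of height 1
    over the one spanned by p, so it has the same volume. *)
Lemma vol_frame k n (q : 'M[R]_(k.+2, n)) (p : 'M[R]_(k.+1, n)) (u : 'rV[R]_n)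
    (X : 'M[R]_(1 + k.+1)) :
  homog q = X *m col_mx (row_mx 0 u) (homog p) ->
  dot u u = 1 -> directions p *m u^T = 0 ->
  vol (directions q) = `|\det X| * vol (directions p).
Proof.
move=> qX uu up.
(* S exchanges the first two rows: the normal comes first in the frame, and the
   base point first in homogeneous coordinates *)
pose S : 'M[R]_(1 + (1 + k)) := block_mx 0 (row_mx 1%:M 0) (col_mx 1%:M 0) (block_mx 0 0 0 1%:M).
have SE q' (a : 'M[R]_(1, q')) b c : S *m col_mx a (col_mx b c) = col_mx b (col_mx a c).
  rewrite mul_block_col mul_row_col mul_col_mx mul_block_col !mul0mx !mul1mx.
  by rewrite add0r !addr0 add_col_mx addr0 !add0r.
have SS : \det S * \det S = 1.
  rewrite -det_mulmx -[RHS](det1 R (1 + (1 + k))); congr (\det _).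
  have SSY (Y : 'M[R]_(1 + (1 + k))) : S *m (S *m Y) = Y.
    by rewrite -[Y]vsubmxK -[dsubmx Y]vsubmxK !SE.
  by rewrite -[RHS]SSY mulmx1.
have Uq := det_unimodular k.+1; have Up := det_unimodular k.
set Lq := block_mx _ _ _ _ in Uq; set Lp := block_mx _ _ _ _ in Up.
have uLq : Lq \in unitmx by rewrite unitmxE Uq unitr1.
pose D : 'M[R]_(1 + k.+1) := block_mx 1%:M 0 0 (Lp : 'M[R]_k.+1).
pose Z : 'M[R]_(1 + k.+1) := invmx Lq *m X *m D *m (S : 'M[R]_(1 + k.+1)).
have dZ : \det Z = \det X * \det S.
  rewrite /Z !det_mulmx det_inv Uq invr1 mul1r.
  by rewrite (det_ublock (1%:M : 'M[R]_1)) det1 Up !mul1r mulr1.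
have EZ : col_mx (row_mx 1%:M (row ord0 q)) (row_mx 0 (directions q)) =
    Z *m col_mx (row_mx 1%:M (row ord0 p)) (row_mx 0 (col_mx u (directions p))).
  have -> : row_mx (0 : 'M[R]_(1 + k, 1)) (col_mx u (directions p)) =
      col_mx (row_mx 0 u) (row_mx 0 (directions p)).
    transitivity (block_mx 0 u 0 (directions p) : 'M[R]_(1 + k, 1 + n)) => //.
    by rewrite block_mxEh col_mx0.
  rewrite /Z -!mulmxA SE.
  have -> : D *m col_mx (row_mx 0 u) (col_mx (row_mx 1%:M (row ord0 p)) (row_mx 0 (directions p)))
      = col_mx (row_mx 0 u) (homog p).
    by rewrite /D mul_block_col !mul0mx mul1mx addr0 add0r -homog_directions.
  by rewrite -qX homog_directions mulKmx.
have [z Vz dz] := block_change EZ.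
have nZ : `|\det z| = `|\det X|.
  rewrite -dz dZ normrM; suff -> : `|\det S| = 1 by rewrite mulr1.
  by apply/eqP; rewrite -(@pexpr_eq1 _ _ 2) // -normrX expr2 SS normr1.
pose V := col_mx u (directions p).
(* the Gram matrix is block diagonal, the normal being a unit vector orthogonal
   to the other directions *)
have gramV : \det (V *m V^T) = \det (directions p *m (directions p)^T).
  have up' : u *m (directions p)^T = 0 by rewrite -[LHS]trmxK trmx_mul trmxK up trmx0.
  rewrite /V tr_col_mx mul_col_row up up'.
  have -> : u *m u^T = 1%:M by rewrite [LHS]mx11_scalar -/(dot u u) uu.
  by rewrite (det_lblock (1%:M : 'M[R]_1)) det1 mul1r.
by rewrite (vol_mul Vz) nZ {1}/vol -/V gramV.
Qed.

End Homogeneous.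

(** * Polytopes as cones *)

Section Polytopes.
Variables (R : realType) (n : nat).
Implicit Types (A S : set 'rV[R]_n) (x y : 'rV[R]_n).

Lemma homog_neq0 x : homog x != 0.
Proof.
apply/eqP => /matrixP/(_ 0 (lshift n 0)); rewrite /homog row_mxEl !mxE.
by move/eqP; rewrite oner_eq0.
Qed.

Lemma homog_comb s (c : 'rV[R]_s) (M : 'M[R]_(s, n)) :
  c *m homog M = row_mx (c *m const_mx 1) (c *m M).
Proof. by rewrite /homog mul_mx_row. Qed.

Lemma homog_combP s (c : 'rV[R]_s) (M : 'M[R]_(s, n)) x :
  homog x = c *m homog M <-> c *m (const_mx 1 : 'cV_s) = const_mx 1 /\ x = c *m M.
Proof.
rewrite homog_comb; split=> [/eq_row_mx[-> ->] //|[-> ->]]; by [].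
Qed.

Lemma sum_const1 s (c : 'rV[R]_s) : (c *m (const_mx 1 : 'cV_s)) = (\sum_i c 0 i)%:M.
Proof.
apply/matrixP=> i j; rewrite !ord1 !mxE eqxx mulr1n.
by apply: eq_bigr => k _; rewrite mxE mulr1.
Qed.

Lemma const1_scalar : const_mx 1 = 1%:M :> 'M[R]_1.
Proof. by apply/matrixP=> i j; rewrite !ord1 !mxE eqxx. Qed.

(** Convexity concerns two points; the points are combined one after the other,
    the partial sums being normalized to total weight 1. *)
Lemma convex_comb A s (M : 'M[R]_(s, n)) : @convex_set R 'rV[R]_n A ->
  (forall i, A (row i M)) ->
  forall c : 'rV[R]_s, nonneg c -> \sum_i c 0 i = 1 -> A (c *m M).
Proof.
move=> cA AM c c0 c1.
have comb a b t : A a -> A b -> 0 <= t -> t <= 1 -> A (t *: a + (1 - t) *: b).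
  move=> Aa Ab t0 t1.
  have t01 : Itv.spec (@Itv.num_sem R) (Itv.Real `[0, 1]%Z) t.
    by rewrite /Itv.num_sem /= num_real /= in_itv /= t0.
  have := cA a b (Itv.Def t01); rewrite !inE; exact.
rewrite mulmx_sum_row.
suff H (r : seq 'I_s) : 0 < \sum_(i <- r) c 0 i ->
    A ((\sum_(i <- r) c 0 i)^-1 *: \sum_(i <- r) c 0 i *: row i M).
  have := H (index_enum _); rewrite c1 invr1 scale1r; apply; exact: ltr01.
elim: r => [|i r IH]; first by rewrite big_nil ltxx.
rewrite !big_cons => pos.
have [r0|r0] := eqVneq (\sum_(j <- r) c 0 j) 0.
  have -> : \sum_(j <- r) c 0 j *: row j M = 0.
    apply: big1_seq => j /andP[_ jr]; move/eqP: r0; rewrite psumr_eq0 => [|k _]; last exact: c0.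
    by move=> /allP/(_ j jr)/eqP ->; rewrite scale0r.
  move: pos; rewrite r0 !addr0 => pos.
  by rewrite scalerA mulVf ?gt_eqF // scale1r.
have rp : 0 < \sum_(j <- r) c 0 j by rewrite lt_neqAle eq_sym r0 sumr_ge0.
set a := c 0 i in pos *; set b := \sum_(j <- r) c 0 j in rp pos IH r0 *.
have := comb _ _ (a / (a + b)) (AM i) (IH rp).
have a0 : 0 <= a by exact: c0.
rewrite divr_ge0 ?(ltW pos) // ler_pdivrMr // mul1r lerDl (ltW rp).
move=> /(_ isT isT); congr A; rewrite scalerDr !scalerA [a / _]mulrC.
congr (_ + _ *: _); rewrite -/a; field; by rewrite !gt_eqF.
Qed.

(** Translated to one of its points, a set closed under affine combinations of two
    points is closed under multiples and sums. *)
Lemma affine_comb A k (M : 'M[R]_(k.+1, n)) : affine_set A ->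
  (forall i, A (row i M)) ->
  forall c : 'rV[R]_k.+1, \sum_i c 0 i = 1 -> A (c *m M).
Proof.
move=> aA AM c c1; pose p0 := row ord0 M.
pose V := [set v | A (p0 + v)].
have VZ v t : V v -> V (t *: v).
  rewrite /V /= => Av; have := aA _ _ t (AM ord0) Av.
  by rewrite -/p0 scalerDr addrA -scalerDl subrK scale1r.
have VD u v : V u -> V v -> V (u + v).
  move=> /(VZ _ 2) Vu /(VZ _ 2) Vv; rewrite /V /=.
  have := aA _ _ 2^-1 Vu Vv; rewrite !scalerDr !scalerA addrACA -scalerDl subrK scale1r.
  have -> : (1 - 2^-1) * 2 = 1 :> R by field.
  by rewrite mulVf ?scale1r // pnatr_eq0.
have -> : c *m M = p0 + \sum_i c 0 i *: (row i M - p0).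
  rewrite mulmx_sum_row; under [in RHS]eq_bigr do rewrite scalerBr.
  by rewrite sumrB -scaler_suml c1 scale1r addrC subrK.
suff : V (\sum_i c 0 i *: (row i M - p0)) by [].
elim/big_ind: _ => [|u v|i _]; [by rewrite /V /= addr0; exact: AM|exact: VD|].
by apply: VZ; rewrite /V /= addrC subrK; exact: AM.
Qed.

Lemma homog_row k (q : 'M[R]_(k, n)) i : homog (row i q) = row i (homog q).
Proof. by apply/rowP=> j; rewrite !mxE; case: splitP => j' _; rewrite !mxE. Qed.

Lemma homog_affine x y (t : R) :
  homog ((1 - t) *: x + t *: y) = (1 - t) *: homog x + t *: homog y.
Proof.
rewrite /homog !scale_row_mx add_row_mx; congr row_mx.
by apply/matrixP=> i j; rewrite !mxE !mulr1 subrK.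
Qed.

Lemma span_pts_affine k (q : 'M[R]_(k, n)) : affine_set (span_pts q).
Proof.
by move=> x y t Hx Hy; rewrite /span_pts /= homog_affine addmx_sub // scalemx_sub.
Qed.

Lemma span_pts_row k (q : 'M[R]_(k, n)) i : span_pts q (row i q).
Proof.
by rewrite /span_pts /= homog_row row_sub.
Qed.

Lemma generator_mem A s (M : 'M[R]_(s, n)) :
  (forall x, A x <-> cone (homog M) (homog x)) -> forall i, A (row i M).
Proof.
move=> AM i; apply/AM; exists (delta_mx 0 i); first by move=> j; rewrite mxE ler0n.
by rewrite -rowE homog_row.
Qed.

Lemma affine_span A k (M : 'M[R]_(k, n)) : affine_set A ->
  (forall i, A (row i M)) -> span_pts M `<=` A.
Proof.
case: k M => [|k] M aA AM x; rewrite /span_pts /= => /submxP[c].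
  by rewrite [c]thinmx0 mul0mx => /eqP; rewrite (negbTE (homog_neq0 x)).
move=> /homog_combP[c1 ->]; apply: affine_comb => //.
move: c1; rewrite sum_const1 const1_scalar => /matrixP/(_ 0 0).
by rewrite !mxE eqxx !mulr1n.
Qed.

Lemma affhull_sub A S : affine_set A -> S `<=` A -> affhull S `<=` A.
Proof. by move=> aA SA; exact: smallest_sub. Qed.

Lemma sub_affhull S : S `<=` affhull S.
Proof. exact: sub_gen_smallest. Qed.

(** A combination of homogeneous vectors of points has first coordinate 1 exactly
    when its coefficients add up to 1. *)
Lemma convhull_cone S : finite_set S -> exists s (M : 'M[R]_(s, n)),
  (forall x, convhull S x <-> cone (homog M) (homog x)).
Proof.
move=> /finite_seqP[l Sl]; exists (size l), (\matrix_(i < size l) nth 0 l i).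
set M := \matrix_i _ => x.
have SM i : S (row i M).
  by rewrite Sl /= rowK; apply: mem_nth.
split=> [Sx|].
  apply: (Sx [set y | cone (homog M) (homog y)]); split.
    move=> y z t; rewrite !inE => -[c c0 /homog_combP[c1 ->]] [e e0 /homog_combP[e1 ->]].
    exists (t%:num *: c + (1 - t%:num) *: e).
      by move=> i; rewrite !mxE addr_ge0 // mulr_ge0 // subr_ge0.
    apply/homog_combP; rewrite !mulmxDl -!scalemxAl c1 e1; split=> //.
    by apply/matrixP=> i j; rewrite !mxE !mulr1 addrC subrK.
  move=> y Sy; have : y \in l by move: Sy; rewrite Sl.
  move=> /(nthP 0)[i il <-]; exists (delta_mx 0 (Ordinal il)).
    by move=> j; rewrite mxE ler0n.
  by rewrite -rowE -homog_row rowK.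
move=> [c c0 /homog_combP[c1 ->]] A [cA SA].
apply: convex_comb => //; first by move=> i; apply: SA.
move: c1; rewrite sum_const1 const1_scalar => /matrixP/(_ 0 0).
by rewrite !mxE eqxx !mulr1n.
Qed.

End Polytopes.

Section PolytopeCone.
Variables (R : realType) (n k : nat) (A : set 'rV[R]_n) (q : 'M[R]_(k.+1, n)).
Hypotheses (fq : aff_indep q) (hq : affhull A = span_pts q).

(** The rows of B are the affine coordinates of the vertices in the frame q.  In
    these coordinates the cone over the polytope has full dimension. *)
Definition polytope_coords s (B : 'M[R]_(s, k.+1)) :=
  [/\ unit_sum B, row_full B &
      forall x, A x <-> exists2 a, cone B a & homog x = a *m homog q].

Lemma polytope_coords_exist s (M : 'M[R]_(s, n)) :
  (forall x, A x <-> cone (homog M) (homog x)) ->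
  exists2 B : 'M[R]_(s, k.+1), polytope_coords B & homog M = B *m homog q.
Proof.
move=> AM.
have AMi := generator_mem AM.
have Mq : (homog M <= homog q)%MS.
  apply/row_subP => i; rewrite -homog_row.
  have : affhull A (row i M) by apply: sub_affhull.
  by rewrite hq.
have qM : (homog q <= homog M)%MS.
  apply/row_subP => i; rewrite -homog_row.
  have : affhull A (row i q) by rewrite hq; exact: span_pts_row.
  move=> Aq; apply: (@affhull_sub _ _ (span_pts M) A (@span_pts_affine _ _ _ M) _ _ Aq) => x /AM[c _ E].
  by rewrite /span_pts /= E submxMl.
have [B EB] := submxP Mq; exists B => //; split.
- rewrite /unit_sum; have := EB; rewrite {2}/homog mul_mx_row => /eq_row_mx[<- _].
  by [].
- rewrite -col_leq_rank; apply: leq_trans (_ : \rank (homog M) <= _)%N.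
    by rewrite -(eqP fq); exact: mxrankS.
  by rewrite EB mxrankM_maxl.
move=> x; rewrite AM; split=> [[c c0 E]|[a [c c0 ->]]].
  by exists (c *m B); [exists c|rewrite E EB mulmxA].
by rewrite -mulmxA -EB => E; exists c.
Qed.

Variables (s : nat) (B : 'M[R]_(s, k.+1)).
Hypothesis BP : polytope_coords B.

(** A point moved in the space of coordinates is brought back to the affine plane
    by dividing by its first homogeneous coordinate, which is close to 1. *)
Lemma relint_rint x a : relint A x -> homog x = a *m homog q -> rint B a.
Proof.
have [uB fB AB] := BP; move=> [Ax near_x] E z.
have [a1 xE] : a *m (const_mx 1 : 'cV_k.+1) = const_mx 1 /\ x = a *m q.
  exact/homog_combP.
pose l (t : R) := pairing (a + t *: z) (const_mx 1).
have lE t : (a + t *: z) *m (const_mx 1 : 'cV_k.+1) = (l t)%:M.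
  by rewrite [LHS]mx11_scalar.
have cl : (fun t => l t) @ (0 : R)^'+ --> (1 : R).
  have -> : (1 : R) = l 0.
    by rewrite /l scale0r addr0 /pairing a1 mxE.
  apply: cvg_at_right_filter; rewrite /l /pairing; apply: cvg_coord.
  apply: cvg_mulmx; last exact: cvg_cst.
  apply: cvg_addmx; first exact: cvg_cst.
  by apply: cvg_scalemx; [exact: cvg_id|exact: cvg_cst].
have cx : (fun t => (l t)^-1 *: ((a + t *: z) *m q)) @ (0 : R)^'+ --> x.
  rewrite -[x]scale1r -(invr1 R) xE -[in X in _ --> X](addr0 a) -[in X in _ --> X](scale0r z).
  apply: cvg_scalemx; first by apply: cvgV => //; exact: oner_neq0.
  apply: cvg_mulmx; last exact: cvg_cst.
  apply: cvg_addmx; first exact: cvg_cst.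
  apply: cvg_scalemx; last exact: cvg_cst.
  apply: (@cvg_at_right_filter _ _ id); exact: cvg_id.
have lp : \forall t \near (0 : R)^'+, 0 < l t by exact: cvgr_gt cl _ ltr01.
have nx : \forall t \near (0 : R)^'+, affhull A ((l t)^-1 *: ((a + t *: z) *m q)) ->
   A ((l t)^-1 *: ((a + t *: z) *m q)) := cx _ near_x.
apply: filterS2 lp nx => t lt H.
have E1 : homog ((l t)^-1 *: ((a + t *: z) *m q)) = ((l t)^-1 *: (a + t *: z)) *m homog q.
  apply/homog_combP; rewrite -!scalemxAl lE; split=> //.
  by rewrite const1_scalar scale_scalar_mx mulVf // gt_eqF.
have /AB[a' Ca'] : A ((l t)^-1 *: ((a + t *: z) *m q)).
  by apply: H; rewrite hq /span_pts /= E1 submxMl.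
rewrite E1 => /(row_free_inj fq) Ea.
have -> : a + t *: z = l t *: ((l t)^-1 *: (a + t *: z)).
  by rewrite scalerA mulfV ?scale1r // gt_eqF.
by apply: coneZ; [exact: ltW|rewrite Ea].
Qed.

(** The sum of the coordinates is positive on nonzero vectors of the cone; dividing
    by it gives a point of the polytope. *)
Lemma cone_section a : cone B a -> a != 0 ->
  exists x l, [/\ 0 < l, A x & a *m homog q = l *: homog x].
Proof.
have [uB fB AB] := BP; move=> Ca a0.
pose l := pairing a (const_mx 1).
have lE : a *m (const_mx 1 : 'cV_k.+1) = l%:M by rewrite [LHS]mx11_scalar.
have l0 : 0 <= l.
  move: Ca => [c c0 E]; rewrite /l E pairing_cone; apply: sumr_ge0 => i _.
  by rewrite uB mxE mulr1.
have lp : 0 < l.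
  rewrite lt_neqAle eq_sym l0 andbT; apply: contra_neq a0 => lz.
  have [c c0 E] := Ca.
  rewrite E; suff -> : c = 0 by rewrite mul0mx.
  apply: (@unit_sum_eq0 _ _ _ (const_mx 1 : 'cV[R]_s)) => //.
    by rewrite /unit_sum; apply/matrixP=> i j; rewrite !mxE big_ord1 !mxE mulr1.
  by rewrite -[const_mx 1]uB mulmxA -E lE lz -[0%:M]scalemx1 scale0r.
exists (l^-1 *: (a *m q)), l.
have E : homog (l^-1 *: (a *m q)) = (l^-1 *: a) *m homog q.
  apply/homog_combP; rewrite -!scalemxAl lE; split=> //.
  by rewrite const1_scalar scale_scalar_mx mulVf // gt_eqF.
split=> //; last by rewrite E -scalemxAl scalerA mulfV ?scale1r // gt_eqF.
by apply/AB; exists (l^-1 *: a) => //; apply: coneZ => //; rewrite invr_ge0.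
Qed.

(** The barycentre of the vertices, for which all coefficients are positive. *)
Lemma relint_nonempty : exists x, relint A x.
Proof.
have [uB fB AB] := BP.
have ra : rint B (const_mx 1 *m B).
  apply: (rint_full (I := [set: 'I_s]%SET)).
  - by move=> i; rewrite mxE.
  - by move=> i; rewrite mxE ltr01 inE.
  rewrite -sub1mx; apply: submx_trans (_ : (B <= _)%MS); first by rewrite sub1mx.
  apply/row_subP => i; rewrite rowE; apply: supp_subrows => j; by rewrite inE.
set a := _ *m B in ra.
have [x [l [l0 Ax xE]]] := cone_section (rint_cone ra) (rint_neq0 uB ra).
have hx : homog x = (l^-1 *: a) *m homog q.
  by rewrite -scalemxAl xE scalerA mulVf ?scale1r // gt_eqF.
exists x; split=> //.
have rx : rint B (l^-1 *: a) by apply: rintZ => //; rewrite invr_gt0.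
have cx : (fun y : 'rV[R]_n => homog y *m pinvmx (homog q)) @ x --> l^-1 *: a.
  have -> : l^-1 *: a = homog x *m pinvmx (homog q).
    by rewrite hx -mulmxA (mulmxVp fq) mulmx1.
  apply: (@cvg_mulmx _ _ (nbhs x) _ _ _ _ (fun y : 'rV[R]_n => homog y) (fun=> pinvmx (homog q))); last exact: cvg_cst.
  apply: cvg_mx => i j; rewrite mxE; under eq_fun do rewrite mxE.
  case: splitP => j' _; last exact: coord_continuous.
  exact: cvg_cst.
have : \forall y \near x, cone B (homog y *m pinvmx (homog q)) := cx _ (rint_nbhs rx).
apply: filterS => y Cy; rewrite hq /span_pts /= => yq.
by apply/AB; exists (homog y *m pinvmx (homog q)) => //; rewrite mulmxKpV.
Qed.

End PolytopeCone.

(** * Facets as supporting functionals *)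

Section ConeRows.
Variable R : realType.

(** A subfamily of generators amounts to coefficients vanishing outside it. *)
Lemma cone_subrows s p (B : 'M[R]_(s, p)) (I : {set 'I_s}) a :
  cone (subrows B I) a <->
  exists c, [/\ nonneg c, forall i, i \notin I -> c 0 i = 0 & a = c *m B].
Proof.
split=> [[c c0 ->]|[c [c0 cI ->]]].
  exists (c *m rowsub (@enum_val _ (mem I)) 1%:M); split.
  - by move=> i; rewrite mxE sumr_ge0 // => j _; rewrite !mxE mulr_ge0 // ler0n.
  - move=> i iI; rewrite mxE big1 // => j _; rewrite !mxE.
    case: eqP => [E|_]; last by rewrite mulr0.
    by case/negP: iI; rewrite -E; exact: enum_valP.
  - by rewrite -mulmxA -rowsubE.
exists (\row_j c 0 (enum_val j)); first by move=> j; rewrite mxE.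
rewrite /subrows rowsubE mulmxA; congr (_ *m _); apply/rowP=> i; rewrite mxE.
have [iI|iI] := boolP (i \in I).
  rewrite (bigD1 (enum_rank_in iI i)) //= big1 ?addr0 => [|j ji].
    by rewrite !mxE enum_rankK_in // eqxx mulr1.
  rewrite !mxE; case: eqP => [E|_]; last by rewrite mulr0.
  by case/eqP: ji; apply: enum_val_inj; rewrite enum_rankK_in.
rewrite cI // big1 // => j _; rewrite !mxE; case: eqP => [E|_]; last by rewrite mulr0.
by case/negP: iI; rewrite -E; exact: enum_valP.
Qed.

End ConeRows.

Section FacetFrame.
Variables (R : realType) (n k s : nat) (A E : set 'rV[R]_n).
Variables (q : 'M[R]_(k.+1, n)) (p : 'M[R]_(k, n)).
Variables (M : 'M[R]_(s, n)) (B : 'M[R]_(s, k.+1)).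
Hypotheses (fq : aff_indep q) (hq : affhull A = span_pts q).
Hypotheses (fp : aff_indep p) (hp : affhull E = span_pts p).
Hypotheses (AM : forall x, A x <-> cone (homog M) (homog x)).
Hypotheses (BP : polytope_coords A q B) (EB : homog M = B *m homog q).
Variables (u : 'rV[R]_n) (b : R).
Hypotheses (ub : forall x, A x -> dot u x <= b).
Hypothesis EE : E = A `&` [set x | dot u x = b].

(** The homogeneous form of the inequality dot u x <= b that cuts out the facet. *)
Let U : 'cV[R]_(1 + n) := col_mx b%:M (- u^T).

Lemma homog_functional x : pairing (homog x) U = b - dot u x.
Proof.
rewrite /pairing /U /homog mul_row_col const1_scalar mul1mx mulmxN mxE.
rewrite [X in X + _]mxE eqxx mulr1n [X in _ + X]mxE; congr (_ - _).
by rewrite /dot -[u *m x^T]trmxK trmx_mul trmxK [RHS]mxE.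
Qed.

Lemma E_sub_A x : E x -> A x. Proof. by rewrite EE => -[]. Qed.

Lemma affine_dot : affine_set [set x | dot u x = b].
Proof.
move=> x y t /= xb yb.
have : pairing (homog ((1 - t) *: x + t *: y)) U = 0.
  by rewrite homog_affine pairingD !pairingZ !homog_functional xb yb !subrr !mulr0 addr0.
by rewrite homog_functional => /eqP; rewrite subr_eq0 => /eqP.
Qed.

Lemma facet_memP x : E x <-> A x /\ (homog x <= homog p)%MS.
Proof.
split=> [Ex|[Ax xp]].
  split; first exact: E_sub_A.
  have : affhull E x by exact: sub_affhull.
  by rewrite hp.
rewrite EE; split=> //.
have : affhull E x by rewrite hp.
by apply: (affhull_sub affine_dot); rewrite EE => y [].
Qed.

Lemma facet_plane_functional : homog p *m U = 0.
Proof.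
apply/matrixP=> i j; rewrite ord1 [RHS]mxE.
have : affhull E (row i p) by rewrite hp; exact: span_pts_row.
move=> aff; have H : dot u (row i p) = b.
  by apply: (affhull_sub affine_dot _ aff); rewrite EE => y [].
have : pairing (homog (row i p)) U = 0 by rewrite homog_functional H subrr.
by rewrite /pairing homog_row -row_mul mxE.
Qed.

(** A facet is a polytope in its own right, generated by the vertices on its
    hyperplane, so [relint_nonempty] applies to it.  It provides the point at which
    the conditions on the inner normal take effect. *)
Lemma facet_relint : (0 < k)%N -> exists x, relint E x.
Proof.
(* the frame p of the facet must have a first point *)
case: k q p B fq hq fp hp BP EB facet_memP facet_plane_functional => // k' q' p' B' fq' hq' fp' hp' BP' EB' _ _ _.
pose I := [set i | (homog M *m U) i 0 == 0]%SET.
pose M' : 'M[R]_(#|I|, n) := rowsub (@enum_val _ (mem I)) M.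
have M'E : homog M' = subrows (homog M) I.
  by apply/matrixP=> i j; rewrite !mxE; case: splitP => j' _; rewrite !mxE.
have MU i : 0 <= (homog M *m U) i 0.
  have := ub (generator_mem AM i); rewrite -subr_ge0 -homog_functional /pairing homog_row -row_mul.
  by rewrite mxE.
have EM x : E x <-> cone (homog M') (homog x).
  rewrite M'E cone_subrows EE; split.
    move=> [/AM[c c0 xE] xb]; exists c; split=> //.
    have : pairing (c *m homog M) U = 0 by rewrite -xE homog_functional xb subrr.
    rewrite pairing_cone => /eqP; rewrite psumr_eq0 => [|i _]; last by rewrite mulr_ge0.
    move=> /allP H i; rewrite inE => iI; apply/eqP.
    by have := H i; rewrite mem_index_enum mulf_eq0 (negbTE iI) orbF; apply.
  move=> [c [c0 cI xE]]; split; first by apply/AM; exists c.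
  apply/eqP; rewrite /= eq_sym -subr_eq0 -homog_functional xE pairing_cone.
  apply/eqP; apply: big1 => i _; have [|/cI ->] := boolP (i \in I); last by rewrite mul0r.
  by rewrite inE => /eqP ->; rewrite mulr0.
have [B2 BP2 _] := polytope_coords_exist fp' hp' EM.
exact: (relint_nonempty fp' hp' BP2).
Qed.

Variable nv : 'rV[R]_n.
Hypothesis k_gt0 : (0 < k)%N.
Hypothesis nv1 : dot nv nv = 1.
Hypothesis nvA : forall x, affhull A x -> affhull A (x + nv).
Hypothesis nvE : forall x y, affhull E x -> affhull E y -> dot nv (y - x) = 0.
Hypothesis nv_in : forall x, relint E x -> \forall t \near (0 : R)^'+, relint A (x + t *: nv).

Let hn : 'rV[R]_(1 + n) := row_mx 0 nv.
Let frame : 'M[R]_(1 + k, 1 + n) := col_mx hn (homog p).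

Lemma homog_shift x (t : R) : homog (x + t *: nv) = homog x + t *: hn.
Proof. by rewrite /homog /hn scale_row_mx add_row_mx scaler0 addr0. Qed.

(** The normal is orthogonal to every direction of the facet, and not to itself. *)
Lemma normal_not_sub : ~~ (hn <= homog p)%MS.
Proof.
apply/negP => /submxP[c Ec]; move: (Ec); rewrite homog_comb => /eq_row_mx[c0 nE].
have [x Ex] := facet_relint k_gt0; have xp : affhull E x by apply: sub_affhull; case: Ex.
have : affhull E (x + 1 *: nv).
  rewrite hp /span_pts /= homog_shift scale1r addmx_sub //; last by rewrite Ec submxMl.
  by move: xp; rewrite hp.
move=> /(nvE xp); rewrite addrC addKr scale1r nv1 => /eqP.
by rewrite oner_eq0.
Qed.

Lemma frame_free : row_free frame.
Proof.
apply/row_free0P => x; rewrite -[x]hsubmxK mul_row_col.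
set c := lsubmx x; set d := rsubmx x.
have -> : c = (c 0 0)%:M by rewrite [LHS]mx11_scalar.
rewrite mul_scalar_mx => E0.
have c0 : c 0 0 = 0.
  apply/eqP; apply: contraNT normal_not_sub => c0.
  have -> : hn = - (c 0 0)^-1 *: (d *m homog p).
    apply/eqP; rewrite -(inj_eq (scalerI c0)) scalerA mulrN mulfV // scaleN1r.
    by rewrite -addr_eq0 E0.
  by rewrite scalemx_sub // submxMl.
move: E0; rewrite c0 scale0r add0r => /(proj2 (row_free0P _) fp) ->.
by rewrite -[0%:M]scalemx1 scale0r row_mx0.
Qed.

Lemma frame_span : (homog q <= frame)%MS.
Proof.
have fq' : (frame <= homog q)%MS.
  rewrite col_mx_sub; apply/andP; split.
    have [x [Ex _]] := facet_relint k_gt0.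
    have xA : affhull A x by apply: sub_affhull; exact: E_sub_A.
    have := nvA xA; move: xA; rewrite hq /span_pts /= => xq.
    have := homog_shift x 1; rewrite !scale1r => -> H.
    by rewrite -[hn](addKr (homog x)) addmx_sub // eqmx_opp.
  apply/row_subP => i; rewrite -homog_row.
  have : affhull E (row i p) by rewrite hp; exact: span_pts_row.
  move=> /(affhull_mono E_sub_A); by rewrite hq.
by rewrite -(geq_leqif (mxrank_leqif_sup fq')) (eqP fq) (eqP frame_free).
Qed.

(** Expresses the frame of the face in the frame made of the normal and the points
    of the facet. *)
Definition frame_change : 'M[R]_(1 + k) := homog q *m pinvmx frame.

Lemma frame_changeE : homog q = frame_change *m frame.
Proof. by rewrite /frame_change mulmxKpV // frame_span. Qed.

Lemma frame_change_unit : frame_change \in unitmx.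
Proof.
rewrite -row_free_unit; apply/row_free0P => x xX.
by apply: (proj2 (row_free0P _) fq); rewrite frame_changeE mulmxA xX mul0mx.
Qed.

Let h : 'cV[R]_k.+1 := col 0 frame_change.

(** The first column of the change of frame reads off the component along the
    normal, the signed height above the facet. *)
Lemma frame_height a : exists d, a *m homog q = pairing a h *: hn + d *m homog p.
Proof.
exists (rsubmx (a *m frame_change)).
rewrite frame_changeE mulmxA -[a *m _ in LHS]hsubmxK mul_row_col; congr (_ + _).
rewrite [lsubmx _]mx11_scalar mul_scalar_mx; congr (_ *: _).
rewrite mxE /pairing /h [LHS]mxE [RHS]mxE; apply: eq_bigr => i _.
by rewrite [col _ _ _ _]mxE; congr (_ * frame_change _ _); apply: val_inj.
Qed.

Lemma height_eq0P a : pairing a h = 0 <-> (a *m homog q <= homog p)%MS.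
Proof.
have [d ->] := frame_height a; split=> [->|H].
  by rewrite scale0r add0r submxMl.
apply/eqP; apply: contraNT normal_not_sub => h0.
have : (pairing a h *: hn <= homog p)%MS.
  by rewrite -[_ *: _](addrK (d *m homog p)) addmx_sub // eqmx_opp submxMl.
by move=> H'; rewrite -(scalerK h0 hn) scalemx_sub.
Qed.

(** The height is a multiple of the inequality that cuts out the facet.  The
    factor is nonnegative because the normal points into the polytope, and nonzero
    because the facet is smaller than the polytope. *)
Lemma height_supporting : supporting B h.
Proof.
have [uB fB AB] := BP.
have hnU : 0 <= pairing hn U.
  have [x Ex] := facet_relint k_gt0.
  have xb : dot u x = b by case: Ex => []; rewrite EE => -[].
  have : \forall t \near (0 : R)^'+, 0 < t /\ relint A (x + t *: nv).
    near=> t; split; first by near: t; exact: nbhs_right_gt.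
    by near: t; exact: nv_in.
  move=> /filter_ex[t [t0 [/ub]]].
  rewrite -subr_ge0 -homog_functional homog_shift pairingD homog_functional xb subrr.
  by rewrite add0r pairingZ pmulr_rge0.
have key a : pairing (a *m homog q) U = pairing a h * pairing hn U.
  have [d ->] := frame_height a; rewrite pairingD pairingZ.
  rewrite [X in _ + X](_ : _ = 0) ?addr0 //.
  by apply/pairing_eq0; rewrite -mulmxA facet_plane_functional mulmx0.
have hnU0 : pairing hn U != 0.
  apply/eqP => Uz.
  have AE : A `<=` E.
    move=> x Ax; rewrite EE; split=> //; have [a _ xE] := proj1 (AB x) Ax.
    by apply/eqP; rewrite /= eq_sym -subr_eq0 -homog_functional xE key Uz mulr0.
  have qp : (homog q <= homog p)%MS.
    apply/row_subP => i; rewrite -homog_row.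
    have : affhull A (row i q) by rewrite hq; exact: span_pts_row.
    by move=> /(affhull_mono AE); rewrite hp.
  by have := mxrankS qp; rewrite (eqP fq) (eqP fp) ltnn.
split.
  apply: contraTneq isT => hz; have := frame_change_unit.
  rewrite unitmxE (expand_det_col _ 0) big1 ?unitr0 // => i _.
  by move/matrixP: hz => /(_ i 0); rewrite mxE => ->; rewrite mxE mul0r.
move=> i.
have := ub (generator_mem AM i); rewrite -subr_ge0 -homog_functional homog_row EB row_mul key.
rewrite pmulr_lge0; last by rewrite lt_neqAle eq_sym hnU0.
by rewrite /pairing -row_mul mxE.
Unshelve. all: by end_near.
Qed.

Definition cone_over (y : 'rV[R]_(1 + n)) := exists x l, [/\ 0 <= l, E x & y = l *: homog x].

(** The vectors of the cone at height 0 are those over points of the polytope in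
    the plane of the facet. *)
Lemma cone_over_height a : cone B a -> cone_over (a *m homog q) <-> pairing a h = 0.
Proof.
move=> Ca; rewrite height_eq0P; split=> [[x [l [l0 /facet_memP[_ xp] ->]]]|ap].
  exact: scalemx_sub.
have [->|a0] := eqVneq a 0.
  by have [x [Ex _]] := facet_relint k_gt0; exists x, 0; rewrite scale0r mul0mx.
have [x [l [l0 Ax xE]]] := cone_section BP Ca a0.
exists x, l; split=> //; first exact: ltW.
apply/facet_memP; split=> //.
by rewrite -(scalerK (lt0r_neq0 l0) (homog x)) scalemx_sub // -xE.
Qed.

Lemma cone_over_sub y : cone_over y -> exists2 a, cone B a & y = a *m homog q.
Proof.
have [_ _ AB] := BP.
move=> [x [l [l0 /E_sub_A/AB[a Ca xE] ->]]]; exists (l *: a); first exact: coneZ.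
by rewrite xE scalemxAl.
Qed.

End FacetFrame.

(** The functional is turned into an inequality on the affine plane of the
    polytope.  The generators where it vanishes span a hyperplane, and
    a maximal independent family of them is a frame of the plane of E. *)
Lemma facet_of_functional (R : realType) n d s (A : set 'rV[R]_n)
    (q : 'M[R]_(d.+2, n)) (M : 'M[R]_(s, n)) (B : 'M[R]_(s, d.+2)) h :
  aff_indep q -> affhull A = span_pts q ->
  (forall x, A x <-> cone (homog M) (homog x)) ->
  polytope_coords A q B -> homog M = B *m homog q -> facet_functional B h ->
  let E := A `&` [set x | homog x *m pinvmx (homog q) *m h = 0] in
  is_facet d.+1 A E /\
  exists I : {set 'I_s}, [/\ \rank (subrows B I) = d.+1, subrows B I *m h = 0 &
    forall i, i \in I -> E (row i M)].
Proof.
move=> fq hq AM [uB fB AB] EB [sh [I rI Ih]] E.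
pose V : 'cV[R]_(1 + n) := pinvmx (homog q) *m h.
have AV (x : 'rV[R]_n) (a : 'rV[R]_d.+2) : homog x = a *m homog q -> homog x *m V = a *m h.
  by move=> ->; rewrite mulmxA -[a *m _ *m _]mulmxA mulmxVp // mulmx1.
have EP x a : homog x = a *m homog q -> (E x <-> A x /\ a *m h = 0).
  by move=> xE; rewrite /E /setI /= -mulmxA (AV x a xE).
have AMi := generator_mem AM.
have MI i : i \in I -> E (row i M).
  move=> iI; apply/(EP _ (row i B)); first by rewrite homog_row EB row_mul.
  split; first exact: AMi.
  rewrite -row_mul; apply/matrixP=> j j'; rewrite !ord1 [RHS]mxE.
  move/matrixP: Ih => /(_ (enum_rank_in iI i) 0); rewrite [RHS]mxE => <-.
  by rewrite /subrows mul_rowsub_mx !mxE enum_rankK_in.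
split; last by exists I.
pose b := usubmx V 0 0; pose u := - (dsubmx V)^T.
have VE : V = col_mx b%:M (- u^T).
  by rewrite -[LHS]vsubmxK [usubmx V]mx11_scalar /u linearN /= trmxK opprK.
have ubE x a : homog x = a *m homog q -> b - dot u x = pairing a h.
  by move=> xE; rewrite -homog_functional -VE /pairing (AV x a xE).
split.
  exists u, b; split.
    move=> x /AB[a Ca xE]; rewrite -subr_ge0 (ubE x a xE).
    exact: cone_supporting sh Ca.
  apply/seteqP; split=> x.
    move=> Ex; have Ax : A x by case: Ex.
    have [a Ca xE] := proj1 (AB x) Ax; split=> //.
    apply/eqP; rewrite /= eq_sym -subr_eq0 (ubE x a xE); apply/eqP/pairing_eq0.
    by case/(EP x a xE): Ex.
  move=> [Ax xb]; have [a Ca xE] := proj1 (AB x) Ax; apply/(EP x a xE); split=> //.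
  by apply/pairing_eq0; rewrite -(ubE x a xE) xb subrr.
pose W := subrows (homog M) I.
have WE : W = subrows B I *m homog q by rewrite /W EB /subrows mul_rowsub_mx.
have rW : \rank W = d.+1 by rewrite WE mxrankMfree.
have [g fg] : exists g : 'I_d.+1 -> 'I_#|I|, row_free (rowsub g W).
  move: (maxrankfun W) (maxrowsub_free W); rewrite rW => g fg; by exists g.
pose p := rowsub (@enum_val _ (mem I) \o g) M.
have pE : homog p = rowsub g W.
  by apply/matrixP=> i j; rewrite !mxE; case: splitP => j' _; rewrite !mxE.
exists p; first by rewrite /aff_indep pE.
apply/seteqP; split.
  apply: affhull_sub; first exact: span_pts_affine.
  move=> x Ex; have [a Ca xE] := proj1 (AB x) (proj1 Ex).
  have [_ ah] := proj1 (EP x a xE) Ex.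
  rewrite /span_pts /= xE.
  have aI := hyperplane_kernel rI sh.1 Ih ah.
  apply: (submx_trans (submxMr _ aI)); rewrite -WE pE.
  have gW : (rowsub g W <= W)%MS by apply/row_subP => i; rewrite row_rowsub row_sub.
  by rewrite -(geq_leqif (mxrank_leqif_sup gW)) rW (eqP fg).
apply: affine_span; first exact: affhull_affine.
move=> i; apply: sub_affhull.
have -> : row i p = row (enum_val (g i)) M by apply/rowP=> j; rewrite !mxE.
apply: MI; exact: enum_valP.
Qed.

(** * The cycle carried by an equilibrium load *)

Section ComplexCycle.
Variables (R : realType) (d k : nat).
Notation n := (d.+1 + k.+1)%N.
Variables (C : pcomplex R d.+1 n) (o : face C -> gr R d.+1 n).
Hypothesis ho : orientation o.

Definition face_frame (f : face C) : 'M[R]_(d.+2, 1 + n) := homog (points (o f)).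

Lemma points_indep m' n' (l : gr R m' n') : aff_indep (points l).
Proof. exact: valP (repr l). Qed.

Lemma affhull_body (f : face C) : affhull (body f) = span_pts (points (o f)).
Proof. by rewrite -ho. Qed.

Record body_cone (f : face C) s (M : 'M[R]_(s, n)) (B : 'M[R]_(s, d.+2)) : Prop := {
  body_homog : forall x, body f x <-> cone (homog M) (homog x);
  body_coords : polytope_coords (body f) (points (o f)) B;
  body_gens : homog M = B *m face_frame f }.

Lemma body_cones : exists (s : face C -> nat) (M : forall f, 'M[R]_(s f, n))
  (B : forall f, 'M[R]_(s f, d.+2)), forall f, body_cone f (M f) (B f).
Proof.
have /choice[g gP] : forall f, exists g : {s : nat & ('M[R]_(s, n) * 'M[R]_(s, d.+2))%type},
    body_cone f (tagged g).1 (tagged g).2.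
  move=> f; have [S [fS _ bS]] := bodyP f.
  have [s [M AM]] := convhull_cone fS.
  have {}AM x : body f x <-> cone (homog M) (homog x) by rewrite bS.
  have [B BP EB] := polytope_coords_exist (points_indep (o f)) (affhull_body f) AM.
  by exists (Tagged (fun s => ('M[R]_(s, n) * 'M[R]_(s, d.+2))%type) (M, B)).
by exists (fun f => tag (g f)), (fun f => (tagged (g f)).1), (fun f => (tagged (g f)).2).
Qed.

Lemma facet_points : exists p : facet C -> 'M[R]_(d.+1, n),
  forall e, aff_indep (p e) /\ affhull (sval e) = span_pts (p e).
Proof.
have /choice[p pP] : forall e : facet C, exists p : 'M[R]_(d.+1, n),
    aff_indep p /\ affhull (sval e) = span_pts p.
  by move=> e; have [p fp hp] := facet_planeP e; exists p.
by exists p.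
Qed.

Variables (nu : facet C -> face C -> 'rV[R]_n) (hnu : inner_normals nu).
Variables (s : face C -> nat) (M : forall f, 'M[R]_(s f, n)).
Variables (B : forall f, 'M[R]_(s f, d.+2)).
Hypothesis MB : forall f, body_cone f (M f) (B f).
Variable p : facet C -> 'M[R]_(d.+1, n).
Hypothesis pP : forall e, aff_indep (p e) /\ affhull (sval e) = span_pts (p e).

Definition incidence_frame (e : facet C) (f : face C) : 'M[R]_(1 + d.+1) :=
  frame_change (points (o f)) (p e) (nu e f).

Definition incidence_normal (e : facet C) (f : face C) : 'rV[R]_(1 + n) :=
  row_mx 0 (nu e f).

Definition height (e : facet C) (f : face C) : 'cV[R]_d.+2 := col 0 (incidence_frame e f).

Record incidence_facts (e : facet C) (f : face C) : Prop := {
  inc_frame : face_frame f = incidence_frame e f *m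
    col_mx (incidence_normal e f) (homog (p e));
  inc_unit : incidence_frame e f \in unitmx;
  inc_supp : supporting (B f) (height e f);
  inc_cone : forall a, cone (B f) a ->
    cone_over (sval e) (a *m face_frame f) <->
    pairing a (height e f) = 0;
  inc_cone_sub : forall y, cone_over (sval e) y ->
    exists2 a, cone (B f) a & y = a *m face_frame f;
  inc_zero : forall a, pairing a (height e f) = 0 <->
    (a *m face_frame f <= homog (p e))%MS;
  inc_mem : forall x, sval e x <-> body f x /\ (homog x <= homog (p e))%MS }.

Lemma incidenceP e f : incident e f -> incidence_facts e f.
Proof.
move=> ef; have [n1 nA nE nin] := hnu ef; have [fp hp] := pP e.
have [AM BP EB] := MB f; have fq := points_indep (o f); have hq := affhull_body f.
move: (ef) => /asboolP[[u [b [ub EE]]] _].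
split.
- exact: (frame_changeE fq hq fp hp AM BP EB ub EE isT n1 nA nE).
- exact: (frame_change_unit fq hq fp hp AM BP EB ub EE isT n1 nA nE).
- exact: (height_supporting fq hq fp hp AM BP EB ub EE isT n1 nA nE nin).
- move=> a Ca; exact: (cone_over_height fq hq fp hp AM BP EB ub EE isT n1 nA nE Ca).
- move=> y; exact: (cone_over_sub BP EE).
- exact: (height_eq0P fq hq fp hp AM BP EB ub EE isT n1 nA nE).
- exact: (facet_memP hp EE).
Qed.

Lemma facet_ext (e e' : facet C) : (forall x, sval e x <-> sval e' x) -> e = e'.
Proof.
case: e e' => [E pE] [E' pE'] /= H; apply: eq_exist; apply/seteqP; split=> x; first by move/H.
by move/H.
Qed.

(** The facet is the set of points where h vanishes; its height vanishes on the
    same hyperplane, and both are nonnegative on the cone. *)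
Lemma height_complete f h : facet_functional (B f) h ->
  exists2 e, incident e f & exists2 l, 0 < l & height e f = l *: h.
Proof.
move=> fh; have [AM BP EB] := MB f; have fq := points_indep (o f); have hq := affhull_body f.
have [fE [I [rI Ih EI]]] := facet_of_functional fq hq AM BP EB fh.
pose e : facet C := exist _ _ (ex_intro _ f fE).
have ef : incident e f by apply/asboolP.
have F := incidenceP ef; exists e => //.
have Ih' : subrows (B f) I *m height e f = 0.
  apply/row_matrixP => i; rewrite row_mul row0; apply/pairing_eq0/(inc_zero F).
  have -> : row i (subrows (B f) I) = row (enum_val i) (B f) by apply/rowP=> j; rewrite !mxE.
  rewrite -row_mul -EB -homog_row.
  by case/(inc_mem F): (EI _ (enum_valP i)).
have [l E] := kernel_proportional rI fh.1.1 Ih Ih'.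
exists l => //; apply: (supporting_scale _ fh.1); last by rewrite -E; exact: inc_supp F.
by case: BP.
Qed.

(** A facet is recovered from its height as the set of points of the polytope at
    height 0. *)
Lemma height_inj f e e' l : incident e f -> incident e' f -> 0 < l ->
  height e' f = l *: height e f -> e' = e.
Proof.
move=> ef e'f l0 E; have F := incidenceP ef; have F' := incidenceP e'f.
have [AM [_ _ AB] EB] := MB f.
apply: facet_ext => x; rewrite (inc_mem F) (inc_mem F').
split=> -[Ax xp]; split=> //; have [a Ca xE] := proj1 (AB x) Ax.
  move: xp; rewrite xE => /(inc_zero F'); rewrite E /pairing -scalemxAr mxE => /eqP.
  by rewrite mulf_eq0 gt_eqF //= => /eqP /(inc_zero F).
move: xp; rewrite xE => /(inc_zero F) ah; apply/(inc_zero F').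
by rewrite E /pairing -scalemxAr mxE [X in _ * X]ah mulr0.
Qed.

Variable om : face C -> R.
Hypothesis equil : forall e : facet C, \sum_(f | incident e f) om f *: nu e f = 0.

(** By [vol_frame], the distance from l to the face f is, up to the sign of the
    orientation, a fixed positive factor times the determinant of the normal, the
    points of the facet and the points of l.  This is linear in the normal, and
    omega annihilates the sum of the normals. *)
Lemma incidence_balance (l : gr R k n) (e : facet C) :
  \sum_(f | incident e f)
    Num.sg (\det (incidence_frame e f)) * (om f * dist l (o f)) = 0.
Proof.
pose P : 'M[R]_(k.+1, 1 + n) := homog (points l).
pose W (v : 'rV[R]_(1 + n)) : 'M[R]_(1 + d.+1 + k.+1) := col_mx (col_mx v (homog (p e))) P.
(* the functional v |-> \det (W v), by expansion along the first row *)
pose g : 'cV[R]_(1 + n) := \col_j cofactor (W 0) 0 j.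
have Wg v : \det (W v) = pairing v g.
  rewrite (expand_det_row _ 0) /pairing mxE; apply: eq_bigr => j _.
  have i0 : 0 = lshift k.+1 (lshift d.+1 0) :> 'I_(1 + d.+1 + k.+1) by apply: val_inj.
  rewrite [g j 0]mxE; congr (_ * _).
    transitivity (W v (lshift k.+1 (lshift d.+1 0)) j); last by rewrite /W !col_mxEu.
    by congr (W v _ _).
  rewrite /cofactor; congr (_ * \det _); apply/matrixP=> a b; rewrite !mxE.
  case: splitP => a' Ea'; rewrite !mxE //; case: splitP => a2 Ea2 //.
  by exfalso; move: Ea'; rewrite Ea2 (ord1 a2).
pose c := (vol (directions (p e)) * vol (directions (points l)))^-1.
have E f : incident e f -> Num.sg (\det (incidence_frame e f)) * (om f * dist l (o f)) =
    pairing (om f *: incidence_normal e f) g * c.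
  move=> ef; have F := incidenceP ef; have [n1 nA nE nin] := hnu ef.
  have [fp hp] := pP e.
  have vE : vol (directions (points (o f))) =
      `|\det (incidence_frame e f)| * vol (directions (p e)).
    apply: (vol_frame (u := nu e f)) => //; first exact: (inc_frame F).
    apply/row_matrixP => i; rewrite row_mul row0 rowK; apply/matrixP=> a b.
    rewrite !ord1 [RHS]mxE.
    have aff j : affhull (sval e) (row j (p e)) by rewrite hp; exact: span_pts_row.
    have := nE _ _ (aff ord0) (aff (lift ord0 i)); rewrite /dot => <-.
    by rewrite -[nu e f in RHS]trmxK -trmx_mul [RHS]mxE.
  rewrite dist_incline vE pairingZ -Wg.
  have -> : incline (homog (points (o f))) (homog (points l)) =
      \det (incidence_frame e f) * \det (W (incidence_normal e f)).
    rewrite /incline; have -> : homog (points (o f)) = _ := inc_frame F.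
    have -> : col_mx (incidence_frame e f *m col_mx (incidence_normal e f) (homog (p e))) (homog (points l)) =
        block_mx (incidence_frame e f) 0 0 1%:M *m W (incidence_normal e f).
      by rewrite mul_block_col !mul0mx mul1mx add0r addr0.
    by rewrite det_mulmx det_ublock det1 mulr1.
  have x0 : \det (incidence_frame e f) != 0.
    by rewrite -unitfE -unitmxE; exact: inc_unit F.
  have vp0 := vol_gt0 fp; have vl0 := vol_gt0 (points_indep l).
  rewrite /c; set x := \det (incidence_frame e f) in x0 *.
  set y := \det _; set z := vol _ in vp0 *; set t := vol _ in vl0 *.
  have nx0 : `|x| != 0 by rewrite normr_eq0.
  have -> : Num.sg x * (om f * (x * y / (`|x| * z * t))) =
      Num.sg x * x / `|x| * (om f * y * (z * t)^-1).
    by field; rewrite nx0 !gt_eqF.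
  by rewrite -normrEsg mulfV // mul1r.
rewrite (eq_bigr _ E) -mulr_suml.
have -> : \sum_(f | incident e f) pairing (om f *: incidence_normal e f) g =
    pairing (row_mx 0 (\sum_(f | incident e f) om f *: nu e f)) g.
  elim/big_rec2: _ => [|f y1 y2 _ ->]; first by rewrite row_mx0 /pairing mul0mx mxE.
  by rewrite -pairingD /incidence_normal scale_row_mx add_row_mx scaler0 addr0.
by rewrite equil row_mx0 /pairing mul0mx mxE mul0r.
Qed.

Lemma complex_degree_constant (l : gr R k n) P v v' :
  let w f := om f * dist l (o f) in
  row_free P -> avoids B face_frame w P ->
  regular B face_frame w P v -> regular B face_frame w P v' ->
  degree B face_frame w P v = degree B face_frame w P v'.
Proof.
move=> w; apply: (@degree_constant _ d.+1 k.+1 _ s B face_frame w _ _ _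
  {classic facet C} (fun e => incident e) (fun e => cone_over (sval e))
  (fun e => homog (p e)) incidence_normal incidence_frame).
- by move=> f; case: (MB f) => _ [].
- by move=> f; case: (MB f) => _ [].
- by move=> f; exact: points_indep.
- by move=> e f /incidenceP[].
- by move=> e f /incidenceP[].
- by move=> e f a /incidenceP F; exact: (inc_cone F).
- by move=> e f y /incidenceP F; exact: (inc_cone_sub F).
- exact: height_complete.
- exact: height_inj.
- exact: incidence_balance.
Qed.

End ComplexCycle.

(** * Moving planes *)

Section Lift.
Variables (R : realType) (k n : nat).

(** Cramer's rule: the entries of \adj X M are the determinants of X with one
    column replaced by a column of M. *)
Lemma cramer_column (X : 'M[R]_k) (M : 'M[R]_(k, n)) i j (X' : 'M[R]_k) :
  (forall a b, X' a b = if b == i then M a j else X a b) ->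
  (\adj X *m M) i j = \det X'.
Proof.
move=> X'E; rewrite mxE (expand_det_col X' i); apply: eq_bigr => a _.
rewrite X'E eqxx mulrC; congr (_ * _); rewrite mxE /cofactor; congr (_ * \det _).
by apply/matrixP=> b c; rewrite !mxE X'E eq_sym (negbTE (neq_lift _ _)).
Qed.

Lemma unit_minor (M : 'M[R]_(k, n)) : row_free M ->
  exists c : 'I_k -> 'I_n, colsub c M \in unitmx.
Proof.
move=> fM; have rM : \rank M^T = k by rewrite mxrank_tr; apply/eqP.
have [c fc] : exists c : 'I_k -> 'I_n, row_free (rowsub c M^T).
  by move: (maxrankfun M^T) (maxrowsub_free M^T); rewrite rM => c fc; exists c.
exists c; rewrite -unitmx_tr -row_free_unit.
by rewrite (_ : (colsub c M)^T = rowsub c M^T) //; apply/matrixP=> i j; rewrite !mxE.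
Qed.

End Lift.

Section PathLift.
Variables (R : realType) (k n : nat) (H : R -> gr R k n) (t : R).
Hypothesis cH : forall c, (fun s => pluecker (H s) c) @ t --> pluecker (H t) c.

Let M s : 'M[R]_(k.+1, 1 + n) := homog (points (H s)).

(** Normalizing a nonvanishing minor to a constant gives spanning points that
    depend on the plane through ratios of Plücker coordinates only. *)
Lemma path_lift : exists A : R -> 'M[R]_k.+1,
  (fun s => A s *m M s) @ t --> M t /\ \forall s \near t, 0 < \det (A s).
Proof.
have [c uc] := unit_minor (points_indep (H t)).
pose X s := colsub c (M s).
pose A s := X t *m ((\det (X s))^-1 *: \adj (X s)).
have vp s : 0 < vol (directions (points (H s))) by exact/vol_gt0/points_indep.
have plE c' s : \det (colsub c' (M s)) =
    pluecker (H s) c' * vol (directions (points (H s))).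
  by rewrite /pluecker divfK // gt_eqF.
have Xt : \det (X t) != 0 by rewrite -unitfE -unitmxE.
have pt : pluecker (H t) c != 0.
  by apply: contra_neq Xt => p0; rewrite plE p0 mul0r.
exists A; split.
  have E s : A s *m M s = X t *m
      \matrix_(i, j) ((pluecker (H s) c)^-1 *
        pluecker (H s) (fun a => if a == i then j else c a)).
    rewrite /A -mulmxA; congr (_ *m _); apply/matrixP=> i j.
    rewrite -scalemxAl mxE [RHS]mxE.
    rewrite (@cramer_column _ _ _ (X s) (M s) i j
      (colsub (fun a => if a == i then j else c a) (M s))); last first.
      by move=> a b; rewrite [LHS]mxE; case: (b == i); rewrite // [RHS]mxE.
    rewrite !plE invfM mulrACA [X in X * _]mulrC -mulrA mulVf ?mulr1 1?mulrC //.
    by rewrite gt_eqF.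
  under eq_fun do rewrite E.
  have -> : M t = A t *m M t.
    by rewrite /A -scalemxAr mul_mx_adj scale_scalar_mx mulVf // mul1mx.
  rewrite E; apply: cvg_mulmx; first exact: cvg_cst.
  apply: cvg_mx => i j; rewrite mxE; under eq_fun do rewrite mxE.
  by apply: cvgM; [by apply: cvgV => //; exact: cH|exact: cH].
have H1 : \forall s \near t, Num.sg (pluecker (H s) c) = Num.sg (pluecker (H t) c).
  exact: (sg_near (@cH c) pt).
apply: filterS H1 => s sg.
have ps : pluecker (H s) c != 0 by rewrite -sgr_eq0 sg sgr_eq0.
have Xs : \det (X s) != 0 by rewrite plE mulf_neq0 // gt_eqF.
have -> : A s = X t *m invmx (X s) by rewrite /A /invmx unitmxE unitfE Xs.
have pp : 0 < pluecker (H t) c * pluecker (H s) c.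
  by rewrite -sgr_gt0 sgrM sg -expr2 sqr_sg pt ltr01.
have -> : \det (X t *m invmx (X s)) =
    \det (X t) * \det (X s) * (\det (X s))^-1 ^+ 2.
  by rewrite det_mulmx det_inv expr2 mulrA mulfK.
rewrite mulr_gt0 ?exprn_even_gt0 ?invr_eq0 ?Xs ?orbT //.
by rewrite !plE mulrACA mulr_gt0 // mulr_gt0 ?vp.
Qed.

End PathLift.

Section Change.
Variables (R : realType) (s d r : nat) (B : 'M[R]_(s, d.+1)) (Q : 'M[R]_(d.+1, d.+1 + r)).
Variables (P : 'M[R]_(r, d.+1 + r)) (A : 'M[R]_r).
Hypothesis A_gt0 : 0 < \det A.

Lemma change_eqmx : (A *m P :=: P)%MS.
Proof.
by apply: eqmxMfull; rewrite row_full_unit unitmxE unitfE gt_eqF.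
Qed.

Lemma incline_change : incline Q (A *m P) = \det A * incline Q P.
Proof.
rewrite /incline; have -> : col_mx Q (A *m P) = block_mx 1%:M 0 0 A *m col_mx Q P.
  by rewrite mul_block_col !mul0mx mul1mx add0r addr0.
by rewrite det_mulmx det_ublock det1 mul1r.
Qed.

(** The notions attached to a frame P of the moving plane depend on the plane and
    its orientation only. *)
Lemma covers_change v : covers B Q (A *m P) v <-> covers B Q P v.
Proof. by split=> -[a Ca H]; exists a => //; move: H; rewrite change_eqmx. Qed.

Lemma regular_value_change v :
  regular_value B Q (A *m P) v <-> regular_value B Q P v.
Proof.
rewrite /regular_value covers_change incline_change mulf_eq0 gt_eqF //=.
split=> -[nc|[D [a Ca H]]]; [by left| |by left|].
  by right; split=> //; exists a => //; move: H; rewrite change_eqmx.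
by right; split=> //; exists a => //; move: H; rewrite change_eqmx.
Qed.

Lemma local_degree_change v : local_degree B Q (A *m P) v = local_degree B Q P v.
Proof.
rewrite /local_degree incline_change sgrM gtr0_sg // mul1r.
by congr (if _ then _ else _); apply/asboolP/asboolP => /covers_change.
Qed.

End Change.

Section Crossing.
Variables (R : realType) (d k : nat).
Notation n := (d.+1 + k.+1)%N.
Variables (H : R -> gr R k n) (t : R) (f : gr R d.+1 n) (x : 'rV[R]_n).
Hypothesis xf : plane f x.
Hypothesis tr : transversal_at H t x (plane f).

Let Q : 'M[R]_(d.+2, 1 + n) := homog (points f).

Lemma homogD (y z : 'rV[R]_n) : homog (y + z) = homog y + row_mx 0 z.
Proof. by rewrite /homog add_row_mx addr0. Qed.

Lemma points_pi (p : aframe R k n) : exists2 A : 'M[R]_k.+1, 0 < \det A &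
  homog (points (\pi_(gr R k n) p)%qT) = A *m homog (val p).
Proof.
have : (\pi_(gr R k n) p = \pi_(gr R k n) (repr (\pi_(gr R k n) p)))%qT by rewrite reprK.
by move=> /(eqquotP (gr R k n))/asboolP[A dA E]; exists A.
Qed.

(** Let W s be the frame of the face stacked on differentiable points p s of the
    moving plane.  By transversality the rows of W t and the velocity y = c p'(t) of
    the common point x = c p(t) span the homogeneous space, so W t has corank 1 and
    y is not in its row space.  Writing x = a Q, the row (-a, c) times W s is
    c p(s) - x, hence c_i \det (W s) is an entry of (c p(s) - x) \adj (W s).
    Dividing by s - t, the derivative of the determinant at t is an entry of
    y \adj (W t) divided by c_i, and it is nonzero by [adj_generic].  The volumes
    in the denominator of the distance are continuous and positive. *)
Lemma transversal_crossing :
  \rank (col_mx Q (homog (points (H t)))) = n /\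
  exists2 dl, dl != 0 &
    derive1 (fun s => dist (H s) f) t = dl /\
    \forall h \near (0 : R)^', Num.sg (dist (H (h + t)) f) = Num.sg h * Num.sg dl.
Proof.
case: tr => p [c [pH dp xc span_v]].
have pt : (\pi_(gr R k n) (p t))%qT = H t by exact: nbhs_singleton pH.
pose Ps s : 'M[R]_(k.+1, 1 + n) := homog (val (p s)).
pose W s : 'M[R]_(d.+2 + k.+1) := col_mx Q (Ps s).
pose D := 'D_1 (fun s => val (p s)) t.
have [A0 A0p A0E] := points_pi (p t); rewrite pt in A0E.
have xQ : (homog x <= Q)%MS by exact: xf.
have [a xa] := submxP xQ.
pose y : 'rV[R]_(1 + n) := row_mx 0 (c *m D).
have xW : (homog x <= W t)%MS.
  by rewrite -addsmxE; apply: submx_trans xQ (addsmxSl _ _).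
have PW : (homog (points (H t)) <= W t)%MS.
  by rewrite A0E -addsmxE; apply: submx_trans (submxMl _ _) (addsmxSr _ _).
have full : (1%:M <= col_mx y (W t))%MS.
  rewrite -addsmxE; apply/row_subP => i; set z := row i _.
  have -> : z = lsubmx z *m homog x + row_mx 0 (rsubmx z - lsubmx z *m x).
    rewrite -{1}[z]hsubmxK /homog mul_mx_row add_row_mx addr0 addrC subrK.
    congr row_mx; apply/matrixP=> i' j; rewrite !ord1 [RHS]mxE big_ord1 [X in _ * X]mxE.
    by rewrite mulr1.
  have [b [d1 [d2 [h1 h2 ->]]]] := span_v (rsubmx z - lsubmx z *m x).
  have -> : row_mx 0 (b *: (c *m D) + d1 + d2) =
      b *: y + (homog (x + d1) - homog x) + (homog (x + d2) - homog x) :> 'rV_(1 + n).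
    have hh e : homog (x + e) - homog x = row_mx 0 e by rewrite homogD addrAC subrr add0r.
    by rewrite !hh /y scale_row_mx !add_row_mx scaler0 !addr0.
  have sW (u : 'rV[R]_(1 + n)) : (u <= W t)%MS -> (u <= y + W t)%MS.
    by move=> uW; exact: submx_trans uW (addsmxSr _ _).
  have xy := sW _ xW.
  rewrite !addmx_sub ?eqmx_opp //.
  - exact: submx_trans (submxMl _ _) xy.
  - by apply: scalemx_sub; exact: addsmxSl.
  - by apply: sW; apply: submx_trans h1 PW.
  - by apply: sW; rewrite -addsmxE; apply: submx_trans h2 (addsmxSl _ _).
(* the linear relation between the rows of W t given by the common point *)
pose ka : 'rV[R]_(d.+2 + k.+1) := row_mx a (- c).
have kW : ka *m W t = 0 by rewrite mul_row_col mulNmx -xa -xc subrr.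
have c0 : c != 0.
  by apply: contra_neq (homog_neq0 x) => cz; rewrite xc cz mul0mx.
have k0 : ka != 0 by rewrite row_mx_eq0 negb_and oppr_eq0 c0 orbT.
have D0 : \det (W t) = 0.
  apply/eqP; apply: contraT; rewrite -unitfE -unitmxE -row_free_unit => fW.
  by case/eqP: k0; apply: (proj2 (row_free0P _) fW).
have rW : \rank (W t) = n.
  apply/eqP; rewrite eqn_leq; apply/andP; split.
    rewrite -ltnS ltn_neqAle rank_leq_row andbT; apply/negP => fW.
    by move/eqP: D0; apply/negP; rewrite -unitfE -unitmxE -row_free_unit.
  have := mxrankS full; rewrite mxrank1 -addsmxE => rk.
  have : (n.+1 <= 1 + \rank (W t))%N.
    apply: leq_trans (leq_trans rk (mxrank_adds_leqif _ _).1) _.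
    by rewrite leq_add2r rank_leq_row.
  by rewrite add1n.
have yW : ~~ (y <= W t)%MS.
  apply/negP => yW; have : (1%:M <= W t)%MS.
    by apply: submx_trans full _; rewrite col_mx_sub yW submx_refl.
  by move/mxrankS; rewrite mxrank1 rW ltnn.
(* y \adj (W t) is a left kernel vector of W t, as its determinant is 0 *)
have [la Ela] : exists la, y *m \adj (W t) = la *: ka.
  apply: (kernel_line _ k0 kW); first by rewrite rW.
  by rewrite -mulmxA mul_adj_mx D0 mul_mx_scalar scale0r.
have la0 : la != 0.
  by apply: contra_neq (adj_generic rW yW) => lz; rewrite Ela lz scale0r.
have [i ci] : exists i, c 0 i != 0.
  apply/existsP; apply: contraT => /existsPn Hc; case/negP: c0; apply/eqP/rowP=> i.
  by rewrite mxE; apply/eqP; move: (Hc i); rewrite negbK.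
split.
  have : (col_mx Q (homog (points (H t))) :=: W t)%MS.
    apply: eqmx_trans (eqmx_sym (addsmxE _ _)) _.
    apply: eqmx_trans _ (addsmxE _ _); apply: adds_eqmx => //.
    by rewrite A0E; apply: eqmxMfull; rewrite row_full_unit unitmxE unitfE gt_eqF.
  by move=> ->.
have cp : (fun h => val (p (h + t))) @ (0 : R)^' --> val (p t).
  have cpt : (fun s => val (p s)) @ t --> val (p t).
    by apply: differentiable_continuous; apply/derivable1_diffP.
  have ch : (fun h : R => h + t) @ (0 : R) --> t.
    by rewrite -[X in _ --> X]add0r; apply: cvgD; [exact: cvg_id|exact: cvg_cst].
  by move=> U /cpt /ch; exact: nbhs_dnbhs.
have chomog (g : R -> 'M[R]_(k.+1, n)) g0 : g @ (0 : R)^' --> g0 ->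
    (fun h => homog (g h)) @ (0 : R)^' --> homog g0.
  move=> cg; apply: cvg_mx => a' b'; rewrite mxE; under eq_fun do rewrite mxE.
  by case: splitP => b2 _; [exact: cvg_cst|exact: cvg_coord].
have cW : (fun h => W (h + t)) @ (0 : R)^' --> W t.
  by apply: cvg_col_mx; [exact: cvg_cst|exact: chomog].
have cdet : (fun h => h^-1 * \det (W (h + t))) @ (0 : R)^' -->
    (c 0 i)^-1 * (y *m \adj (W t)) 0 (rshift d.+2 i).
  pose z h : 'rV[R]_(1 + n) := row_mx 0 (c *m (h^-1 *: (val (p (h + t)) - val (p t)))).
  have E h : h^-1 * \det (W (h + t)) =
      (c 0 i)^-1 * (z h *m \adj (W (h + t))) 0 (rshift d.+2 i).
    have -> : z h = h^-1 *: (row_mx (- a) c *m W (h + t)).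
      have -> : z h = h^-1 *: (c *m (Ps (h + t) - homog (val (p t)))).
        have -> : Ps (h + t) - homog (val (p t)) = row_mx 0 (val (p (h + t)) - val (p t)).
          by rewrite /Ps /homog opp_row_mx add_row_mx subrr.
        by rewrite mul_mx_row mulmx0 scale_row_mx scaler0 /z -scalemxAr.
      by rewrite mul_row_col mulNmx -xa xc mulmxBr [- _ + _]addrC.
    rewrite -scalemxAl -mulmxA mul_mx_adj mul_mx_scalar !mxE.
    rewrite (unsplitK (inr i)) mulrCA; congr (_ * _).
    by rewrite mulrCA mulVf ?mulr1.
  under eq_fun do rewrite E.
  apply: cvgM; first exact: cvg_cst.
  apply: cvg_coord; apply: cvg_mulmx; last by apply: cvg_adj.
  have cD : (fun h => h^-1 *: (val (p (h + t)) - val (p t))) @ (0 : R)^' --> D.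
    have -> : (fun h => h^-1 *: (val (p (h + t)) - val (p t))) =
       (fun h => h^-1 *: (((fun s => val (p s)) \o shift t) (h *: 1) - val (p t))).
      by apply/funext => h; rewrite /= -[h%:A]/(h * 1) mulr1.
    exact: dp.
  apply: cvg_mx => a' b'; rewrite /z mxE; under eq_fun do rewrite mxE.
  case: splitP => b2 _; last by apply: cvg_coord; apply: cvg_mulmx => //; exact: cvg_cst.
  exact: cvg_cst.
pose v h := vol (directions (points f)) * vol (directions (val (p (h + t)))).
have cv : v @ (0 : R)^' -->
    vol (directions (points f)) * vol (directions (val (p t))).
  apply: cvgM; first exact: cvg_cst.
  have cdir : (fun h => directions (val (p (h + t)))) @ (0 : R)^' --> directions (val (p t)).
    apply: cvg_mx => a' b'; rewrite !mxE; under eq_fun do rewrite !mxE.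
    by apply: cvgB; exact: cvg_coord.
  rewrite /vol; apply: cvg_comp; last exact: sqrt_continuous.
  by apply: cvg_det; apply: cvg_mulmx => //; exact: cvg_tr.
have v0 : vol (directions (points f)) * vol (directions (val (p t))) != 0.
  by rewrite mulf_neq0 // gt_eqF // vol_gt0 ?points_indep // (valP (p t)).
have distE s : (\pi_(gr R k n) (p s))%qT = H s -> dist (H s) f =
    \det (W s) / (vol (directions (points f)) * vol (directions (val (p s)))).
  move=> ps; have [A Ap AE] := points_pi (p s); rewrite ps in AE.
  rewrite dist_incline AE incline_change (vol_change AE) gtr0_norm //.
  have vf := vol_gt0 (points_indep f); have vs := vol_gt0 (valP (p s)).
  by rewrite /incline -/(W s); field; rewrite !gt_eqF.
have distt : dist (H t) f = 0 by rewrite distE // D0 mul0r.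
pose dl := ((c 0 i)^-1 * (y *m \adj (W t)) 0 (rshift d.+2 i)) /
  (vol (directions (points f)) * vol (directions (val (p t)))).
have dl0 : dl != 0.
  rewrite !mulf_neq0 ?invr_eq0 // Ela !mxE (unsplitK (inr i)) mxE mulf_neq0 //.
  by rewrite oppr_eq0.
have pH' : \forall h \near (0 : R)^', (\pi_(gr R k n) (p (h + t)))%qT = H (h + t).
  have ch : (fun h : R => h + t) @ (0 : R) --> t.
    by rewrite -[X in _ --> X]add0r; apply: cvgD; [exact: cvg_id|exact: cvg_cst].
  by move: pH => /ch; exact: nbhs_dnbhs.
have cq : (fun h => h^-1 *: (dist (H (h + t)) f - dist (H t) f)) @ (0 : R)^' --> dl.
  have : (fun h => (h^-1 * \det (W (h + t))) / v h) @ (0 : R)^' --> dl.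
    by apply: cvgM => //; exact: cvgV.
  apply: cvg_trans; apply: near_eq_cvg; apply: filterS pH' => h ph.
  by rewrite distt subr0 distE // -mulrA.
exists dl => //; split.
  by rewrite /derive1; exact: cvg_lim cq.
have sq := sg_near cq dl0.
near=> h.
have h0 : h != 0 by near: h; exact: nbhs_dnbhs_neq.
have <- : Num.sg (h^-1 *: (dist (H (h + t)) f - dist (H t) f)) = Num.sg dl.
  by near: h; exact: sq.
by rewrite -sgrM distt subr0 /GRing.scale /= mulrA mulfV // mul1r.
Unshelve. all: by end_near.
Qed.

End Crossing.

(** * Integration along a path *)

Section Jumps.
Variable R : realType.

(** Clamped to [0, 1], the function is defined on the whole line and locally
    constant there, so its derivative is 0. *)
Lemma locally_constant_segment (G : R -> R) :
  (forall t : R, 0 <= t <= 1 -> \forall s \near t, 0 <= s <= 1 -> G s = G t) ->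
  G 0 = G 1.
Proof.
move=> lG; pose cl (t : R) := Num.max 0 (Num.min 1 t).
have cl01 t : 0 <= cl t <= 1.
  by rewrite /cl le_max lexx /= ge_max ler01 ge_min lexx.
have ccl (t : R) : cl @ t --> cl t.
  have : {for t, continuous ((fun=> 0 : R^o) \max ((fun=> 1 : R^o) \min (id : R -> R^o)))}.
    apply: continuous_max; first exact: cvg_cst.
    by apply: continuous_min; [exact: cvg_cst|exact: cvg_id].
  by [].
have -> : G 0 = G (cl 0) by rewrite /cl min_r ?ler01 // max_l.
have -> : G 1 = G (cl 1) by rewrite /cl min_l // max_r // ler01.
apply: (@is_derive_0_is_cst R (G \o cl)) => t.
have H : \forall s \near t, cst (G (cl t)) s = (G \o cl) s.
  have H0 : \forall s \near t, 0 <= cl s <= 1 -> G (cl s) = G (cl t).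
    exact: (ccl t _ (lG _ (cl01 t))).
  by apply: filterS H0 => s H0; rewrite /= H0.
by apply: near_eq_is_derive H _; exact: is_derive_cst.
Qed.

(** At a jump ym takes the value on the left, and yp is the value on the right.
    Subtracting from ym the sum of the jumps before t leaves a locally constant
    function. *)
Lemma sum_of_jumps (ym yp J : R -> R) (ts : seq R) : uniq ts ->
  (forall t, t \in ts -> 0 <= t <= 1) ->
  (forall t : R, 0 <= t <= 1 -> t \notin ts -> J t = 0) ->
  (forall t : R, 0 <= t <= 1 -> yp t - ym t = J t) ->
  (forall t : R, 0 <= t <= 1 -> \forall s \near t, 0 <= s <= 1 -> s < t -> ym s = ym t) ->
  (forall t : R, 0 <= t <= 1 -> \forall s \near t, 0 <= s <= 1 -> t < s -> ym s = yp t) ->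
  ym 1 - ym 0 = \sum_(t <- ts | t < 1) J t.
Proof.
move=> uts ts01 J0 jump left right.
pose S t := \sum_(u <- ts | u < t) J u.
have gap (t : R) : \forall s \near t, forall u, u \in ts -> u != t -> (u < s) = (u < t).
  elim: ts {uts ts01 J0 S} => [|a ts IH]; first by apply: filterE.
  have Ha : \forall s \near t, a != t -> (a < s) = (a < t).
    have [->|at_] := eqVneq a t; first by apply: filterE.
    have [lt|gt|E] := ltrgtP a t; last by rewrite E eqxx in at_.
      have H0 : \forall s \near t, a < s.
        exact: (@cvgr_gt _ _ (nbhs t) _ id t (@cvg_id _ _) a lt).
      by apply: filterS H0 => s ->.
    have H0 : \forall s \near t, s < a.
      exact: (@cvgr_lt _ _ (nbhs t) _ id t (@cvg_id _ _) a gt).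
    by apply: filterS H0 => s sa _; rewrite ltNge (ltW sa).
  apply: filterS2 Ha IH => s H1 H2 u; rewrite inE => /orP[/eqP-> //|]; exact: H2.
have H : forall t : R, 0 <= t <= 1 -> \forall s \near t, 0 <= s <= 1 -> ym s - S s = ym t - S t.
  move=> t t01; have H1 := left t t01; have H2 := right t t01; have H3 := gap t.
  near=> s => s01.
  have gs : forall u, u \in ts -> u != t -> (u < s) = (u < t) by near: s.
  have [st|ts'|->//] := ltrgtP s t.
    have -> : ym s = ym t by move: s01 st; near: s.
    congr (_ - _); rewrite /S big_seq_cond [RHS]big_seq_cond; apply: eq_bigl => u.
    apply: andb_id2l => uts'; have [->|ut] := eqVneq u t; last exact: gs.
    by rewrite ltxx ltNge (ltW st).
  have -> : ym s = yp t by move: s01 ts'; near: s.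
  have -> : S s = S t + J t.
    rewrite /S (bigID (fun u => u == t)) /= addrC; congr (_ + _).
      rewrite big_seq_cond [RHS]big_seq_cond; apply: eq_bigl => u.
      case uts': (u \in ts) => //=; have [->|ut] := eqVneq u t; first by rewrite ltxx andbF.
      by rewrite andbT; apply: gs.
    have [tin|tnot] := boolP (t \in ts); last first.
      rewrite J0 // big_seq_cond big1 // => u /andP[uin /andP[_ /eqP E]].
      by rewrite E (negbTE tnot) in uin.
    rewrite big_mkcond (bigD1_seq t) //= eqxx andbT ts' big1 ?addr0 // => u ut.
    by rewrite (negbTE ut) andbF.
  rewrite -(jump t t01); ring.
have := locally_constant_segment H.
rewrite (_ : S 0 = 0) ?subr0.
  by move=> ->; rewrite /S; ring.
rewrite /S big_seq_cond big1 // => u /andP[/ts01/andP[u0 _]].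
by rewrite ltNge u0.
Unshelve. all: by end_near.
Qed.

End Jumps.

Section LiftingValue.
Variables (R : realType) (d k : nat).
Notation n := (d.+1 + k.+1)%N.
Variables (C : pcomplex R d.+1 n) (o : face C -> gr R d.+1 n).
Hypothesis ho : orientation o.
Variables (nu : facet C -> face C -> 'rV[R]_n) (hnu : inner_normals nu).
Variables (s : face C -> nat) (M : forall f, 'M[R]_(s f, n)).
Variables (B : forall f, 'M[R]_(s f, d.+2)).
Hypothesis MB : forall f, body_cone o f (M f) (B f).
Variable p : facet C -> 'M[R]_(d.+1, n).
Hypothesis pP : forall e, aff_indep (p e) /\ affhull (sval e) = span_pts (p e).
Variable om : face C -> R.
Hypothesis equil : forall e : facet C, \sum_(f | incident e f) om f *: nu e f = 0.
Variable l : gr R k n.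

Definition weight (f : face C) : R := om f * dist l (o f).

Let Q := face_frame o.
Let frame (l' : gr R k n) : 'M[R]_(k.+1, d.+2 + k.+1) := homog (points l').

(** A relation rather than a function: the value is unique for planes that meet
    no face of nonzero weight, by [linking_value_unique], but not in general. *)
Definition linking_value (l' : gr R k n) (y : R) :=
  exists2 v, regular B Q weight (frame l') v & degree B Q weight (frame l') v = y.

Definition off_cycle (l' : gr R k n) := forall f, weight f != 0 -> ~ meets_face l' f.

Lemma frame_free_rows l' : row_free (frame l').
Proof. exact: points_indep. Qed.

(** A nonzero vector of the cone is a positive multiple of a point of the face. *)
Lemma unmet_misses l' f : ~ meets_face l' f -> misses (B f) (Q f) (frame l').
Proof.
move=> nm a Ca aP; apply/eqP; apply: contra_notT nm => a0.
have [_ BP _] := MB f.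
have [x [c [c0 bx xE]]] := cone_section BP Ca a0.
exists x; split=> //; rewrite /plane /span_pts /=.
by rewrite -(scalerK (lt0r_neq0 c0) (homog x)) scalemx_sub // -xE.
Qed.

Lemma linking_value_unique l' y y' :
  off_cycle l' -> linking_value l' y -> linking_value l' y' -> y = y'.
Proof.
move=> cl [v rv <-] [v' rv' <-].
apply: (complex_degree_constant ho hnu MB pP equil (l := l)) => //.
  exact: frame_free_rows.
by move=> f wf; apply: unmet_misses; exact: cl.
Qed.

(** A common point is a linear relation between the rows of the determinant that
    gives the distance. *)
Lemma weight_meets f : meets_face l f -> weight f = 0.
Proof.
move=> [x [xl xf]]; rewrite /weight dist_incline.
suff -> : incline (homog (points (o f))) (homog (points l)) = 0 by rewrite mul0r mulr0.
have xo : plane (o f) x by rewrite ho; exact: sub_affhull.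
have [a xa] := submxP xo; have [c xc] := submxP xl.
apply/eqP; apply: contraT; rewrite -unitfE -unitmxE -row_free_unit => fW.
have : row_mx a (- c) = 0.
  by apply: (proj2 (row_free0P _) fW); rewrite mul_row_col mulNmx -xa -xc subrr.
move/eqP; rewrite row_mx_eq0 => /andP[/eqP az _].
by have := homog_neq0 x; rewrite xa az mul0mx eqxx.
Qed.

Section Jump.
Variables (H : R -> gr R k n) (t : R).
Hypothesis cH : forall c, (fun u => pluecker (H u) c) @ t --> pluecker (H t) c.
Hypothesis cross : forall f x, weight f != 0 -> plane (H t) x -> body f x ->
  relint (body f) x /\ transversal_at H t x (affhull (body f)).

Definition face_jump f : R :=
  if `[< meets_face (H t) f >] then crossing_sign o H f t else 0.

Definition path_jump : R := \sum_f weight f * face_jump f.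

Lemma dnbhs_shift (S : R -> Prop) :
  (\forall h \near (0 : R)^', S (h + t)) -> \forall u \near t, u != t -> S u.
Proof.
move=> H0; have H1 : \forall h \near (0 : R), h != 0 -> S (h + t).
  exact: H0.
have ct : (fun u => u - t) @ t --> (0 : R).
  by rewrite -(subrr t); apply: cvgB; [exact: cvg_id|exact: cvg_cst].
have H2 : \forall u \near t, u - t != 0 -> S (u - t + t) by exact: (ct _ H1).
by apply: filterS H2 => u; rewrite subr_eq0 subrK.
Qed.

Section Lifted.
Variable A : R -> 'M[R]_k.+1.
Hypothesis cA : (fun u => A u *m frame (H u)) @ t --> frame (H t).
Hypothesis A_gt0 : \forall u \near t, 0 < \det (A u).
Variable v : 'rV[R]_(d.+2 + k.+1).
Hypothesis v_walls : off_walls B Q (frame (H t)) v.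
Hypothesis v_hyper : forall f, incline (Q f) (frame (H t)) = 0 ->
  ~~ (v <= col_mx (Q f) (frame (H t)))%MS.

Lemma sg_dist l' f : Num.sg (dist l' (o f)) = Num.sg (incline (Q f) (frame l')).
Proof.
rewrite dist_incline sgrM [X in _ * X]gtr0_sg ?mulr1 //.
by rewrite invr_gt0 mulr_gt0 // vol_gt0 // points_indep.
Qed.

(** Here a and b are the local degrees before and after time t.  Away from f the
    local degree does not change.  When the plane crosses f, only one sign of the
    determinant lets f cover v, and f then contributes that sign: the local degree
    goes from 0 to the sign of dist after t, or from the sign of dist before t
    to 0.  Both times it grows by the sign of the derivative. *)
Lemma face_jumpP f : weight f != 0 -> exists a b, [/\ b - a = face_jump f,
  \forall u \near t, u != t ->
    regular_value (B f) (Q f) (A u *m frame (H u)) v /\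
    local_degree (B f) (Q f) (A u *m frame (H u)) v = if t < u then b else a &
  ~ meets_face (H t) f -> regular_value (B f) (Q f) (frame (H t)) v /\
    local_degree (B f) (Q f) (frame (H t)) v = a].
Proof.
move=> wf; have [AM BP EB] := MB f; have [uB _ AB] := BP.
have fP := frame_free_rows (H t).
have [mt|nm] := pselect (meets_face (H t) f); last first.
  have rv : regular_value (B f) (Q f) (frame (H t)) v.
    by apply: generic_regular; [exact: v_walls|exact: v_hyper].
  exists (local_degree (B f) (Q f) (frame (H t)) v), (local_degree (B f) (Q f) (frame (H t)) v).
  split; [|  |by split].
    by rewrite subrr /face_jump; case: asboolP.
  have H1 : \forall u \near t, regular_value (B f) (Q f) (A u *m frame (H u)) v /\
      local_degree (B f) (Q f) (A u *m frame (H u)) v = local_degree (B f) (Q f) (frame (H t)) v.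
    exact: (local_degree_near uB cA fP (unmet_misses nm) rv).
  by apply: filterS H1 => u [H1 H2] _; split=> //; rewrite H2 if_same.
have [x [xH xf]] := mt; have [rx tr] := cross wf xH xf.
have [a0 _ xa] := proj1 (AB x) xf.
have ra := relint_rint (points_indep (o f)) (affhull_body ho f) BP rx xa.
have xo : plane (o f) x by rewrite ho; exact: sub_affhull.
rewrite -ho in tr.
have [rW [dl dl0 [dE sgE]]] := transversal_crossing xo tr.
have D0 : incline (Q f) (frame (H t)) = 0.
  apply/eqP; apply: contraT; rewrite -unitfE -unitmxE -row_free_unit => /eqP fW.
  have : (d.+2 + k.+1)%N = n by rewrite -[LHS]fW -[RHS]rW.
  by move/eqP; rewrite addSn eqn_leq ltnn.
have aP : (a0 *m Q f <= frame (H t))%MS by rewrite /Q /face_frame -xa.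
have [al al0 near_al] : exists2 al : R, al != 0 & \forall u \near t,
    incline (Q f) (A u *m frame (H u)) != 0 ->
    regular_value (B f) (Q f) (A u *m frame (H u)) v /\
    local_degree (B f) (Q f) (A u *m frame (H u)) v =
      if 0 < incline (Q f) (A u *m frame (H u)) * al
      then Num.sg (incline (Q f) (A u *m frame (H u))) else 0.
  exact: (local_degree_crossing uB cA fP ra aP rW (v_hyper D0)).
(* the local degree when the determinant has the sign sg *)
pose val (sg : R) := if 0 < sg * al then sg else 0.
exists (val (- Num.sg dl)), (val (Num.sg dl)); split=> //.
- rewrite /face_jump; case: asboolP => // _; rewrite /crossing_sign dE /val mulNr oppr_gt0.
  have [p1|n1|z1] := ltrgtP 0 (Num.sg dl * al).
  + by rewrite subr0.
  + by rewrite opprK add0r.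
  + by move/eqP: z1; rewrite eq_sym mulf_eq0 sgr_eq0 (negbTE dl0) (negbTE al0).
- have sgu : \forall u \near t, u != t ->
      Num.sg (dist (H u) (o f)) = Num.sg (u - t) * Num.sg dl.
    by apply: dnbhs_shift; apply: filterS sgE => h ->; rewrite addrK.
  near=> u => ut.
  have Au : 0 < \det (A u) by near: u.
  have su : Num.sg (dist (H u) (o f)) = Num.sg (u - t) * Num.sg dl by move: ut; near: u.
  have Du : Num.sg (incline (Q f) (A u *m frame (H u))) = Num.sg (u - t) * Num.sg dl.
    by rewrite incline_change sgrM gtr0_sg // mul1r -sg_dist.
  have Dn : incline (Q f) (A u *m frame (H u)) != 0.
    by rewrite -sgr_eq0 Du mulf_neq0 // sgr_eq0 ?subr_eq0.
  have [rv ->] : regular_value (B f) (Q f) (A u *m frame (H u)) v /\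
    local_degree (B f) (Q f) (A u *m frame (H u)) v =
      if 0 < incline (Q f) (A u *m frame (H u)) * al
      then Num.sg (incline (Q f) (A u *m frame (H u))) else 0.
    by move: Dn; near: u.
  split=> //.
  have -> : (0 < incline (Q f) (A u *m frame (H u)) * al) =
      (0 < Num.sg (incline (Q f) (A u *m frame (H u))) * al).
    by rewrite -sgr_gt0 sgrM -[RHS]sgr_gt0 sgrM sgr_id.
  rewrite Du -/(val _); have [tu|tu] := ltP t u.
    by rewrite gtr0_sg ?subr_gt0 // mul1r.
  by rewrite ltr0_sg ?mulN1r // subr_lt0 lt_neqAle ut.
Unshelve. all: by end_near.
Qed.

End Lifted.

(** All the faces are treated with the same v, chosen generic for the plane
    at time t. *)
Lemma path_jumpP : exists ym yp, [/\ yp - ym = path_jump,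
  \forall u \near t, u < t -> linking_value (H u) ym,
  \forall u \near t, t < u -> linking_value (H u) yp &
  off_cycle (H t) -> linking_value (H t) ym].
Proof.
have [A [cA A_gt0]] := path_lift cH.
have [v [vw _ _ vh]] := exists_generic B Q (frame (H t)) 0 0.
have /choice[ab abP] : forall f, exists ab : R * R, weight f != 0 ->
  [/\ ab.2 - ab.1 = face_jump f,
  \forall u \near t, u != t ->
    regular_value (B f) (Q f) (A u *m frame (H u)) v /\
    local_degree (B f) (Q f) (A u *m frame (H u)) v = if t < u then ab.2 else ab.1 &
  ~ meets_face (H t) f -> regular_value (B f) (Q f) (frame (H t)) v /\
    local_degree (B f) (Q f) (frame (H t)) v = ab.1].
  move=> f; have [wf|wf] := eqVneq (weight f) 0; first by exists (0, 0).
  have [a [b [H1 H2 H3]]] := face_jumpP cA A_gt0 vw vh wf.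
  by exists (a, b).
have near_all : \forall u \near t, u != t -> 0 < \det (A u) /\ forall f, weight f != 0 ->
    regular_value (B f) (Q f) (A u *m frame (H u)) v /\
    local_degree (B f) (Q f) (A u *m frame (H u)) v = if t < u then (ab f).2 else (ab f).1.
  have H1 : \forall u \near t, forall f, weight f != 0 -> u != t ->
      regular_value (B f) (Q f) (A u *m frame (H u)) v /\
      local_degree (B f) (Q f) (A u *m frame (H u)) v = if t < u then (ab f).2 else (ab f).1.
    apply: (@filter_forall _ _ _ (nbhs t) _) => f; have [wf|wf] := eqVneq (weight f) 0.
      by apply: filterE => u.
    by have [_ H2 _] := abP f wf; apply: filterS H2 => u H2 _; exact: H2.
  by apply: filterS2 A_gt0 H1 => u H1 H2 ut; split=> // f wf; exact: H2.
have val u : u != t -> (0 < \det (A u) /\ forall f, weight f != 0 ->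
    regular_value (B f) (Q f) (A u *m frame (H u)) v /\
    local_degree (B f) (Q f) (A u *m frame (H u)) v = if t < u then (ab f).2 else (ab f).1) ->
    linking_value (H u) (\sum_f weight f * if t < u then (ab f).2 else (ab f).1).
  move=> ut [Au Hu]; exists v.
    by move=> f wf; have [/(regular_value_change _ _ _ Au)] := Hu f wf.
  apply: eq_bigr => f _; have [->|wf] := eqVneq (weight f) 0; first by rewrite !mul0r.
  by have [_ <-] := Hu f wf; rewrite local_degree_change.
exists (\sum_f weight f * (ab f).1), (\sum_f weight f * (ab f).2); split.
- rewrite -sumrB; apply: eq_bigr => f _; rewrite -mulrBr.
  have [->|wf] := eqVneq (weight f) 0; first by rewrite !mul0r.
  by have [-> _ _] := abP f wf.
- apply: filterS near_all => u Hu ut; have tn : u != t by rewrite lt_eqF.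
  have := val u tn (Hu tn); by rewrite ltNge (ltW ut).
- apply: filterS near_all => u Hu ut; have tn : u != t by rewrite gt_eqF.
  have := val u tn (Hu tn); by rewrite ut.
move=> cl; exists v.
  by move=> f wf; have [_ _ /(_ (cl f wf))[]] := abP f wf.
apply: eq_bigr => f _; have [->|wf] := eqVneq (weight f) 0; first by rewrite !mul0r.
by have [_ _ /(_ (cl f wf))[_ ->]] := abP f wf.
Qed.

End Jump.

Lemma near_notin (ts : seq R) (t : R) : \forall u \near t, u != t -> u \notin ts.
Proof.
elim: ts => [|a ts IH]; first by apply: filterE.
have Ha : \forall u \near t, u != t -> u != a.
  have [->|at_] := eqVneq a t; first by apply: filterE.
  have H0 : \forall u \near t, u - a != 0.
    apply: (@cvgr_neq0 _ _ _ (nbhs t) _ (fun u => u - a) (t - a)).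
      by apply: cvgB; [exact: cvg_id|exact: cvg_cst].
    by rewrite subr_eq0 eq_sym.
  by apply: filterS H0 => u; rewrite subr_eq0.
by apply: filterS2 Ha IH => u H1 H2 ut; rewrite inE negb_or H1 // H2.
Qed.

(** [path_jumpP] gives at each time the linking values just before and just after
    it, and off the finitely many times of intersection these agree with the value
    at that time; then [sum_of_jumps] applies.  A crossing at the final time is not
    counted there, and its weight is 0. *)
Lemma lifting_linking_value (l0 : gr R k n) (H : R -> gr R k n) :
  (forall f : face C, ~ meets_face l0 f) -> simple_path C H l0 l ->
  exists y0 y1, [/\ linking_value l0 y0, linking_value l y1 &
    lifting o om H l = y1 - y0].
Proof.
move=> nl0 [H0 H1 dH fT crossH].
have cH (t : R) : 0 <= t <= 1 ->
    forall c, (fun u => pluecker (H u) c) @ t --> pluecker (H t) c.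
  move=> t01 c; have /derivable1_diffP/differentiable_continuous := dH t c t01.
  exact.
have cross (t : R) : 0 <= t <= 1 -> forall f x, weight f != 0 ->
    plane (H t) x -> body f x ->
    relint (body f) x /\ transversal_at H t x (affhull (body f)).
  move=> /andP[t0 t1] f x wf xH xf; apply: crossH => //; rewrite t0 lt_neqAle t1 andbT.
  apply: contra_neq wf => t1E; apply: weight_meets; exists x; split=> //.
  by rewrite -H1 -t1E.
have [ts0 Ts0] := proj1 (finite_seqP _) fT.
pose ts := undup ts0.
have tsP (t : R) : t \in ts <-> 0 <= t <= 1 /\ exists f : face C, meets_face (H t) f.
  by rewrite mem_undup; have := Ts0; move/seteqP => [S1 S2]; split=> [/S2|/S1].
have /choice[yy yyP] : forall t : R, exists yy : R * R, 0 <= t <= 1 ->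
    [/\ yy.2 - yy.1 = path_jump H t,
    \forall u \near t, u < t -> linking_value (H u) yy.1,
    \forall u \near t, t < u -> linking_value (H u) yy.2 &
    off_cycle (H t) -> linking_value (H t) yy.1].
  move=> t; have [t01|t01] := boolP (0 <= t <= 1); last by exists (0, 0).
  by have [ym [yp HH]] := path_jumpP (cH t t01) (cross t t01); exists (ym, yp).
have off_crossings (t : R) : 0 <= t <= 1 -> t \notin ts -> off_cycle (H t).
  by move=> t01 /negP tn f _ mf; apply: tn; apply/tsP; split=> //; exists f.
have one01 : 0 <= (1 : R) <= 1 by rewrite ler01 lexx.
have zero01 : 0 <= (0 : R) <= 1 by rewrite ler01 lexx.
have off_cycle1 : off_cycle (H 1).
  by move=> f wf mf; move/eqP: wf; apply; apply: weight_meets; rewrite -H1.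
have off_cycle0 : off_cycle (H 0) by move=> f _; rewrite H0.
have near_off_cycle (t : R) : \forall u \near t, u != t -> 0 <= u <= 1 -> off_cycle (H u).
  by apply: filterS (near_notin ts t) => u Hu ut u01; apply: off_crossings => //; exact: Hu.
exists (yy 0).1, (yy 1).1; split.
- by have [_ _ _ Hv] := yyP 0 zero01; rewrite -H0; exact: Hv.
- by have [_ _ _ Hv] := yyP 1 one01; rewrite -H1; exact: Hv.
rewrite (@sum_of_jumps R (fun t => (yy t).1) (fun t => (yy t).2) (path_jump H) ts (undup_uniq _)) //.
- transitivity (\sum_(t <- ts) path_jump H t); last first.
    rewrite [RHS]big_mkcond; apply: eq_big_seq => t /tsP[/andP[_ t1] _].
    case: ltP => // t1'; have -> : t = 1 by apply/le_anti; rewrite t1 t1'.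
    rewrite /path_jump big1 // => f _; rewrite /face_jump.
    case: asboolP => [mf|_]; last by rewrite mulr0.
    by rewrite (weight_meets (f := f)) ?mul0r // -H1.
  rewrite /lifting /path_jump exchange_big; apply: eq_bigr => f _ /=.
  rewrite -mulr_sumr /weight.
  have -> : sign_mult o H f = \sum_(t <- ts) face_jump H t f.
    rewrite fsbig_seq ?undup_uniq // /sign_mult.
    transitivity (\sum_(t \in [set t | 0 <= t <= 1 /\ meets_face (H t) f]) face_jump H t f).
      apply: eq_fsbigr => t; rewrite inE => -[_ mf]; rewrite /face_jump.
      by case: asboolP.
    apply: fsbig_widen => t /=; first by move=> [t01 mf]; apply/tsP; split=> //; exists f.
    move=> [/tsP[t01 _] nm]; rewrite /face_jump; case: asboolP => // mf.
    by case: nm.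
  ring.
- by move=> t /tsP[].
- move=> t t01 tn; rewrite /path_jump big1 // => f _; rewrite /face_jump.
  by case: asboolP => [mf|_]; [case/negP: tn; apply/tsP; split=> //; exists f|rewrite mulr0].
- by move=> t /yyP[].
- move=> t t01; have [_ Hl _ _] := yyP t t01.
  apply: filterS2 Hl (near_off_cycle t) => u Hu cu u01 ut.
  have [_ _ _ Hv] := yyP u u01.
  have cl : off_cycle (H u) by apply: cu => //; rewrite lt_eqF.
  by apply: (linking_value_unique cl); [exact: Hv|exact: Hu].
- move=> t t01; have [_ _ Hr _] := yyP t t01.
  apply: filterS2 Hr (near_off_cycle t) => u Hu cu u01 ut.
  have [_ _ _ Hv] := yyP u u01.
  have cl : off_cycle (H u) by apply: cu => //; rewrite gt_eqF.
  by apply: (linking_value_unique cl); [exact: Hv|exact: Hu].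
Qed.

End LiftingValue.

Section Independence.
Variables (R : realType) (d k : nat).
Notation n := (d.+1 + k.+1)%N.

(** The dimensions are written so that a face frame stacked on a plane frame is a
    square matrix by the form of its type. *)
Theorem lifting_path_independent (C : pcomplex R d.+1 n)
    (nu : facet C -> face C -> 'rV[R]_n) (hnu : inner_normals nu)
    (w : force_load (complex_framework hnu)) (hw : equilibrium w)
    (o : face C -> gr R d.+1 n) (ho : orientation o)
    (l0 l : gr R k n)
    (hl0 : plane l0 `&` convhull (\bigcup_(f in [set: face C]) body f) = set0)
    (H1 H2 : R -> gr R k n) :
  simple_path C H1 l0 l -> simple_path C H2 l0 l ->
  lifting o w H1 l = lifting o w H2 l.
Proof.
move=> hH1 hH2.
have [s [M [B MB]]] := body_cones ho.
have [p pP] := facet_points C.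
have nl0 (f : face C) : ~ meets_face l0 f.
  move=> [x [xl xf]]; suff : (set0 : set 'rV[R]_n) x by [].
  by rewrite -hl0; split=> //; apply: sub_gen_smallest; exists f.
have [y0 [y1 [v0 v1 ->]]] := lifting_linking_value ho hnu MB pP hw nl0 hH1.
have [z0 [z1 [u0 u1 ->]]] := lifting_linking_value ho hnu MB pP hw nl0 hH2.
have cl0 : off_cycle o w l l0 by move=> f _; exact: nl0.
have cl : off_cycle o w l l by move=> f wf /(weight_meets ho w) wf0; rewrite wf0 eqxx in wf.
rewrite (linking_value_unique ho hnu MB pP hw cl0 v0 u0).
by rewrite (linking_value_unique ho hnu MB pP hw cl v1 u1).
Qed.

End Independence.

Theorem theorem5p14 (R : realType) (n m : nat) (m_ge1 : (1 <= m)%N)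
    (lt_mn : (m < n)%N) (C : pcomplex R m n)
    (nu : facet C -> face C -> 'rV[R]_n) (hnu : inner_normals nu)
    (w : force_load (complex_framework hnu)) (hw : equilibrium w)
    (o : face C -> gr R m n) (ho : orientation o)
    (l0 : gr R (n - m - 1) n)
    (hl0 : plane l0 `&` convhull (\bigcup_(f in [set: face C]) body f) = set0)
    (l : gr R (n - m - 1) n)
    (H1 H2 : R -> gr R (n - m - 1) n)
    (hH1 : simple_path C H1 l0 l) (hH2 : simple_path C H2 l0 l) :
  lifting o w H1 l = lifting o w H2 l.
Proof.
move: C nu hnu w hw o ho l0 hl0 l H1 H2 hH1 hH2.
case: m m_ge1 lt_mn => [m0|d _ lt_mn]; first by exfalso; clear -m0; rewrite ltnn in m0.
have nE : n = (d.+1 + (n - d.+1 - 1).+1)%N.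
  by rewrite -subnDA addn1 -subSn // subSS subnKC // ltnW.
move: (n - d.+1 - 1)%N nE => k nE; subst n => C nu hnu w hw o ho l0 hl0 l H1 H2.
exact: lifting_path_independent.
Qed.
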